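(* Let $n\ge2$, $s\in(0,1)$, and let $\omega\subseteq\mathbb{R}^n$ be a bounded open set such that $\Omega:=\omega\times\mathbb{R}$ has Lipschitz boundary. Assume that $0\in\partial\omega$ and that there exists a bounded (open) set $S\subseteq\mathbb{R}^n$ with boundary of class $C^{1,\alpha}$, for some $\alpha\in(s,1)$, contained in $\omega$ and such that $0\in\partial S$. Then, for every $\varepsilon>0$, there exist $\delta>0$, a function $\psi\in C^\infty_0(\mathbb{R}^n\setminus\overline{\omega},[0,\varepsilon])$ and an $s$-minimal set $E$ in $\Omega$ such that $E\setminus\Omega=E_0\setminus\Omega$, where $E_0:=\{x_{n+1}<\psi(x',x_n)\}$, and $$E\cap(S\times\mathbb{R})\supseteq(S\cap B_\delta)\times[0,\delta].$$
   Context: Points of $\mathbb{R}^{n+1}$ are written $X=(x',x_n,x_{n+1})\in\mathbb{R}^{n-1}\times\mathbb{R}\times\mathbb{R}$. For $s\in(0,1)$ and measurable $A,B\subseteq\mathbb{R}^{n+1}$, $L_s(A,B):=\iint_{A\times B}|x-y|^{-(n+1+s)}\,dx\,dy$. For an open set $U\subseteq\mathbb{R}^{n+1}$, $\operatorname{Per}_s(E,U):=L_s(E\cap U,E^c\cap U)+L_s(E\cap U,E^c\cap U^c)+L_s(E\cap U^c,E^c\cap U)$. If $U$ is bounded, $E$ is $s$-minimal in $U$ if $\operatorname{Per}_s(E,U)<+\infty$ and $\operatorname{Per}_s(E,U)\le\operatorname{Per}_s(F,U)$ for all $F$ with $E\setminus U=F\setminus U$; $E$ is $s$-minimal in the cylinder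 $\Omega$ if it is $s$-minimal in every bounded open $\Omega'\subseteq\Omega$. $B_\delta=\{x\in\mathbb{R}^n:|x|<\delta\}$. $C^\infty_0(A,[0,\varepsilon])$ denotes smooth compactly supported functions on $\mathbb{R}^n$ with values in $[0,\varepsilon]$ and support in $A$. *)

(* Defs.v *)
From HB Require Import structures.
From mathcomp Require Import all_boot all_order all_algebra.
From mathcomp Require Import all_classical all_reals all_analysis.
Set Implicit Arguments. Unset Strict Implicit. Unset Printing Implicit Defensive.
Import Order.TTheory GRing.Theory Num.Theory.
Import numFieldNormedType.Exports.
Local Open Scope classical_set_scope.
Local Open Scope ring_scope.

Section Defs.
Variable R : realType.

Definition enorm (m : nat) (x : 'rV[R]_m) : R :=
  Num.sqrt (\sum_(i < m) x ord0 i ^+ 2).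

Definition ebounded (m : nat) (A : set 'rV[R]_m) : Prop :=
  exists M : R, forall x, A x -> enorm x <= M.

Definition bdry (m : nat) (A : set 'rV[R]_m) : set 'rV[R]_m :=
  closure A `\` interior A.

Definition ext_row (m : nat) (y : 'rV[R]_m) (t : R) : 'rV[R]_m.+1 :=
  \row_(i < m.+1) match unlift ord_max i with Some j => y ord0 j | None => t end.

(* integral over R^m of a nonnegative function (Tonelli: equals the
   integral w.r.t. m-dimensional Lebesgue measure for measurable f) *)
Fixpoint iint (m : nat) : ('rV[R]_m -> \bar R) -> \bar R :=
  match m with
  | 0 => fun f => f 0
  | m'.+1 => fun f =>
      (\int[@lebesgue_measure R]_(t in setT) iint (fun y => f (ext_row y t)))%E
  end.

Definition borel (m : nat) (A : set 'rV[R]_m) : Prop :=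
  <<s [set B : set 'rV[R]_m | open B] >> A.

Definition vol (m : nat) (A : set 'rV[R]_m) : \bar R :=
  iint (fun x => (\1_A x)%:E).

Definition lmeasurable (m : nat) (A : set 'rV[R]_m) : Prop :=
  exists B N, borel B /\ borel N /\ vol N = 0%E /\
    (A `\` B) `|` (B `\` A) `<=` N.

Definition Ls (m : nat) (s : R) (A B : set 'rV[R]_m) : \bar R :=
  iint (fun x => iint (fun y =>
    (\1_A x * \1_B y * (enorm (x - y)) `^ (- (m%:R + s)))%:E)).

Definition Per_s (m : nat) (s : R) (E U : set 'rV[R]_m) : \bar R :=
  (Ls s (E `&` U) (~` E `&` U) + Ls s (E `&` U) (~` E `&` ~` U)
   + Ls s (E `&` ~` U) (~` E `&` U))%E.

Definition s_minimal (m : nat) (s : R) (E U : set 'rV[R]_m) : Prop :=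
  (Per_s s E U < +oo)%E /\
  forall F, lmeasurable F -> F `\` U = E `\` U -> (Per_s s E U <= Per_s s F U)%E.

Definition s_minimal_in (m : nat) (s : R) (E Omega : set 'rV[R]_m) : Prop :=
  forall O', open O' -> ebounded O' -> O' `<=` Omega -> s_minimal s E O'.

Definition lipschitz_fun (m : nat) (g : 'rV[R]_m -> R) : Prop :=
  exists L : R, forall x y, `|g x - g y| <= L * enorm (x - y).

Definition C1alpha_fun (m : nat) (alpha : R) (g : 'rV[R]_m -> R) : Prop :=
  (forall x, differentiable g x) /\
  forall v : 'rV[R]_m, exists C : R, forall x y,
    `|'D_v g x - 'D_v g y| <= C * (enorm (x - y)) `^ alpha.

(* near every boundary point, U is (after a rigid motion) the subgraph
   {z_i < g(z)} of a function g not depending on z_i and satisfying P *)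
Definition graph_boundary (m : nat) (P : ('rV[R]_m -> R) -> Prop)
    (U : set 'rV[R]_m) : Prop :=
  forall p, bdry U p ->
  exists (r : R) (Q : 'M[R]_m) (i : 'I_m) (g : 'rV[R]_m -> R),
    0 < r /\ Q *m Q^T = 1%:M /\ P g /\
    (forall z t, g z = g (z + (t - z ord0 i) *: delta_mx ord0 i)) /\
    forall x, enorm (x - p) < r ->
      (U x <-> ((x - p) *m Q) ord0 i < g ((x - p) *m Q)).

Definition lipschitz_boundary (m : nat) (U : set 'rV[R]_m) : Prop :=
  graph_boundary (@lipschitz_fun m) U.

Definition C1alpha_boundary (m : nat) (alpha : R) (U : set 'rV[R]_m) : Prop :=
  graph_boundary (@C1alpha_fun m alpha) U.

Fixpoint Ck (m : nat) (k : nat) (f : 'rV[R]_m -> R) : Prop :=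
  match k with
  | 0 => continuous f
  | k'.+1 => (forall x, differentiable f x) /\ forall v, Ck k' ('D_v f)
  end.

Definition smooth (m : nat) (f : 'rV[R]_m -> R) : Prop := forall k, Ck k f.

Definition Cinf0 (m : nat) (A : set 'rV[R]_m) (eps : R) (f : 'rV[R]_m -> R) : Prop :=
  smooth f /\ compact (closure [set x | f x != 0]) /\
  closure [set x | f x != 0] `<=` A /\ (forall x, 0 <= f x <= eps).

Definition xh (n : nat) (X : 'rV[R]_n.+1) : 'rV[R]_n :=
  \row_(i < n) X ord0 (widen_ord (leqnSn n) i).
Definition xl (n : nat) (X : 'rV[R]_n.+1) : R := X ord0 ord_max.

Definition cyl (n : nat) (A : set 'rV[R]_n) : set 'rV[R]_n.+1 :=
  [set X | A (xh X)].

End Defs.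

(* Main.v *)
Require Import Defs.
From HB Require Import structures.
From mathcomp Require Import all_boot all_order all_algebra.
From mathcomp Require Import all_classical all_reals all_analysis.
From mathcomp Require Import measurable_realfun ring lra.
Set Implicit Arguments. Unset Strict Implicit. Unset Printing Implicit Defensive.
Import Order.TTheory GRing.Theory Num.Theory.
Import numFieldNormedType.Exports.
Local Open Scope classical_set_scope.
Local Open Scope ring_scope.

(** [psi] is a small bump far away from [omega].  The set [E] minimizes the
    [s]-perimeter among the sets that contain [{xl < 0}] and the exterior datum
    and are contained in [{xl <= eps}]; a minimizer exists because the perimeter
    is submodular, so that the upper limit of a fast minimizing sequence is again
    minimizing.  Half-spaces are calibrated, hence the constraint is never active
    and [E] is [s]-minimal in the cylinder.

    If [phi] is positive on a set [D] disjoint from [E], and at every point of [D]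
    the fractional mean curvature of the superlevel sets of [phi] is bounded by a
    negative constant, then adding [D] to [E] would lower the perimeter; hence [D]
    is null.  This is applied to the barriers
    [<nu, x - p> - g y - b |X - Q|^(1 + alpha)] at boundary points [p] of [S]:
    the bump makes them valid for a large slope [g]; then the half-space [xl < 0]
    together with the wedge already known to lie in [E] produces, near its vertex,
    a gain of order [r^(-s)] at scale [r], which beats all the losses and lowers
    [g] by a fixed amount, down to [g = 0]; finally the vertex is lifted from
    height [0] to height [y0].  Since [S] is [C^{1,alpha}], the superlevel sets of
    the last barriers cover the points of [S] near [0], up to a null set that can
    be added to [E]. *)

(** * Lebesgue measure on row vectors *)

(** The condition [s < alpha] enters by scaling: a region of width [rho ^ (1 + alpha)] at distance
    [rho] carries kernel mass [rho ^ (alpha - s)] in the dyadic shell of radius [rho], and this is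
    summable near [0]. The curvature integrals exist only as principal values. Every pointwise
    comparison is therefore made with the kernel cut off at distance [t], and the cut-off is removed
    only for double integrals.

    Each lowering of the slope makes the curvature [b] of the barrier larger. Finitely many steps
    suffice because the decrement depends on the initial slope alone: compared with the gain
    [r ^ (- s)], the loss due to [b] is of order [b * r ^ s], and it is absorbed by choosing [r]
    after [b].

    All constants have to be uniform in the boundary point and its normal, since infinitely many
    barriers are used, each with its own exceptional null set. The null sets can be collected only
    after the barriers have been replaced by countably many rational cubes. *)

Lemma eq_ler (R : numDomainType) (x y : R) : x = y -> x <= y.
Proof. by move->. Qed.

Section MeasurableSets.
Context d (T : measurableType d) (R : realType).
Implicit Types f g : T -> R.

Lemma measurable_ltr_set f g : measurable_fun setT f -> measurable_fun setT g ->
  measurable [set x | f x < g x].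
Proof.
move=> mf mg; have /(_ measurableT [set true]) := measurable_fun_ltr mf mg.
by rewrite setTI; exact.
Qed.

Lemma measurable_ler_set f g : measurable_fun setT f -> measurable_fun setT g ->
  measurable [set x | f x <= g x].
Proof.
move=> mf mg; have /(_ measurableT [set true]) := measurable_fun_ler mf mg.
by rewrite setTI; exact.
Qed.

Lemma measurable_preimage d' (T' : measurableType d') (h : T -> T') (A : set T') :
  measurable_fun setT h -> measurable A -> measurable (h @^-1` A).
Proof. by move=> mh mA; rewrite -[X in measurable X]setTI; exact: mh. Qed.

End MeasurableSets.

Section RowMeasure.
Variable R : realType.
Implicit Types m : nat.

Local Notation rowT m := (g_sigma_algebraType (@open 'rV[R]_m)).

Lemma xhE m (X : 'rV[R]_m.+1) i : xh X ord0 i = X ord0 (lift ord_max i).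
Proof. by rewrite mxE; congr (X _ _); apply: val_inj; rewrite /= /bump leqNgt ltn_ord. Qed.

Lemma xh_ext m (y : 'rV[R]_m) t : xh (ext_row y t) = y.
Proof. by apply/rowP => i; rewrite xhE mxE liftK. Qed.

Lemma xl_ext m (y : 'rV[R]_m) t : xl (ext_row y t) = t.
Proof. by rewrite /xl mxE unlift_none. Qed.

Lemma ext_xhl m (X : 'rV[R]_m.+1) : ext_row (xh X) (xl X) = X.
Proof.
apply/rowP => i; rewrite mxE; case: unliftP => [j ->|-> //].
by rewrite xhE.
Qed.

Lemma openP_ball m (U : set 'rV[R]_m) (x : 'rV[R]_m) : open U -> U x ->
  exists2 e : R, 0 < e & forall y : 'rV[R]_m,
    (forall i, `|x ord0 i - y ord0 i| < e) -> U y.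
Proof.
move=> oU Ux; have /nbhs_ballP[e /= e0 He] : nbhs x U by exact: open_nbhs_nbhs.
exists e => // y Hy; apply: He; split => // i j; rewrite ord1; exact: Hy.
Qed.

Lemma rat_approx (x e : R) : 0 < e -> exists q : rat, `|ratr q - x| < e.
Proof.
move=> e0; have : x - e < x + e by lra.
move=> /rat_in_itvoo[q]; rewrite in_itv/= => /andP[h1 h2]; exists q.
by rewrite ltr_distlC -(addrC e) in h1 h2 *; apply/andP; split; lra.
Qed.

(** Rational centres and radii [1 / (k + 1)] give a countable base of open cubes. It serves for
    measurability here, and at the end to make the cover by barriers countable. *)
Definition ratbox m (p : 'rV[rat]_m * nat) : set 'rV[R]_m :=
  [set y | forall i, `|ratr (p.1 ord0 i) - y ord0 i| < p.2.+1%:R^-1].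

Lemma open_ratbox m (U : set 'rV[R]_m) (x : 'rV[R]_m) : open U -> U x ->
  exists p, ratbox p x /\ ratbox p `<=` U.
Proof.
move=> oU Ux; have [e e0 He] := openP_ball oU Ux.
have [k Hk] : exists k, k.+1%:R^-1 < e / 2.
  have e20 : 0 < e / 2 by rewrite divr_gt0.
  have [k _ Hk] := near_infty_natSinv_lt (PosNum e20).
  by exists k; exact: (Hk k (leqnn k)).
have k0 : 0 < k.+1%:R^-1 :> R by [].
have [q Hq] := choice (fun i => rat_approx (x ord0 i) k0).
exists (\row_i q i, k); split => /= [i|y Hy]; first by rewrite mxE.
apply: He => i; have := Hy i; rewrite /= mxE => h.
rewrite (_ : x ord0 i - y ord0 i = (ratr (q i) - y ord0 i) - (ratr (q i) - x ord0 i)); last by lra.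
by apply: le_lt_trans (ler_normB _ _) _; rewrite (splitr e) ltrD// (lt_trans _ Hk).
Qed.

(** An open set is the countable union of the rational cubes that it contains, and membership in a
    cube is a finite conjunction of conditions on coordinates. *)
Lemma measurable_rowP d (X : measurableType d) m (f : X -> rowT m) :
  (forall i, measurable_fun setT (fun x => f x ord0 i)) -> measurable_fun setT f.
Proof.
move=> mf; apply: (@measurability _ _ _ (rowT m) _ _ (@open 'rV[R]_m)) => //.
move=> _ [U oU <-]; rewrite setTI.
have -> : f @^-1` U = \bigcup_(p in [set p : 'rV[rat]_m * nat | ratbox p `<=` U])
    f @^-1` (ratbox p).
  apply/seteqP; split => [x /= Ux|x [p /= pU fx]]; last exact: pU.
  by have [p [px pU]] := open_ratbox oU Ux; exists p.
rewrite bigcup_mkcond; apply: countable_bigcupT_measurable.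
  exact: countableP.
move=> p; case: ifPn => // _.
rewrite (_ : _ @^-1` _ = \big[setI/setT]_(i < m)
   [set x | `|ratr (p.1 ord0 i) - f x ord0 i| < p.2.+1%:R^-1]); last first.
  rewrite -bigcap_seq; apply/seteqP; split => x /= h => [i _|i]; first exact: h.
  by apply: h; rewrite /= mem_index_enum.
apply: bigsetI_measurable => i _.
apply: measurable_ltr_set => //.
by apply: measurableT_comp => //; apply: measurable_funB.
Qed.

Lemma measurable_coord m (i : 'I_m) : measurable_fun setT (fun x : rowT m => x ord0 i).
Proof.
apply: (@measurability _ _ (rowT m) (measurableTypeR R) setT _ _ (RGenOpens.measurableE R)).
move=> _ [_ [a [b ->] <-]]; rewrite setTI; apply: sub_gen_smallest => /=.
apply: open_comp => [x _|]; last exact: interval_open.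
exact: coord_continuous.
Qed.

Lemma measurable_fun_coord d (X : measurableType d) m (f : X -> rowT m) (i : 'I_m) :
  measurable_fun setT f -> measurable_fun setT (fun x => f x ord0 i).
Proof. by move=> mf; apply: (measurableT_comp (measurable_coord i)). Qed.

Lemma measurable_ext m :
  measurable_fun setT (fun p : rowT m * measurableTypeR R => ext_row p.1 p.2 : rowT m.+1).
Proof.
apply: measurable_rowP => i; under eq_fun do rewrite mxE.
case: unliftP => [j _|_]; last exact: measurable_snd.
exact: (measurable_fun_coord j measurable_fst).
Qed.

Lemma measurable_xhl m :
  measurable_fun setT (fun X : rowT m.+1 => (xh X : rowT m, xl X : measurableTypeR R)).
Proof.
apply: measurable_fun_pair; last exact: measurable_coord.
by apply: measurable_rowP => i; under eq_fun do rewrite mxE; exact: measurable_coord.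
Qed.

Section push.
Context d d' (T1 : measurableType d) (T2 : measurableType d').
Variables (mu : {measure set T1 -> \bar R}) (f : T1 -> T2) (g : T2 -> T1).
Hypothesis mu_sf : sigma_finite setT mu.
Hypotheses (mf : measurable_fun setT f) (mg : measurable_fun setT g).
Hypothesis fK : cancel f g.

(** The hypotheses are arguments so that the structure of a sigma-finite measure can be attached to
    this name. The left inverse [g] transports an exhausting sequence from [T1] to [T2]. *)
Definition sfpush of sigma_finite setT mu & measurable_fun setT f & measurable_fun setT g & cancel f g
  : set T2 -> \bar R := pushforward mu f.

Let nu := sfpush mu_sf mf mg fK.
Let pm : {measure set T2 -> \bar R} :=
  measure_function_pushforward__canonical__measure_function_Measure mu mf.
Let nu0 : nu set0 = 0%E. Proof. exact: (measure0 pm). Qed.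
Let nu_ge0 A : (0 <= nu A)%E. Proof. exact: (measure_ge0 pm). Qed.
Let nu_sa : semi_sigma_additive nu.
Proof. exact: (@measure_semi_sigma_additive _ _ _ pm). Qed.

HB.instance Definition _ := isMeasure.Build _ _ _ nu nu0 nu_ge0 nu_sa.

Let nu_sf : sigma_finite setT nu.
Proof.
have [F FT Ff] := mu_sf; exists (fun k => g @^-1` F k).
  by rewrite -preimage_bigcup -FT.
move=> i; have [mF Fi] := Ff i; split; first exact: measurable_preimage.
rewrite /nu /sfpush /pushforward (_ : _ @^-1` _ = F i)//.
by apply/seteqP; split => x /=; rewrite fK.
Qed.

HB.instance Definition _ := Measure_isSigmaFinite.Build _ _ _ nu nu_sf.
End push.

Lemma prod_sf d d' (T1 : measurableType d) (T2 : measurableType d')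
  (m1 : {sigma_finite_measure set T1 -> \bar R})
  (m2 : {sigma_finite_measure set T2 -> \bar R}) : sigma_finite setT (m1 \x m2)%E.
Proof.
have /sigma_finiteP[F [FT ndF Ff]] := sigma_finiteT m1.
have /sigma_finiteP[G [GT ndG Gf]] := sigma_finiteT m2.
exists (fun n => F n `*` G n).
  apply/seteqP; split => // -[x y] _.
  have [i _ Fx] : (\bigcup_i F i) x by rewrite -FT.
  have [j _ Gy] : (\bigcup_i G i) y by rewrite -GT.
  exists (maxn i j) => //; split => /=.
    by move: Fx; apply/subsetPset/ndF/leq_maxl.
  by move: Gy; apply/subsetPset/ndG/leq_maxr.
move=> i; have [mF Fi] := Ff i; have [mG Gi] := Gf i; split.
  exact: measurableX.
by rewrite product_measure1E// lte_mul_pinfty// ge0_fin_numE.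
Qed.

Lemma ext_rowK m : cancel (fun p : rowT m * measurableTypeR R => ext_row p.1 p.2 : rowT m.+1)
   (fun X => (xh X, xl X)).
Proof. by case=> y t; rewrite /= xh_ext xl_ext. Qed.

Lemma sf_dirac m : sigma_finite setT (@dirac _ (rowT m) 0 R).
Proof.
exists (fun=> setT); first by rewrite bigcup_const.
by move=> i; split => //; rewrite diracT ltry.
Qed.

Definition rmuS m (mu : {sigma_finite_measure set (rowT m) -> \bar R}) :
    {sigma_finite_measure set (rowT m.+1) -> \bar R} :=
  sfpush (prod_sf mu (@lebesgue_measure R)) (@measurable_ext m) (@measurable_xhl m) (@ext_rowK m).

HB.instance Definition _ m := Measure_isSigmaFinite.Build _ _ _ (@dirac _ (rowT m) 0 R) (@sf_dirac m).

(** Lebesgue measure on row vectors, by the same recursion as [iint]: the last coordinate is split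
    off each time, and dimension [0] carries the Dirac mass of its only point. *)
Fixpoint rmu m : {sigma_finite_measure set (rowT m) -> \bar R} :=
  match m with
  | 0 => @dirac _ (rowT 0) 0 R
  | m'.+1 => rmuS (rmu m')
  end.

End RowMeasure.
Notation rowT R m := (g_sigma_algebraType (@open 'rV[R]_m)).

Section Iint.
Context {R : realType}.
Local Open Scope ereal_scope.

Lemma ge0_integral_sfpush d d' (T1 : measurableType d) (T2 : measurableType d')
 (mu : {measure set T1 -> \bar R}) (smu : sigma_finite setT mu) (f : T1 -> T2) (g : T2 -> T1)
 (mf : measurable_fun setT f) (mg : measurable_fun setT g) (fK : cancel f g) (h : T2 -> \bar R) :
  measurable_fun setT h -> (forall x, 0 <= h x) ->
  \int[sfpush smu mf mg fK]_x h x = \int[mu]_x h (f x).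
Proof. by move=> mh h0; apply: (@ge0_integral_pushforward _ _ _ _ _ f mf mu setT). Qed.

Lemma measureE_int d (T : measurableType d) (mu : {measure set T -> \bar R}) (A : set T) :
  measurable A -> mu A = \int[mu]_x (\1_A x)%:E.
Proof. by move=> mA; rewrite integral_indic// setIT. Qed.

Lemma rmuS_int1 m (f : rowT R m.+1 -> \bar R) : measurable_fun setT f -> (forall x, 0 <= f x) ->
  \int[rmu R m.+1]_x f x = \int[rmu R m]_y \int[lebesgue_measure]_t f (ext_row y t).
Proof.
move=> mf f0; rewrite [LHS]ge0_integral_sfpush//.
rewrite (@fubini_tonelli1 _ _ _ _ _ (rmu R m) (@lebesgue_measure R) (fun p => f (ext_row p.1 p.2)))//.
exact: (measurableT_comp mf (@measurable_ext R m)).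
Qed.

Lemma rmuS_int2 m (f : rowT R m.+1 -> \bar R) : measurable_fun setT f -> (forall x, 0 <= f x) ->
  \int[rmu R m.+1]_x f x = \int[lebesgue_measure]_t \int[rmu R m]_y f (ext_row y t).
Proof.
move=> mf f0; rewrite [LHS]ge0_integral_sfpush//.
rewrite (@fubini_tonelli2 _ _ _ _ _ (rmu R m) (@lebesgue_measure R) (fun p => f (ext_row p.1 p.2)))//.
exact: (measurableT_comp mf (@measurable_ext R m)).
Qed.

Lemma measurable_ext1 m (t : measurableTypeR R) :
  measurable_fun setT (fun y : rowT R m => ext_row y t : rowT R m.+1).
Proof. exact: (measurableT_comp (@measurable_ext R m) (measurable_pair2 t)). Qed.

Lemma measurable_ext2 m (y : rowT R m) :
  measurable_fun setT (fun t : measurableTypeR R => ext_row y t : rowT R m.+1).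
Proof. exact: (measurableT_comp (@measurable_ext R m) (measurable_pair1 y)). Qed.

(** Unfolding [iint] gives Tonelli's order with the last coordinate outermost. *)
Lemma iintE m (f : rowT R m -> \bar R) : measurable_fun setT f -> (forall x, 0 <= f x) ->
  iint f = \int[rmu R m]_x f x.
Proof.
elim: m f => [|m IH] f mf f0.
  by rewrite /= integral_dirac//= diracT mul1e.
rewrite rmuS_int2// [LHS]/=; apply: eq_integral => t _; rewrite IH//.
exact: (measurableT_comp mf (measurable_ext1 t)).
Qed.

Lemma rmuS_set1 m (A : set (rowT R m.+1)) : measurable A ->
  rmu R m.+1 A = \int[rmu R m]_y lebesgue_measure [set t : measurableTypeR R | A (ext_row y t)].
Proof.
move=> mA; rewrite measureE_int// rmuS_int1//; last exact/measurable_EFinP.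
apply: eq_integral => y _; rewrite [RHS]measureE_int//.
exact: (measurable_preimage (measurable_ext2 y)).
Qed.

Lemma rmuS_set2 m (A : set (rowT R m.+1)) : measurable A ->
  rmu R m.+1 A = \int[lebesgue_measure]_t rmu R m [set y | A (ext_row y t)].
Proof.
move=> mA; rewrite measureE_int// rmuS_int2//; last exact/measurable_EFinP.
apply: eq_integral => t _; rewrite [RHS]measureE_int//.
exact: (measurable_preimage (measurable_ext1 t)).
Qed.

(** The integral of a nonnegative function is a supremum over the simple functions below it, so the
    comparison holds for arbitrary functions. It is applied to competitors whose sections may fail
    to be Borel. *)
Lemma le_integral_nomeas d (T : measurableType d) (mu : {measure set T -> \bar R}) (f g : T -> \bar R) :
  (forall x, 0 <= f x) -> (forall x, f x <= g x) -> \int[mu]_x f x <= \int[mu]_x g x.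
Proof.
move=> f0 fg; have g0 x : 0 <= g x by apply: le_trans (fg x).
rewrite !ge0_integralTE//; apply: le_ereal_sup => _ [h /= hf <-].
by exists h => //= x; apply: le_trans (fg x); exact: hf.
Qed.

Lemma iint_ge0 m (f : 'rV[R]_m -> \bar R) : (forall x, 0 <= f x) -> 0 <= iint f.
Proof.
elim: m f => [|m IH] f f0 //=; apply: integral_ge0 => t _.
by apply: IH.
Qed.

Lemma le_iint m (f g : 'rV[R]_m -> \bar R) :
  (forall x, 0 <= f x) -> (forall x, f x <= g x) -> iint f <= iint g.
Proof.
elim: m f g => [|m IH] f g f0 fg //=; apply: le_integral_nomeas => t.
  exact: iint_ge0.
exact: IH.
Qed.

End Iint.

Section Vol.
Context {R : realType}.
Local Notation leb := (@lebesgue_measure R).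

(** By uniqueness of Lebesgue measure it is enough to test half-open intervals; reflection moves the
    closed endpoint to the other side and keeps the length. *)
Lemma lebesgue_reflect (c : R) (A : set (measurableTypeR R)) : measurable A ->
  leb [set t | A (c - t)] = leb A.
Proof.
have mr : measurable_fun [set: measurableTypeR R] (fun t : measurableTypeR R => c - t : measurableTypeR R).
  by apply: measurable_funB.
pose mu : {measure set (measurableTypeR R) -> \bar R} :=
  measure_function_pushforward__canonical__measure_function_Measure leb mr.
move=> mA; apply/esym; apply: (@lebesgue_measure_unique R mu) => //= _ [[a b]] _ <-.
rewrite /mu /= /pushforward (_ : _ @^-1` _ = `[c - b, c - a[%classic).
  rewrite !lebesgue_measure_itv/= !lte_fin ltrD2l ltrN2; case: ifPn => // _.
  by congr (_%:E); ring.
by apply/seteqP; split => t; rewrite /= !in_itv/= => /andP[h1 h2]; apply/andP; split; lra.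
Qed.

Lemma integral_reflect1 (c : R) (f : measurableTypeR R -> \bar R) :
  measurable_fun setT f -> (forall x, 0 <= f x)%E ->
  (\int[leb]_t f (c - t)%R = \int[leb]_t f t)%E.
Proof.
have mr : measurable_fun [set: measurableTypeR R] (fun t : measurableTypeR R => c - t : measurableTypeR R).
  by apply: measurable_funB.
move=> mf f0.
have /esym := @ge0_integral_pushforward _ _ _ _ R _ mr leb setT f measurableT mf (fun _ _ => f0 _).
rewrite preimage_setT => ->; apply: eq_measure_integral => A mA _ /=.
exact: lebesgue_reflect.
Qed.

Lemma xlB m (X Y : 'rV[R]_m.+1) : xl (X - Y) = xl X - xl Y.
Proof. by rewrite /xl !mxE. Qed.

Lemma measurable_rowB m d (T : measurableType d) (f g : T -> rowT R m) :
  measurable_fun setT f -> measurable_fun setT g ->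
  measurable_fun setT (fun x => (f x : 'rV[R]_m) - (g x : 'rV[R]_m) : rowT R m).
Proof.
move=> mf mg; apply: measurable_rowP => i; under eq_fun do rewrite !mxE.
by apply: measurable_funB; exact: measurable_fun_coord.
Qed.

Lemma ext_rowB m (X : 'rV[R]_m.+1) y t :
  X - ext_row y t = ext_row (xh X - y) (xl X - t).
Proof. by rewrite -{1}(ext_xhl X); apply/rowP => i; rewrite !mxE; case: unliftP => *; rewrite ?mxE. Qed.

Lemma integral_reflect m (X : 'rV[R]_m) (f : rowT R m -> \bar R) :
  measurable_fun setT f -> (forall x, 0 <= f x)%E ->
  (\int[rmu R m]_y f (X - y : 'rV[R]_m)%R = \int[rmu R m]_y f y)%E.
Proof.
elim: m X f => [|m IH] X f mf f0.
  by apply: eq_integral => y _; congr f; apply/rowP; case.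
rewrite [RHS]rmuS_int2// [LHS]rmuS_int2; last 2 first.
- by apply: (measurableT_comp mf); apply: measurable_rowB => //; exact: measurable_cst.
- by move=> x; exact: f0.
transitivity (\int[leb]_t \int[rmu R m]_y f (ext_row y (xl X - t)%R))%E.
  apply: eq_integral => t _.
  under eq_integral do rewrite ext_rowB.
  rewrite (IH (xh X) (fun y => f (ext_row y (xl X - t))))//.
  exact: (measurableT_comp mf (measurable_ext1 _)).
rewrite (integral_reflect1 (xl X) (f := fun t => \int[rmu R m]_y f (ext_row y t)))%E//.
  apply: (@measurable_fun_fubini_tonelli_G _ _ _ _ R (rmu R m) (fun p => f (ext_row p.1 p.2))) => //.
  exact: (measurableT_comp mf (@measurable_ext R m)).
by move=> t; exact: integral_ge0.
Qed.

Definition dot m (v h : 'rV[R]_m) : R := \sum_i v ord0 i * h ord0 i.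

Lemma measurable_dot m (v : 'rV[R]_m) : measurable_fun setT (fun h : rowT R m => dot v h).
Proof.
apply: measurable_sum => i; apply: measurable_funM => //; exact: measurable_coord.
Qed.

Definition scube m (c : 'rV[R]_m) (r : R) : set (rowT R m) :=
  [set h | forall i, `|h ord0 i - c ord0 i| <= r].

Lemma measurable_scube m c r : measurable (@scube m c r).
Proof.
rewrite (_ : scube c r = \big[setI/setT]_(i < m)
   [set x : rowT R m | `|x ord0 i - c ord0 i| <= r]); last first.
  rewrite -bigcap_seq; apply/seteqP; split => x /= h => [i _|i]; first exact: h.
  by apply: h; rewrite /= mem_index_enum.
apply: bigsetI_measurable => i _; apply: measurable_ler_set => //.
apply: measurableT_comp => //; apply: measurable_funB => //; exact: measurable_coord.
Qed.

Lemma leb_abs_le (c r : R) : 0 <= r -> leb [set t | `|t - c| <= r] = (2 * r)%:E.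
Proof.
move=> r0; rewrite (_ : [set t | _] = `[c - r, c + r]%classic).
  rewrite lebesgue_measure_itv/= lte_fin; case: ifPn => h.
    by rewrite -EFinD; congr EFin; ring.
  by congr EFin; lra.
by apply/seteqP; split => t; rewrite /= in_itv/= ler_distl.
Qed.

Lemma scubeS m (c : 'rV[R]_m.+1) r y t :
  scube c r (ext_row y t) <-> scube (xh c) r y /\ `|t - xl c| <= r.
Proof.
split => [h|[h1 h2] i].
  split => [i|].
    by have := h (lift ord_max i); rewrite mxE liftK xhE.
  by have := h ord_max; rewrite mxE unlift_none.
rewrite mxE; case: unliftP => [j ->|->]; last exact: h2.
by rewrite -xhE; exact: h1.
Qed.

Lemma vol_scube m (c : 'rV[R]_m) r : 0 <= r -> rmu R m (scube c r) = ((2 * r) ^+ m)%:E.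
Proof.
move=> r0; elim: m c => [|m IH] c.
  by rewrite /= diracE mem_set//= => -[].
rewrite rmuS_set2; last exact: measurable_scube.
transitivity (\int[leb]_t ((2 * r) ^+ m * \1_[set t | (`|t - xl c| <= r)%R] t)%:E)%E.
  apply: eq_integral => t _; rewrite indicE; case: (boolP (_ \in _)) => [/set_mem/= h|/negP h].
    rewrite mulr1 -(IH (xh c)); congr (rmu R m _).
    by apply/seteqP; split => y /= => [/scubeS[]//|hy]; apply/scubeS.
  rewrite mulr0 (_ : [set y | _] = set0) ?measure0//.
  by apply/seteqP; split => y //= /scubeS[_ hh]; apply: h; exact/mem_set.
have mA : measurable [set t : measurableTypeR R | `|t - xl c| <= r].
  apply: measurable_ler_set => //; apply: measurableT_comp => //.
  exact: measurable_funB.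
under eq_integral do rewrite EFinM.
rewrite ge0_integralZl_EFin ?exprn_ge0 ?mulr_ge0//; last exact/measurable_EFinP.
transitivity (((2 * r) ^+ m)%:E * (2 * r)%:E)%E; last by rewrite -EFinM exprSr.
by congr (_ * _)%E; rewrite -(measureE_int leb)//; exact: leb_abs_le.
Qed.

Lemma vol_reflect m (X : 'rV[R]_m) (A : set (rowT R m)) : measurable A ->
  rmu R m [set y | A (X - y)] = rmu R m A.
Proof.
move=> mA; rewrite [RHS]measureE_int// -(integral_reflect X)//; last exact/measurable_EFinP.
rewrite measureE_int//.
by apply: (@measurable_preimage _ _ _ _ (fun y : rowT R m => X - y : rowT R m)) => //;
  apply: measurable_rowB => //; exact: measurable_cst.
Qed.

Lemma dotS m (v h : 'rV[R]_m.+1) : dot v h = dot (xh v) (xh h) + xl v * xl h.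
Proof.
rewrite /dot big_ord_recr /=; congr (_ + _).
by apply: eq_bigr => i _; rewrite !mxE.
Qed.

(** The offset [c] serves the induction on the dimension: freezing the last coordinate at [t] turns
    it into [xl v * t + c]. *)
Definition slab m (v : 'rV[R]_m) (c q r : R) : set (rowT R m) :=
  scube 0 r `&` [set h | `|dot v h + c| <= q].

Lemma measurable_slab m v c q r : measurable (@slab m v c q r).
Proof.
apply: measurableI; first exact: measurable_scube.
apply: measurable_ler_set => //; apply: measurableT_comp => //.
by apply: measurable_funD => //; exact: measurable_dot.
Qed.

Lemma slabS m (v : 'rV[R]_m.+1) c q r y t : slab v c q r (ext_row y t) <->
  slab (xh v) (xl v * t + c) q r y /\ `|t| <= r.
Proof.
have x0 : xh (0 : 'rV[R]_m.+1) = 0 by apply/rowP => i; rewrite !mxE.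
have l0 : xl (0 : 'rV[R]_m.+1) = 0 by rewrite /xl mxE.
split.
  move=> [/scubeS[h1 h2] /=]; rewrite dotS xh_ext xl_ext x0 l0 subr0 in h1 h2 * => h3.
  by split => //; split => //=; rewrite addrA.
move=> [[h1 /= h3] h2]; split; first by apply/scubeS; rewrite x0 l0 subr0.
by rewrite /= dotS xh_ext xl_ext -addrA.
Qed.

(** With the other coordinates frozen, coordinate [i] ranges over an interval of length
    [2 q / |v_i|]. The induction peels off last coordinates until it reaches [i]. *)
Lemma vol_slab m (v : 'rV[R]_m) c q r i : 0 <= r -> 0 <= q -> v ord0 i != 0 ->
  (rmu R m (slab v c q r) <= ((2 * r) ^+ m.-1 * (2 * q / `|v ord0 i|))%:E)%E.
Proof.
move=> r0 q0; elim: m v c i => [|m IH] v c i; first by case: i.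
have -> : i = if unlift ord_max i is Some j then lift ord_max j else ord_max.
  by case: unliftP.
case: (unlift ord_max i) => [j|] vi.
- rewrite -xhE in vi *; rewrite rmuS_set2; last exact: measurable_slab.
  have mA : measurable [set t : measurableTypeR R | `|t| <= r].
    by apply: measurable_ler_set => //; apply: measurableT_comp.
  apply: (@le_trans _ _ (\int[leb]_t (((2 * r) ^+ m.-1 * (2 * q / `|xh v ord0 j|))%:E * (\1_[set t : R | `|t| <= r] t)%:E)))%E.
    apply: le_integral_nomeas => t //; rewrite indicE.
    case: (boolP (_ \in _)) => [/set_mem/= h|/negP h].
      rewrite mule1; apply: le_trans (IH (xh v) (xl v * t + c) j vi).
      apply: le_measure; rewrite ?inE.
      + exact: (measurable_preimage (measurable_ext1 t) (measurable_slab _ _ _ _)).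
      + exact: measurable_slab.
      + by move=> y /= /slabS[].
    rewrite mule0 (_ : [set y | _] = set0) ?measure0//.
    by apply/seteqP; split => y //= /slabS[_ hh]; apply: h; exact/mem_set.
  rewrite ge0_integralZl_EFin//; last 2 first.
    exact/measurable_EFinP.
    by rewrite mulr_ge0 ?exprn_ge0 ?divr_ge0 ?mulr_ge0.
  rewrite -measureE_int//.
  rewrite (_ : [set t | `|t| <= r] = [set t | `|t - 0| <= r]); last by under [RHS]eq_set do rewrite subr0.
  set L := (X in (_ * X)%E); have -> : L = (2 * r)%:E by exact: leb_abs_le.
  rewrite -EFinM lee_fin /=.
  case: m {IH i L} v j vi {mA} => [|m] v j vi; first by case: j vi.
  by rewrite /= [in leRHS]exprS; apply: eq_ler; ring.
- rewrite -/(xl v) in vi *; rewrite rmuS_set1; last exact: measurable_slab.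
  have q' : 0 <= q / `|xl v| by rewrite divr_ge0.
  apply: (@le_trans _ _ (\int[rmu R m]_y ((2 * (q / `|xl v|))%:E * (\1_(scube 0 r) y)%:E)))%E.
    apply: le_integral_nomeas => y //; rewrite indicE.
    case: (boolP (_ \in _)) => [/set_mem/= h|/negP h].
      rewrite mule1 -(leb_abs_le (- (dot (xh v) y + c) / xl v))//.
      apply: le_measure; rewrite ?inE.
      + exact: (measurable_preimage (measurable_ext2 y) (measurable_slab _ _ _ _)).
      + apply: measurable_ler_set => //; apply: measurableT_comp => //.
        exact: measurable_funB.
      + move=> t /= [_]; rewrite /= dotS xh_ext xl_ext => hq.
        rewrite ler_pdivlMr ?normr_gt0// -normrM; apply: le_trans hq.
        apply: eq_ler; congr (`|_|); field.
        exact: vi.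
    rewrite mule0 (_ : [set t | _] = set0) ?measure0//.
    apply/seteqP; split => t //= /slabS[[hh _] _]; apply: h; exact/mem_set.
  rewrite ge0_integralZl_EFin//; last 2 first.
    apply/measurable_EFinP/measurable_indic; exact: measurable_scube.
    by rewrite mulr_ge0.
  rewrite -measureE_int; last exact: measurable_scube.
  set L := (X in (_ * X)%E); have -> : L = ((2 * r) ^+ m)%:E by exact: vol_scube.
  by rewrite -EFinM lee_fin /= mulrC mulrA.
Qed.

End Vol.

(** * Euclidean norm and masses of the kernel *)

Section Euclid.
Context {R : realType}.
Implicit Types m : nat.

Lemma dotC m (x y : 'rV[R]_m) : dot x y = dot y x.
Proof. by apply: eq_bigr => i _; rewrite mulrC. Qed.

Lemma dotDr m (x y z : 'rV[R]_m) : dot x (y + z) = dot x y + dot x z.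
Proof. by rewrite -big_split; apply: eq_bigr => i _; rewrite mxE mulrDr. Qed.

Lemma dotZr m a (x y : 'rV[R]_m) : dot x (a *: y) = a * dot x y.
Proof. by rewrite big_distrr; apply: eq_bigr => i _; rewrite mxE mulrCA. Qed.

Lemma dotNr m (x y : 'rV[R]_m) : dot x (- y) = - dot x y.
Proof. by rewrite -scaleN1r dotZr mulN1r. Qed.

Lemma dotBr m (x y z : 'rV[R]_m) : dot x (y - z) = dot x y - dot x z.
Proof. by rewrite dotDr dotNr. Qed.

Lemma dotDl m (x y z : 'rV[R]_m) : dot (y + z) x = dot y x + dot z x.
Proof. by rewrite dotC dotDr !(dotC x). Qed.

Lemma dotBl m (x y z : 'rV[R]_m) : dot (y - z) x = dot y x - dot z x.
Proof. by rewrite dotC dotBr !(dotC x). Qed.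

Lemma dotZl m a (x y : 'rV[R]_m) : dot (a *: x) y = a * dot x y.
Proof. by rewrite dotC dotZr dotC. Qed.

Lemma enorm_ge0 m (x : 'rV[R]_m) : 0 <= enorm x.
Proof. exact: sqrtr_ge0. Qed.

Lemma enorm_sq m (x : 'rV[R]_m) : enorm x ^+ 2 = dot x x.
Proof.
rewrite sqr_sqrtr; last by apply: sumr_ge0 => i _; exact: sqr_ge0.
by apply: eq_bigr => i _; rewrite expr2.
Qed.

Lemma dot_ge0 m (x : 'rV[R]_m) : 0 <= dot x x.
Proof. by rewrite -enorm_sq sqr_ge0. Qed.

Lemma enormN m (x : 'rV[R]_m) : enorm (- x) = enorm x.
Proof. by congr Num.sqrt; apply: eq_bigr => i _; rewrite mxE sqrrN. Qed.

Lemma enormBC m (x y : 'rV[R]_m) : enorm (x - y) = enorm (y - x).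
Proof. by rewrite -enormN opprB. Qed.

Lemma enormZ m a (x : 'rV[R]_m) : enorm (a *: x) = `|a| * enorm x.
Proof.
rewrite -sqrtr_sqr -sqrtrM ?sqr_ge0//; congr Num.sqrt; rewrite big_distrr/=.
by apply: eq_bigr => i _; rewrite mxE exprMn.
Qed.

Lemma enorm0 m : enorm (0 : 'rV[R]_m) = 0.
Proof. by rewrite -(scale0r 0) enormZ normr0 mul0r. Qed.

Lemma coord_enorm m (x : 'rV[R]_m) i : `|x ord0 i| <= enorm x.
Proof.
rewrite -sqrtr_sqr ler_wsqrtr// (bigD1 i)//= lerDl.
by apply: sumr_ge0 => j _; exact: sqr_ge0.
Qed.

Lemma enorm_eq0 m (x : 'rV[R]_m) : enorm x = 0 -> x = 0.
Proof.
move=> x0; apply/rowP => i; rewrite mxE; apply/eqP; rewrite -normr_le0 -x0.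
exact: coord_enorm.
Qed.

Lemma enorm_gt0 m (x y : 'rV[R]_m) : x <> y -> 0 < enorm (x - y).
Proof.
move=> xy; rewrite lt_neqAle enorm_ge0 andbT eq_sym; apply/eqP => /enorm_eq0/eqP.
by rewrite subr_eq0 => /eqP.
Qed.

Lemma cauchy_schwarz m (x y : 'rV[R]_m) : `|dot x y| <= enorm x * enorm y.
Proof.
rewrite -(@ler_pXn2r _ 2) ?nnegrE ?mulr_ge0 ?enorm_ge0// exprMn !enorm_sq.
rewrite real_normK ?num_real//.
have [y0|y0] := eqVneq (dot y y) 0.
  have : enorm y = 0 by apply/eqP; rewrite -sqrf_eq0 enorm_sq y0.
  move=> /enorm_eq0 ->; rewrite /dot; under eq_bigr do rewrite mxE mulr0.
  by rewrite big1_eq expr0n/= mulr_ge0// sumr_ge0// => i _; rewrite -expr2 sqr_ge0.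
have yp : 0 < dot y y by rewrite lt_def y0 dot_ge0.
(* This vector is [|y|^2] times the component of [x] orthogonal to [y]. *)
have := dot_ge0 (dot y y *: x - dot x y *: y).
rewrite !(dotBl, dotBr, dotZl, dotZr) (dotC y x) => h.
rewrite -subr_ge0 -(pmulr_rge0 _ yp); apply: le_trans h _.
by apply: eq_ler; ring.
Qed.

Lemma enormD m (x y : 'rV[R]_m) : enorm (x + y) <= enorm x + enorm y.
Proof.
rewrite -(@ler_pXn2r _ 2) ?nnegrE ?addr_ge0 ?enorm_ge0//.
rewrite sqrrD !enorm_sq !(dotDl, dotDr) (dotC y x).
have := le_trans (ler_norm _) (cauchy_schwarz x y); lra.
Qed.

Lemma enormB m (x y : 'rV[R]_m) : enorm (x - y) <= enorm x + enorm y.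
Proof. by rewrite -(enormN y) enormD. Qed.

Lemma enormB_tri m (y x z : 'rV[R]_m) : enorm (x - z) <= enorm (x - y) + enorm (y - z).
Proof. by apply: le_trans (enormD _ _); rewrite subrKA. Qed.

Lemma enorm_coord_le m (x : 'rV[R]_m) r : (forall i, `|x ord0 i| <= r) ->
  enorm x <= Num.sqrt m%:R * r.
Proof.
case: m x => [|m] x xr.
  by rewrite [x](_ : _ = 0) ?enorm0 ?sqrtr0 ?mul0r//; apply/rowP; case.
have r0 : 0 <= r by apply: le_trans (xr ord0).
rewrite -[in leRHS](ger0_norm r0) -sqrtr_sqr -sqrtrM ?ler0n// ler_wsqrtr//.
apply: (@le_trans _ _ (\sum_(i < m.+1) r ^+ 2)).
  apply: ler_sum => i _; rewrite -[leLHS]real_normK ?num_real//.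
  by rewrite ler_pXn2r ?nnegrE.
by rewrite sumr_const card_ord mulr_natl.
Qed.

(** Slicing along a largest coordinate replaces the rotation of [v] onto an axis, at the cost of a
    factor [sqrt m]. *)
Lemma max_coord m (v : 'rV[R]_m.+1) : exists i, enorm v <= Num.sqrt m.+1%:R * `|v ord0 i|.
Proof.
have [i hi] : exists i, forall j, `|v ord0 j| <= `|v ord0 i|.
  by have [i _ hi] := @arg_maxP _ _ 'I_m.+1 ord0 xpredT (fun i => `|v ord0 i|) isT; exists i => j; exact: hi.
by exists i; apply: enorm_coord_le => j.
Qed.

Lemma measurable_enorm m d (T : measurableType d) (f : T -> rowT R m) :
  measurable_fun setT f -> measurable_fun setT (fun x => enorm (f x : 'rV[R]_m)).
Proof.
move=> mf; apply: (@measurableT_comp _ _ _ _ _ _ (@Num.sqrt R)).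
  by apply: continuous_measurable_fun; exact: sqrt_continuous.
apply: measurable_sum => i; apply: measurable_funX; exact: measurable_fun_coord.
Qed.

Definition cball m (X : 'rV[R]_m) (r : R) : set (rowT R m) := [set y | enorm (X - y) <= r].

Lemma measurable_cball m (X : 'rV[R]_m) r : measurable (cball X r).
Proof.
apply: measurable_ler_set => //; apply: measurable_enorm.
by apply: measurable_rowB => //; exact: measurable_cst.
Qed.

Lemma enorm_ball_scube m (X : 'rV[R]_m) r Y : enorm (Y - X) <= r -> scube X r Y.
Proof. by move=> h i; apply: le_trans h; rewrite (_ : _ - _ = (Y - X) ord0 i) ?coord_enorm// !mxE. Qed.

End Euclid.

Section Dyadic.
Context {R : realType}.

Lemma bound_exp2 (x : R) : exists k, x < 2 ^+ k.
Proof.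
exists (Num.bound `|x|); apply: le_lt_trans (ler_norm _) _.
apply: lt_le_trans (archi_boundP (normr_ge0 x)) _.
by rewrite -natrX ler_nat ltnW// ltn_expl.
Qed.

Lemma dyadic_far (r d : R) : 0 < r -> r < d -> exists k, r * 2 ^+ k < d <= 2 * (r * 2 ^+ k).
Proof.
move=> r0 rd.
have ex : exists k, d <= 2 * (r * 2 ^+ k).
  have [k hk] := bound_exp2 (d / (2 * r)); exists k.
  move: hk; rewrite ltr_pdivrMr ?mulr_gt0// => /ltW /le_trans; apply; apply: eq_ler; ring.
case: (ex_minnP ex) => -[|k] hk hmin; first by exists 0%N; rewrite hk andbT mulr1.
exists k.+1; rewrite hk andbT ltNge; apply/negP => hd.
suff : d <= 2 * (r * 2 ^+ k) by move/hmin; rewrite ltnn.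
by move: hd; rewrite exprS mulrCA.
Qed.

Lemma dyadic_near (r d : R) : 0 < d -> d <= r ->
  exists k, r / 2 * 2^-1 ^+ k < d <= 2 * (r / 2 * 2^-1 ^+ k).
Proof.
move=> d0 rd.
have ex : exists k, r / 2 * 2^-1 ^+ k < d.
  have [k hk] := bound_exp2 (r / 2 / d); exists k.
  by rewrite exprVn ltr_pdivrMr ?exprn_gt0// [ltRHS]mulrC -ltr_pdivrMr.
case: (ex_minnP ex) => -[|k] hk hmin.
  by exists 0%N; rewrite hk /= expr0 mulr1 mulrCA mulfV ?mulr1// pnatr_eq0.
exists k.+1; rewrite hk/= leNgt; apply/negP => hd.
suff : r / 2 * 2^-1 ^+ k < d by move/hmin; rewrite ltnn.
by apply: le_lt_trans hd; rewrite exprS; apply: eq_ler; field.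
Qed.

End Dyadic.

Section Kernel.
Context {R : realType}.
Variables (m : nat) (s : R).
Local Notation T := (rowT R m).
Hypothesis s0 : 0 < s.

Definition knl (x y : 'rV[R]_m) : R := (enorm (x - y)) `^ (- (m%:R + s)).

Lemma knl_ge0 x y : 0 <= knl x y. Proof. exact: powR_ge0. Qed.
Lemma knlC x y : knl x y = knl y x. Proof. by rewrite /knl enormBC. Qed.
Lemma ms_gt0 : 0 < m%:R + s :> R. Proof. by rewrite ltr_wpDl. Qed.
(** [powR] sends [0] to [0] for every nonzero exponent, so the kernel is [0], not infinite, on the
    diagonal. The diagonal is thereby invisible to all interactions. *)
Lemma knl_diag x : knl x x = 0.
Proof. by rewrite /knl subrr enorm0 powR0// oppr_eq0 gt_eqF// ms_gt0. Qed.

Lemma measurable_knl d (X : measurableType d) (f g : X -> T) :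
  measurable_fun setT f -> measurable_fun setT g ->
  measurable_fun setT (fun x => (knl (f x) (g x))%:E).
Proof.
move=> mf mg; apply/measurable_EFinP; apply: (measurableT_comp (measurable_powR _)).
by apply: measurable_enorm; exact: measurable_rowB.
Qed.

Lemma knl_le x y a : 0 < a -> a <= enorm (x - y) -> knl x y <= a `^ (- (m%:R + s)).
Proof.
move=> a0 ay; rewrite /knl !powRN lef_pV2 ?posrE ?powR_gt0//; last exact: lt_le_trans ay.
by apply: ge0_ler_powR; rewrite ?nnegrE ?enorm_ge0 ?(ltW ms_gt0) ?(ltW a0).
Qed.

Lemma knl_ge x y a : x <> y -> enorm (x - y) <= a -> a `^ (- (m%:R + s)) <= knl x y.
Proof.
move=> xy ay; have e0 := enorm_gt0 xy.
rewrite /knl !powRN lef_pV2 ?posrE ?powR_gt0//; last exact: lt_le_trans ay.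
by apply: ge0_ler_powR; rewrite ?nnegrE ?enorm_ge0 ?(ltW ms_gt0) ?(le_trans (ltW e0) ay).
Qed.

Lemma nneseries_geo_le (c z : R) : 0 <= c -> 0 <= z < 1 ->
  (\sum_(k <oo) (c * z ^+ k)%:E <= (c / (1 - z))%:E)%E.
Proof.
move=> c0 /andP[z0 z1]; apply: lime_le.
  by apply: is_cvg_nneseries => n _ _; rewrite lee_fin mulr_ge0// exprn_ge0.
apply: nearW => n; rewrite sumEFin lee_fin -big_distrr/=.
have z10 : 0 < 1 - z by rewrite subr_gt0.
rewrite ler_wpM2l// -(ler_pM2r z10) mulVf ?gt_eqF//.
elim: n => [|n IH]; first by rewrite big_geq// mul0r.
suff -> : (\sum_(0 <= k < n.+1) z ^+ k) * (1 - z) = 1 - z ^+ n.+1.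
  by rewrite gerBl exprn_ge0.
elim: n {IH} => [|n IH]; first by rewrite big_nat1 expr0 expr1 mul1r.
by rewrite big_nat_recr//= mulrDl IH (exprS _ n.+1); ring.
Qed.

(** On the shell of radius [a lam^k] the kernel is at most [(a lam^k) ^ (-(m + s))], and the volume
    bound leaves a geometric series of ratio [lam ^ (gam - s)]. Later [gam] is [alpha] near a
    tangency ([lam = 1/2]), and [0] for a full exterior or [-1] for an exterior slab ([lam = 2]). *)
Lemma kernel_dyadic X (W : set T) (a lam C gam : R) : measurable W -> 0 < a -> 0 < lam -> 0 <= C ->
  lam `^ (gam - s) < 1 ->
  (forall y, W y -> X <> y -> exists k, a * lam ^+ k < enorm (X - y) <= 2 * (a * lam ^+ k)) ->
  (forall k, (rmu R m (W `&` cball X (2 * (a * lam ^+ k)))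
     <= (C * (a * lam ^+ k) `^ (m%:R + gam))%:E)%E) ->
  (\int[rmu R m]_(y in W) (knl X y)%:E <= (C * a `^ (gam - s) / (1 - lam `^ (gam - s)))%:E)%E.
Proof.
move=> mW a0 l0 C0 z1 hW hv.
have ak k : 0 < a * lam ^+ k by rewrite mulr_gt0// exprn_gt0.
pose A k : set T := cball X (2 * (a * lam ^+ k)).
have mA k : measurable (A k) by exact: measurable_cball.
pose c k := (a * lam ^+ k) `^ (- (m%:R + s)).
apply: (@le_trans _ _ (\int[rmu R m]_(y in W) \sum_(k <oo) (c k * \1_(A k) y)%:E)%E).
  apply: ge0_le_integral => //.
  - by move=> y _; rewrite lee_fin knl_ge0.
  - by apply: measurable_funTS; apply: measurable_knl => //; exact: measurable_cst.
  - apply: measurable_funTS; apply: ge0_emeasurable_sum => k.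
      by move=> y _ _; rewrite lee_fin mulr_ge0 ?powR_ge0.
    by move=> _; apply/measurable_EFinP; apply: measurable_funM.
  - move=> y Wy.
    have [<-|Xy] := pselect (X = y).
      by rewrite knl_diag; apply: nneseries_ge0 => k _ _; rewrite lee_fin mulr_ge0 ?powR_ge0.
    have [k /andP[k1 k2]] := hW y Wy Xy.
    (* The single term of the shell containing [y] already dominates the kernel. *)
    apply: le_trans (nneseries_lim_ge k.+1 _); last first.
      by move=> j _ _; rewrite lee_fin mulr_ge0 ?powR_ge0.
    rewrite big_nat_recr//= -[leLHS]add0e leeD//.
      by apply: sume_ge0 => j _; rewrite lee_fin mulr_ge0 ?powR_ge0.
    rewrite lee_fin indicE mem_set// mulr1; apply: knl_le => //; exact: ltW.
rewrite integral_nneseries//; last 2 first.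
- move=> k; apply: measurable_funTS; apply/measurable_EFinP; exact: measurable_funM.
- by move=> k y _; rewrite lee_fin mulr_ge0 ?powR_ge0.
apply: (@le_trans _ _ (\sum_(k <oo) ((C * a `^ (gam - s)) * (lam `^ (gam - s)) ^+ k)%:E)%E).
  apply: lee_nneseries => [k _|k _].
    by move=> _; apply: integral_ge0 => y _; rewrite lee_fin mulr_ge0 ?powR_ge0.
  under eq_integral do rewrite EFinM.
  rewrite ge0_integralZl_EFin//; [|by apply: measurable_funTS; exact/measurable_EFinP|exact: powR_ge0].
  rewrite integral_indic// setIC.
  apply: (@le_trans _ _ ((c k)%:E * (C * (a * lam ^+ k) `^ (m%:R + gam))%:E)%E).
    by apply: lee_wpmul2l; [rewrite lee_fin powR_ge0|exact: hv].
  rewrite -EFinM lee_fin mulrCA -mulrA ler_wpM2l// /c -powRD; last first.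
    by apply/implyP => _; rewrite gt_eqF.
  rewrite (_ : - (m%:R + s) + (m%:R + gam) = gam - s); last by ring.
  rewrite (powRM _ (ltW a0) (exprn_ge0 _ (ltW l0))).
  rewrite -(powR_mulrn k (powR_ge0 lam _)) -(powR_mulrn k (ltW l0)).
  by rewrite -!powRrM (mulrC (k%:R)).
apply: nneseries_geo_le; first by rewrite mulr_ge0 ?powR_ge0.
by rewrite powR_ge0.
Qed.

End Kernel.

Section Masses.
Context {R : realType}.
Variables (m' : nat) (s alpha : R).
Local Notation m := m'.+1.
Local Notation T := (rowT R m).
Hypotheses (s0 : 0 < s) (sa : s < alpha).
Local Notation k := (@knl R m s).

(** The map [y |-> X - y] preserves volume and brings the set into a slab at the origin, which is
    sliced along the largest coordinate of [v]. *)
Lemma vol_slab_ball (X v : 'rV[R]_m) (w r : R) (W : set T) : v <> 0 -> 0 <= w -> 0 <= r ->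
  measurable W -> W `<=` cball X r ->
  (forall y, W y -> `|dot v (X - y)| <= w) ->
  (rmu R m W <= ((2 * r) ^+ m' * (2 * w * Num.sqrt m%:R / enorm v))%:E)%E.
Proof.
move=> v0 w0 r0 mW WB Wv.
have [i hi] := max_coord v.
have ev : 0 < enorm v by rewrite -(subr0 v) enorm_gt0.
have vi : v ord0 i != 0.
  by apply/eqP => h; move: hi; rewrite h normr0 mulr0 leNgt ev.
rewrite -(vol_reflect X mW).
apply: (@le_trans _ _ (rmu R m (slab v 0 w r))).
  apply: le_measure; rewrite ?inE.
  - apply: (@measurable_preimage _ _ _ _ (fun y : T => X - y : T)) => //.
    by apply: measurable_rowB => //; exact: measurable_cst.
  - exact: measurable_slab.
  - move=> y /= Wy; split.
      by apply: enorm_ball_scube; have := WB _ Wy; rewrite /cball /= opprB addrC subrK subr0.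
    by have := Wv _ Wy; rewrite /= opprB addrC subrK addr0.
apply: le_trans (vol_slab 0 r0 w0 vi) _; rewrite lee_fin /=.
rewrite ler_wpM2l ?exprn_ge0 ?mulr_ge0// -[leRHS]mulrA ler_wpM2l ?mulr_ge0//.
rewrite ler_pdivlMr// mulrC ler_pdivrMr ?normr_gt0//.
Qed.

(** At distance [rho] the width is of order [B rho^(1 + alpha) / |v|], so dyadic volumes scale like
    [rho^(m + alpha)]; [alpha > s] makes the shells summable down to [X]. *)
Lemma mass_near : exists2 C, 0 < C & forall (X v : 'rV[R]_m) (B r : R) (W : set T),
  v <> 0 -> 0 <= B -> 0 < r -> measurable W -> W `<=` cball X r ->
  (forall y, W y -> `|dot v (X - y)| <= B * enorm (X - y) `^ (1 + alpha)) ->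
  (\int[rmu R m]_(y in W) (k X y)%:E <= (C * (B / enorm v) * r `^ (alpha - s))%:E)%E.
Proof.
pose z : R := 2^-1 `^ (alpha - s).
have as0 : 0 < alpha - s by rewrite subr_gt0.
have z1 : z < 1.
  have -> : 1 = 1 `^ (alpha - s) :> R by rewrite powR1.
  by apply: gt0_ltr_powR; rewrite ?nnegrE ?invr_ge0// invf_lt1// ltr1n.
pose D : R := 4 ^+ m' * (2 * 2 `^ (1 + alpha) * Num.sqrt m%:R).
have D0 : 0 < D by rewrite !mulr_gt0 ?exprn_gt0 ?powR_gt0 ?sqrtr_gt0.
have z10 : 0 < 1 - z by rewrite subr_gt0.
exists (D * z / (1 - z)); first by rewrite divr_gt0 ?mulr_gt0 ?powR_gt0 ?invr_gt0.
move=> X v B r W v0 B0 r0 mW WB Wv.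
have ev : 0 < enorm v by rewrite -(subr0 v) enorm_gt0.
have BD : 0 <= D * (B / enorm v) by rewrite mulr_ge0 ?divr_ge0 ?(ltW D0) ?(ltW ev).
apply: le_trans (kernel_dyadic s0 (a := r / 2) (lam := 2^-1) (gam := alpha) (C := D * (B / enorm v)) mW _ _ BD z1 _ _) _ => //.
- by rewrite divr_gt0.
- move=> y Wy Xy; apply: dyadic_near; first exact: enorm_gt0 Xy.
  exact: WB Wy.
- move=> j; set a := r / 2 * _.
  have a0 : 0 < a by rewrite mulr_gt0 ?divr_gt0 ?exprn_gt0 ?invr_gt0.
  have a20 : 0 <= 2 * a by rewrite mulr_ge0// ltW.
  apply: le_trans (vol_slab_ball (X := X) (v := v) (w := B * (2 * a) `^ (1 + alpha)) (r := 2 * a) _ _ _ _ _ _) _ => //.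
  + by rewrite mulr_ge0// powR_ge0.
  + by apply: measurableI => //; exact: measurable_cball.
  + move=> y [Wy hy]; apply: le_trans (Wv _ Wy) _; rewrite ler_wpM2l//.
    have al : 0 <= 1 + alpha by rewrite addr_ge0// (ltW (lt_trans s0 sa)).
    by apply: ge0_ler_powR; rewrite ?nnegrE ?enorm_ge0.
  rewrite lee_fin; apply: eq_ler.
  rewrite (powRM _ _ (ltW a0))// [in RHS](_ : m%:R + alpha = m'%:R + (1 + alpha)); last first.
    by rewrite -natr1; ring.
  rewrite (powRD (x := a) (r := m'%:R)); last by apply/implyP => _; rewrite gt_eqF.
  rewrite powR_mulrn ?(ltW a0)// (_ : 2 * (2 * a) = 4 * a) ?exprMn; last by ring.
  rewrite /D; field; rewrite gt_eqF//.
rewrite lee_fin; apply: eq_ler; rewrite powRM ?(ltW r0)// -/z.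
by field; rewrite !gt_eqF.
Qed.

Lemma pow2_lt1 (g : R) : g < 0 -> 2 `^ g < 1 :> R.
Proof.
move=> g0; rewrite -(opprK g) powRN invf_lt1 ?powR_gt0//.
rewrite (_ : (1 < _) = (1 `^ (- g) < 2 `^ (- g))); last by rewrite powR1.
by apply: gt0_ltr_powR; rewrite ?oppr_gt0 ?nnegrE// ltr1n.
Qed.

Lemma mass_far : exists2 C, 0 < C & forall (X : 'rV[R]_m) (r : R) (W : set T),
  0 < r -> measurable W -> (forall y, W y -> r < enorm (X - y)) ->
  (\int[rmu R m]_(y in W) (k X y)%:E <= (C * r `^ (- s))%:E)%E.
Proof.
have z1 : 2 `^ (0 - s) < 1 by apply: pow2_lt1; rewrite sub0r oppr_lt0.
have z10 : 0 < 1 - 2 `^ (0 - s) :> R by rewrite subr_gt0.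
exists (4 ^+ m / (1 - 2 `^ (0 - s))); first by rewrite divr_gt0 ?exprn_gt0.
move=> X r W r0 mW Wr.
apply: le_trans (kernel_dyadic s0 (a := r) (lam := 2) (gam := 0) (C := 4 ^+ m) mW _ _ _ z1 _ _) _ => //.
- by move=> y Wy _; apply: dyadic_far => //; exact: Wr.
- move=> j; set a := r * _; have a0 : 0 < a by rewrite mulr_gt0 ?exprn_gt0.
  apply: (@le_trans _ _ (rmu R m (scube X (2 * a)))).
    apply: le_measure; rewrite ?inE.
    + by apply: measurableI => //; exact: measurable_cball.
    + exact: measurable_scube.
    + by move=> y [_ hy]; apply: enorm_ball_scube; rewrite enormBC.
  have -> : rmu R m (scube X (2 * a)) = ((2 * (2 * a)) ^+ m)%:E.
    by apply: vol_scube; rewrite mulr_ge0 ?(ltW a0).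
  rewrite addr0 powR_mulrn ?(ltW a0)// lee_fin (_ : 2 * (2 * a) = 4 * a); last by ring.
  by rewrite exprMn.
by rewrite lee_fin sub0r; apply: eq_ler; ring.
Qed.

(** At scale [rho] a slab of width [w] has volume of order [w rho^(m - 1)], one power less than a
    ball; hence the additional factor [1 / r] compared with [mass_far]. *)
Lemma mass_far_slab : exists2 C, 0 < C & forall (X v : 'rV[R]_m) (w r : R) (W : set T),
  v <> 0 -> 0 <= w -> 0 < r -> measurable W ->
  (forall y, W y -> r < enorm (X - y) /\ `|dot v (X - y)| <= w) ->
  (\int[rmu R m]_(y in W) (k X y)%:E <= (C * (w / enorm v) * r `^ (- 1 - s))%:E)%E.
Proof.
have z1 : 2 `^ (-1 - s) < 1 by apply: pow2_lt1; rewrite subr_lt0 (lt_trans _ s0).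
have z10 : 0 < 1 - 2 `^ (-1 - s) :> R by rewrite subr_gt0.
pose D : R := 4 ^+ m' * (2 * Num.sqrt m%:R).
have D0 : 0 < D by rewrite !mulr_gt0 ?exprn_gt0 ?sqrtr_gt0.
exists (D / (1 - 2 `^ (-1 - s))); first by rewrite divr_gt0.
move=> X v w r W v0 w0 r0 mW Wr.
have ev : 0 < enorm v by rewrite -(subr0 v) enorm_gt0.
have BD : 0 <= D * (w / enorm v) by rewrite mulr_ge0 ?divr_ge0 ?(ltW D0) ?(ltW ev).
apply: le_trans (kernel_dyadic s0 (a := r) (lam := 2) (gam := -1) (C := D * (w / enorm v)) mW _ _ BD z1 _ _) _ => //.
- by move=> y Wy _; apply: dyadic_far => //; exact: (Wr y Wy).1.
- move=> j; set a := r * _; have a0 : 0 < a by rewrite mulr_gt0 ?exprn_gt0.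
  have a20 : 0 <= 2 * a by rewrite mulr_ge0// ltW.
  apply: le_trans (vol_slab_ball (X := X) (v := v) (w := w) (r := 2 * a) _ _ _ _ _ _) _ => //.
  + by apply: measurableI => //; exact: measurable_cball.
  + by move=> y [/Wr[]].
  rewrite lee_fin (_ : m%:R + -1 = m'%:R); last by rewrite -natr1; ring.
  rewrite powR_mulrn ?(ltW a0)// (_ : 2 * (2 * a) = 4 * a) ?exprMn; last by ring.
  by apply: eq_ler; rewrite /D; field; rewrite gt_eqF.
by rewrite lee_fin; apply: eq_ler; field; rewrite !gt_eqF.
Qed.

End Masses.

(** * Interaction measure and perimeter *)

#[local] Opaque rmu.

Section Energy.
Context {R : realType}.
Variables (m : nat) (s : R).
Local Notation T := (rowT R m).
Local Notation mu := (rmu R m).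
Local Notation mu2 := (mu \x mu)%E.
Implicit Types (Z : set (T * T)) (A B E F D N U : set T).

Definition kk (z : T * T) : \bar R := (knl s z.1 z.2)%:E.

Lemma kk_ge0 z : (0 <= kk z)%E. Proof. by rewrite lee_fin knl_ge0. Qed.

Lemma measurable_kk : measurable_fun setT kk.
Proof. exact: measurable_knl. Qed.

Lemma measurable_kkx x : measurable_fun setT (fun y : T => (knl s x y)%:E).
Proof. by apply: measurable_knl => //; exact: measurable_cst. Qed.

(** Regarded as a measure on pairs of points, the interaction inherits additivity, subadditivity and
    continuity from below, on which all perimeter comparisons rest. *)
Definition J Z : \bar R := (\int[mu2]_(z in Z) kk z)%E.

Lemma J0 : J set0 = 0%E. Proof. exact: integral_set0. Qed.
Lemma J_ge0 Z : (0 <= J Z)%E. Proof. by apply: integral_ge0 => z _; exact: kk_ge0. Qed.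
Lemma J_semi_sigma_additive : semi_sigma_additive J.
Proof.
move=> F mF tF mUF; rewrite /J ge0_integral_bigcup//; last 2 first.
- by apply: measurable_funTS; exact: measurable_kk.
- by move=> z _; exact: kk_ge0.
by apply: is_cvg_nneseries => n _ _; exact: J_ge0.
Qed.

HB.instance Definition _ := isMeasure.Build _ _ _ J J0 J_ge0 J_semi_sigma_additive.

Lemma le_J Z Z' : measurable Z -> measurable Z' -> Z `<=` Z' -> (J Z <= J Z')%E.
Proof. by move=> mZ mZ' ZZ'; apply: le_measure; rewrite ?inE. Qed.

Lemma J_setU Z Z' : measurable Z -> measurable Z' -> Z `&` Z' = set0 ->
  J (Z `|` Z') = (J Z + J Z')%E.
Proof. exact: measureU. Qed.

Lemma JE_indic Z : measurable Z -> J Z = (\int[mu2]_z (kk z * (\1_Z z)%:E))%E.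
Proof.
move=> mZ; rewrite /J integral_mkcond; apply: eq_integral => z _.
rewrite patchE indicE; case: ifPn => _; rewrite ?mule1 ?mule0//.
Qed.

Lemma measurable_kkI Z : measurable Z -> measurable_fun setT (fun z => kk z * (\1_Z z)%:E)%E.
Proof.
by move=> mZ; apply: emeasurable_funM; [exact: measurable_kk|exact/measurable_EFinP].
Qed.

Lemma kkI_ge0 Z z : (0 <= kk z * (\1_Z z)%:E)%E.
Proof. by rewrite mule_ge0 ?kk_ge0// lee_fin. Qed.

Lemma sect_integralE Z x : (\int[mu]_(y in [set y | Z (x, y)]) (knl s x y)%:E =
   \int[mu]_y (kk (x, y) * (\1_Z (x, y))%:E))%E.
Proof.
rewrite integral_mkcond; apply: eq_integral => y _.
rewrite patchE indicE; case: ifPn => /= h; first by rewrite mem_set ?mule1//; exact: (set_mem h).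
by rewrite memNset ?mule0// => hh; move/negP: h; apply; exact/mem_set.
Qed.

Lemma JE1 Z : measurable Z ->
  J Z = (\int[mu]_x \int[mu]_(y in [set y | Z (x, y)]) (knl s x y)%:E)%E.
Proof.
move=> mZ; rewrite (JE_indic mZ) (fubini_tonelli1 _ (measurable_kkI mZ) (kkI_ge0 Z)).
by apply: eq_integral => x _; rewrite sect_integralE.
Qed.

Lemma measurable_sect_integral Z : measurable Z -> measurable_fun setT
  (fun x => \int[mu]_(y in [set y | Z (x, y)]) (knl s x y)%:E)%E.
Proof.
move=> mZ; under eq_fun do rewrite sect_integralE.
exact: (@measurable_fun_fubini_tonelli_F _ _ _ _ R mu _ (measurable_kkI mZ) (kkI_ge0 _)).
Qed.

Lemma JE2 Z : measurable Z ->
  J Z = (\int[mu]_y \int[mu]_(x in [set x | Z (x, y)]) (knl s x y)%:E)%E.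
Proof.
move=> mZ; rewrite (JE_indic mZ) (fubini_tonelli2 _ (measurable_kkI mZ) (kkI_ge0 Z)).
apply: eq_integral => x _; rewrite [RHS]integral_mkcond; apply: eq_integral => y _.
by rewrite patchE indicE; case: ifPn => /= h; [rewrite mem_set ?mule1//; exact: (set_mem h)|rewrite memNset ?mule0// => hh; move/negP: h; apply; exact/mem_set].
Qed.

Lemma measurable_swapset Z : measurable Z -> measurable [set z | Z (z.2, z.1)].
Proof.
move=> mZ; apply: (@measurable_preimage _ _ _ _ (fun z : T * T => (z.2, z.1))) => //.
exact: measurable_fun_pair.
Qed.

Lemma J_swap Z : measurable Z -> J [set z | Z (z.2, z.1)] = J Z.
Proof.
move=> mZ; rewrite (JE1 (measurable_swapset mZ)) (JE2 mZ).
by apply: eq_integral => x _; apply: eq_integral => y _; rewrite knlC.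
Qed.

Lemma measurable_fst_set A : measurable A -> measurable [set z : T * T | A z.1].
Proof. by move=> mA; exact: (measurable_preimage measurable_fst). Qed.

Lemma measurable_snd_set A : measurable A -> measurable [set z : T * T | A z.2].
Proof. by move=> mA; exact: (measurable_preimage measurable_snd). Qed.

Lemma J_null1 N : measurable N -> mu N = 0%E -> J [set z | N z.1] = 0%E.
Proof.
move=> mN N0; rewrite JE1; last exact: measurable_fst_set.
transitivity (\int[mu]_(x in N) \int[mu]_y (knl s x y)%:E)%E.
  rewrite [RHS]integral_mkcond; apply: eq_integral => x _; rewrite patchE.
  case: ifPn => [/set_mem /= h|h].
    by congr (integral _ _ _); apply/seteqP; split.
  rewrite (_ : [set y | _] = set0) ?integral_set0//.
  by apply/seteqP; split => y //= hh; move/negP: h; apply; exact/mem_set.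
apply: null_set_integral => //; apply: measurable_funTS.
apply: (@measurable_fun_fubini_tonelli_F _ _ _ _ R mu kk); [exact: measurable_kk|exact: kk_ge0].
Qed.

Lemma J_null2 N : measurable N -> mu N = 0%E -> J [set z | N z.2] = 0%E.
Proof.
move=> mN N0; rewrite -(J_null1 mN N0) -[RHS]J_swap//; exact: measurable_fst_set.
Qed.

(** The three interactions in the definition of the perimeter combine into one set of pairs, those
    that touch [U]. Separate [A] and [B] allow sets that are not complementary. *)
Definition perAB A B U : set (T * T) := [set z | [/\ A z.1, B z.2 & U z.1 \/ U z.2]].
Definition per E U := J (perAB E (~` E) U).

Lemma measurable_perAB A B U : measurable A -> measurable B -> measurable U ->
  measurable (perAB A B U).
Proof.
move=> mA mB mU; rewrite (_ : perAB A B U = [set z | A z.1] `&` [set z | B z.2] `&`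
   ([set z | U z.1] `|` [set z | U z.2])).
  apply: measurableI; first by apply: measurableI; [exact: measurable_fst_set|exact: measurable_snd_set].
  by apply: measurableU; [exact: measurable_fst_set|exact: measurable_snd_set].
by apply/seteqP; split => z /= => [[]|[[]]].
Qed.

Lemma measurableXs A B : measurable A -> measurable B -> measurable (A `*` B).
Proof. exact: measurableX. Qed.

Lemma LsE A B : measurable A -> measurable B -> Ls s A B = J (A `*` B).
Proof.
move=> mA mB; have mX := measurableXs mA mB.
have E (x y : T) : (\1_A x * \1_B y * enorm (x - y : 'rV[R]_m) `^ (- (m%:R + s)))%:E =
    (kk (x, y) * (\1_(A `*` B) (x, y))%:E)%E.
  by rewrite -EFinM mulrC; congr (_ * _)%:E; rewrite !indicE in_setX -natrM mulnb.
rewrite (JE_indic mX) (fubini_tonelli1 _ (measurable_kkI mX) (kkI_ge0 _)).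
transitivity (iint (fun x : T => \int[mu]_y (kk (x, y) * (\1_(A `*` B) (x, y))%:E))%E).
  congr iint; apply/funext => x; rewrite -iintE.
  - by congr iint; apply/funext => y; exact: E.
  - exact: (@measurableT_comp _ _ _ _ _ _ _ _ (pair x : T -> T * T) (measurable_kkI mX) (measurable_pair1 (x : T))).
  - by move=> y; exact: kkI_ge0.
rewrite iintE.
- by [].
- exact: (@measurable_fun_fubini_tonelli_F _ _ _ _ R mu _ (measurable_kkI mX) (kkI_ge0 _)).
- by move=> x; apply: integral_ge0 => y _; exact: kkI_ge0.
Qed.

(** [Per_s] with its two sets decoupled, for [A] and [B] that only approximate a set and its
    complement from inside. *)
Definition Ls3 A B U : \bar R :=
  (Ls s (A `&` U) (B `&` U) + Ls s (A `&` U) (B `&` ~` U) + Ls s (A `&` ~` U) (B `&` U))%E.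

Lemma Ls3E A B U : measurable A -> measurable B -> measurable U ->
  Ls3 A B U = J (perAB A B U).
Proof.
move=> mA mB mU; have mU' := measurableC mU.
have m1 := measurableXs (measurableI _ _ mA mU) (measurableI _ _ mB mU).
have m2 := measurableXs (measurableI _ _ mA mU) (measurableI _ _ mB mU').
have m3 := measurableXs (measurableI _ _ mA mU') (measurableI _ _ mB mU).
rewrite /Ls3 !LsE; do ?[exact: measurableI|exact: mU|exact: mA|exact: mB].
rewrite -J_setU//; last first.
  by apply/seteqP; split => // z [[_ [_ h1]] [_ [_ h2]]].
rewrite -J_setU//; last first.
  by apply/seteqP; split => // z [[[[_ h1] _]|[[_ h1] _]] [[_ h2] _]].
- exact: measurableU.
- congr (J _); apply/seteqP; split => z /=.
    by move=> [[[[? ?] [? ?]]|[[? ?] [? ?]]]|[[? ?] [? ?]]]; split => //; tauto.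
  move=> [h1 h2 h3]; have [u1|u1] := pselect (U z.1); have [u2|u2] := pselect (U z.2); rewrite /setX/=; tauto.
Qed.

Lemma le_Ls A A' B B' : A `<=` A' -> B `<=` B' -> (Ls s A B <= Ls s A' B')%E.
Proof.
have mono (C C' : set T) x : C `<=` C' -> (\1_C x <= \1_C' x :> R).
  move=> CC'; rewrite !indicE; case: (boolP (x \in C)) => [/set_mem/CC' h|_].
    by rewrite mem_set.
  by rewrite ler0n.
move=> AA' BB'; apply: le_iint => x.
  apply: iint_ge0 => y; rewrite lee_fin !mulr_ge0 ?powR_ge0//.
apply: le_iint => y; rewrite lee_fin; first by rewrite !mulr_ge0 ?powR_ge0//.
by rewrite ler_wpM2r ?powR_ge0// ler_pM ?mono.
Qed.

Lemma le_Ls3 A A' B B' U : A `<=` A' -> B `<=` B' -> (Ls3 A B U <= Ls3 A' B' U)%E.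
Proof.
by move=> AA' BB'; rewrite !leeD// le_Ls//; apply: setSI.
Qed.

Lemma Per_sE E U : measurable E -> measurable U -> Per_s s E U = per E U.
Proof. by move=> mE mU; rewrite /per -(Ls3E mE (measurableC mE) mU). Qed.

Lemma open_borel U : open U -> measurable U.
Proof. by move=> oU; exact: sub_gen_smallest. Qed.

Lemma volE N : measurable N -> vol N = mu N.
Proof. by move=> mN; rewrite /vol iintE ?measureE_int//; exact/measurable_EFinP. Qed.

(** A competitor [F] is only Lebesgue measurable. It contains a Borel set [F'] and its complement
    contains a Borel set [C]; together they miss only a null subset of [U]. Monotonicity of [Ls3],
    valid for arbitrary sets, then bounds the perimeter of [F] below by that of the Borel competitor
    [F']. *)
Lemma s_minimal_borel E U : measurable E -> open U -> (per E U < +oo)%E ->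
  (forall F, measurable F -> F `\` U = E `\` U -> (per E U <= per F U)%E) ->
  s_minimal s E U.
Proof.
move=> mE oU fE minE; have mU := open_borel oU; split; first by rewrite Per_sE.
move=> F [B [N [bB [bN [N0 BFN]]]]] FE; rewrite Per_sE//.
have mB : measurable (B : set T) by exact: bB.
have mN : measurable (N : set T) by exact: bN.
rewrite volE// in N0.
pose F' : set T := ((B `\` N) `&` U) `|` (E `\` U).
pose C : set T := (~` (B `|` N) `&` U) `|` (~` E `\` U).
have mF' : measurable F'.
  by apply: measurableU; [apply: measurableI => //|]; exact: measurableD.
have mC : measurable C.
  apply: measurableU; first by apply: measurableI => //; apply/measurableC/measurableU.
  by apply: measurableD => //; exact: measurableC.
have subF : F' `<=` F.
  move=> x [[[Bx nN] Ux]|].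
    by apply: contrapT => nF; apply: nN; apply: BFN; right.
  by rewrite -FE => -[].
have subC : C `<=` ~` F.
  move=> x [[nBN Ux] Fx|[nE nU] Fx].
    by apply: (nBN); right; apply: BFN; left; split => // Bx; apply: (nBN); left.
  by have : (F `\` U) x by []; rewrite FE => -[].
have F'E : F' `\` U = E `\` U.
  apply/seteqP; split => x.
    by move=> [[[_ ?]//|[? ?]] ?].
  by move=> [? ?]; split => //; right.
apply: le_trans (minE _ mF' F'E) _.
apply: le_trans (le_Ls3 U subF subC); rewrite Ls3E//.
have mZ := measurable_perAB mF' mC mU.
have mN2 := measurable_snd_set mN.
(* The complement of [F'] and the set [C] differ only inside [N]. *)
apply: (@le_trans _ _ (J (perAB F' C U `|` [set z | N z.2]))).
  apply: le_J => //.
  - by apply: measurable_perAB => //; exact: measurableC.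
  - exact: measurableU.
  - move=> z [h1 h2 h3]; have [|nN] := pselect (N z.2); first by right.
    left; split => //; have [Uz|nU] := pselect (U z.2).
      by left; split => // -[Bz|//]; apply: h2; left.
    by right; split => // Ez; apply: h2; right.
apply: le_trans (measureU2 _ _ _) _ => //.
by rewrite [X in (_ + X)%E]J_null2// adde0.
Qed.

End Energy.

(** * Calibrations *)

Section Calibration.
Context {R : realType}.
Variables (m' : nat) (s : R).
Hypothesis s0 : 0 < s.
Local Notation m := m'.+1.
Local Notation T := (rowT R m).
Local Notation mu := (rmu R m).
Local Notation k := (@knl R m s).
Local Notation J := (@J R m s).
Implicit Types (A B D E F U : set T) (Z : set (T * T)).

Definition far (t : R) : set (T * T) := [set z | t < enorm (z.1 - z.2 : 'rV[R]_m)].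

Lemma measurable_far t : measurable (far t).
Proof.
apply: measurable_ltr_set => //; apply: measurable_enorm.
exact: measurable_rowB.
Qed.

(** Continuity from below exhausts all pairs of distinct points; what is left is the diagonal, where
    the kernel is [0]. *)
Lemma J_trunc Z : measurable Z -> (fun i => J (Z `&` far i.+1%:R^-1)) @ \oo --> J Z.
Proof.
move=> mZ.
have mi i : measurable (Z `&` far i.+1%:R^-1) by apply: measurableI => //; exact: measurable_far.
have mU : measurable (\bigcup_i (Z `&` far i.+1%:R^-1)) by apply: bigcupT_measurable.
have -> : J Z = J (\bigcup_i (Z `&` far i.+1%:R^-1)).
  have mD : measurable (Z `&` ~` \bigcup_i (far i.+1%:R^-1)).
    apply: measurableI => //; apply: measurableC; apply: bigcupT_measurable => i; exact: measurable_far.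
  have -> : J Z = J ((\bigcup_i (Z `&` far i.+1%:R^-1)) `|` (Z `&` ~` \bigcup_i (far i.+1%:R^-1))).
    congr (J _); apply/seteqP; split => z.
      move=> Zz; have [[i _ fz]|nf] := pselect ((\bigcup_i (far i.+1%:R^-1)) z).
        by left; exists i.
      by right.
    by move=> [[i _ []]|[]].
  rewrite J_setU//; last first.
    by apply/seteqP; split => // z [[i _ [_ fz]] [_ nf]]; apply: nf; exists i.
  suff -> : J (Z `&` ~` \bigcup_i (far i.+1%:R^-1)) = 0%E by rewrite adde0.
  apply: integral0_eq => z [_ nf]; rewrite /kk.
  have [<-|ne] := pselect (z.1 = z.2); first by rewrite knl_diag.
  exfalso; apply: nf; have e0 := enorm_gt0 ne.
  by have [i _ hi] := near_infty_natSinv_lt (PosNum e0); exists i => //; exact: (hi i (leqnn i)).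
apply: nondecreasing_cvg_mu => // i j ij; apply/subsetPset => z [Zz fz]; split => //.
by apply: le_lt_trans fz; rewrite lef_pV2 ?posrE// ler_nat.
Qed.

Lemma J_le_trunc Z (b : \bar R) (t0 : R) : measurable Z -> 0 < t0 ->
  (forall t, 0 < t < t0 -> (J (Z `&` far t) <= b)%E) -> (J Z <= b)%E.
Proof.
move=> mZ t00 hb; rewrite -(cvg_lim _ (J_trunc mZ))//.
apply: lime_le; first by apply/cvg_ex; exists (J Z); exact: J_trunc.
have [i0 _ hi] := near_infty_natSinv_lt (PosNum t00).
exists i0 => // i ii; apply: hb; rewrite invr_gt0 ltr0Sn/=; exact: hi.
Qed.

Lemma measurable_sect Z x : measurable Z -> measurable [set y | Z (x, y)].
Proof. by move=> mZ; apply: (measurable_preimage (h := pair x)). Qed.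

(** Each point of [D] sees a truncated kernel of bounded mass. Finiteness of truncated interactions
    is what allows terms to be cancelled in the calibration. *)
Lemma J_prod_finite D Z t : measurable D -> measurable Z -> 0 < t -> (mu D < +oo)%E ->
  Z `<=` [set z | D z.1] `&` far t -> (J Z < +oo)%E.
Proof.
move=> mD mZ t0 fD ZD; have [C C0 hC] := mass_far m' s0.
rewrite JE1//.
apply: (@le_lt_trans _ _ (\int[mu]_x ((C * t `^ (- s))%:E * (\1_D x)%:E))%E).
  apply: le_integral_nomeas => x; first by apply: integral_ge0 => y _; rewrite lee_fin knl_ge0.
  rewrite indicE; case: (boolP (x \in D)) => [_|/negP nD].
    rewrite mule1; apply: (hC x t) => //; first exact: measurable_sect.
    by move=> y /ZD[].
  rewrite (_ : [set y | _] = set0) ?integral_set0 ?mule0//.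
  by apply/seteqP; split => y // /ZD[/= Dx _]; apply: nD; exact/mem_set.
rewrite ge0_integralZl_EFin//; last 2 first.
- exact/measurable_EFinP.
- by rewrite mulr_ge0 ?powR_ge0// ltW.
rewrite -measureE_int// lte_mul_pinfty// ?lee_fin ?mulr_ge0 ?powR_ge0// ltW//.
Qed.

(** The kernel mass of [below] minus that of [above] is the fractional mean curvature at [x],
    truncated at distance [t], of [A] enlarged by the superlevel set of [phi] through [x]. *)
Definition below A (phi : T -> R) (x : T) (t : R) : set T :=
  [set y | [/\ ~ A y, phi y < phi x & t < enorm (x - y : 'rV[R]_m)]].
Definition above A (phi : T -> R) (x : T) (t : R) : set T :=
  [set y | (A y \/ phi x < phi y) /\ t < enorm (x - y : 'rV[R]_m)].

(* For [z] in [D x D] the sign of [phi z.2 - phi z.1] is antisymmetric, so these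
   pairs cancel and only the interaction of [D] with its complement survives. *)
Lemma calibration D F A (phi : T -> R) (c t0 : R) :
  measurable D -> measurable F -> measurable A -> measurable_fun setT phi ->
  (mu D < +oo)%E -> D `&` F = set0 -> A `<=` F ->
  (forall x, D x -> 0 < phi x) -> (forall y, ~ F y -> ~ D y -> phi y <= 0) ->
  0 <= c -> 0 < t0 ->
  (forall x t, D x -> 0 < t < t0 ->
    (\int[mu]_(y in below A phi x t) (k x y)%:E + c%:E <=
     \int[mu]_(y in above A phi x t) (k x y)%:E)%E) ->
  (J (D `*` ~` (F `|` D)) + c%:E * mu D <= J (D `*` F))%E.
Proof.
move=> mD mF mA mphi fD DF AF phiD phiN c0 t00 hcal.
have mphi1 : measurable_fun setT (fun z : T * T => phi z.1) by exact: (measurableT_comp mphi measurable_fst).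
have mphi2 : measurable_fun setT (fun z : T * T => phi z.2) by exact: (measurableT_comp mphi measurable_snd).
have mlt12 : measurable [set z : T * T | phi z.1 < phi z.2] by exact: measurable_ltr_set.
have mlt21 : measurable [set z : T * T | phi z.2 < phi z.1] by exact: measurable_ltr_set.
have mDF : measurable (D `*` F) by exact: measurableX.
have mDN : measurable (D `*` ~` (F `|` D)) by apply: measurableX => //; apply/measurableC/measurableU.
have fcD : (c%:E * mu D)%E \is a fin_num by rewrite fin_numM// ge0_fin_numE.
(* The finite term [c * mu D] is moved to the right, so that the left side is a single interaction,
   to which truncation applies. *)
rewrite addeC -leeBrDl; last by rewrite fin_numE in fcD; exact: fcD.
apply: (J_le_trunc mDN t00) => t tt; have t_gt0 : 0 < t by case/andP: tt.
rewrite leeBrDl//.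
have mf := measurable_far t.
pose M : set (T * T) := [set z | D z.1] `&` [set z | ~ A z.2] `&` [set z | phi z.2 < phi z.1] `&` far t.
pose P : set (T * T) := [set z | D z.1] `&` ([set z | A z.2] `|` [set z | phi z.1 < phi z.2]) `&` far t.
have mD1 := measurable_fst_set mD.
have mA2 := measurable_snd_set mA.
have mM : measurable M.
  by apply: measurableI => //; apply: measurableI => //; apply: measurableI => //; exact: measurableC.
have mP : measurable P.
  by apply: measurableI => //; apply: measurableI => //; exact: measurableU.
have MP : (J M + c%:E * mu D <= J P)%E.
  rewrite (JE1 s mM) (JE1 s mP) (measureE_int mu mD) -ge0_integralZl_EFin//; last exact/measurable_EFinP.
  rewrite -ge0_integralD//; last 4 first.
  - by move=> x _; apply: integral_ge0 => y _; rewrite lee_fin knl_ge0.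
  - exact: measurable_sect_integral.
  - by move=> x _; rewrite -EFinM lee_fin mulr_ge0.
  - by apply: emeasurable_funM => //; exact/measurable_EFinP.
  apply: le_integral_nomeas => x.
    by rewrite adde_ge0 ?integral_ge0// => [y _|]; rewrite lee_fin ?knl_ge0 ?mulr_ge0.
  rewrite indicE; case: (boolP (x \in D)) => [/set_mem Dx|/negP nD].
    have -> : [set y | M (x, y)] = below A phi x t.
      by apply/seteqP; split => y /= [] => [[[? ?] ?]|? ?] ?; do 3 ?split.
    have -> : [set y | P (x, y)] = above A phi x t.
      by apply/seteqP; split => y /= [] => [[? ?]|?] ?; do 2 ?split.
    rewrite mule1; exact: hcal.
  rewrite mule0 adde0 (_ : [set y | _] = set0) ?integral_set0 ?integral_ge0//.
    by move=> y _; rewrite lee_fin knl_ge0.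
  by apply/seteqP; split => y // [[[Dx _] _] _]; apply: nD; exact/mem_set.
pose MD := M `&` [set z | D z.2]; pose PD := P `&` [set z | D z.2].
have mD2 := measurable_snd_set mD.
have mMD : measurable MD by exact: measurableI.
have mPD : measurable PD by exact: measurableI.
have swapMP : J MD = J PD.
  rewrite -(J_swap s mMD); congr (J _).
  have nA x : D x -> ~ A x by move=> Dx /AF Fx; have : (D `&` F) x by []; rewrite DF.
  apply/seteqP; split => z; rewrite /MD /PD /M /P /far /=.
    by move=> [[[[D2 nA1] ph] ft] D1]; rewrite enormBC; do 3 split => //; right.
  move=> [[[D1 [/nA//|ph]] ft] D2]; rewrite enormBC; do 4 split => //; exact: nA.
(* Finite thanks to the truncation, so that the interaction of [D] with itself can be cancelled at
   the end. *)
have fPD : J PD \is a fin_num.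
  rewrite ge0_fin_numE//; apply: (@J_prod_finite D _ t) => //.
  by move=> z [[[D1 _] ft] _].
have h1 : (J (D `*` ~` (F `|` D) `&` far t) + J MD <= J M)%E.
  rewrite -J_setU//; [|exact: measurableI|].
    apply: le_J => //; first by apply: measurableU => //; exact: measurableI.
    move=> z [[[D1 nFD] ft]|[]//]; split; last exact: ft.
    split; first by split => // /AF ?; apply: nFD; left.
    apply: le_lt_trans (phiD _ D1); apply: phiN => ?; apply: nFD; [by left|by right].
  by apply/seteqP; split => // z [[[_ nFD] _] [_ D2]]; apply: nFD; right.
have h2 : (J P <= J (D `*` F) + J PD)%E.
  rewrite (_ : P = (P `&` ~` [set z | D z.2]) `|` PD); last by rewrite -setIUr setUC setUCr setIT.
  have mPn : measurable (P `&` ~` [set z | D z.2]) by apply: measurableI => //; exact: measurableC.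
  rewrite J_setU//; last by apply/seteqP; split => // z [[_ nD] [_ D2]].
  apply: leeD => //; apply: le_J => // z [[[D1 AP] ft] nD2]; split => //.
  case: AP => [/AF//|ph]; apply: contrapT => nF2.
  by have := phiN _ nF2 nD2; rewrite leNgt (lt_trans (phiD _ D1) ph).
rewrite -(leeD2rE _ _ fPD) -[in leLHS]swapMP addeAC.
rewrite -addeA addeC [in leLHS](addeC (J MD)).
apply: le_trans h2; apply: le_trans MP; exact: leeD.
Qed.

End Calibration.

(** * Minimizers *)

Section Minimizers.
Context {R : realType}.
Variables (m : nat) (s : R).
Local Notation T := (rowT R m).
Local Notation mu := (rmu R m).
Local Notation J := (@J R m s).
Local Notation per := (@per R m s).
Implicit Types (A B D E F U K L M : set T) (Z : set (T * T)).

Lemma perE E U : per E U = J (perAB E (~` E) U).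
Proof. by []. Qed.

Lemma measurable_per E U : measurable E -> measurable U -> measurable (perAB E (~` E) U).
Proof. by move=> mE mU; apply: measurable_perAB => //; exact: measurableC. Qed.

Lemma J_setUI Z Z' : measurable Z -> measurable Z' ->
  (J Z + J Z' = J (Z `|` Z') + J (Z `&` Z'))%E.
Proof.
move=> mZ mZ'; have mD : measurable (Z' `\` Z) by exact: measurableD.
have mI : measurable (Z `&` Z') by exact: measurableI.
have -> : J Z' = (J (Z' `\` Z) + J (Z `&` Z'))%E.
  rewrite -J_setU//; last by apply/seteqP; split => // z [[_ h] [? _]].
  congr (J _); apply/seteqP; split => z; last by move=> [[]|[]].
  by move=> z'; case: (pselect (Z z)) => zz; [right|left].
rewrite addeA -(J_setU s mZ mD); last by apply/seteqP; split => // z [? [_ ?]].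
congr (J _ + _)%E; apply/seteqP; split => z.
  by move=> [?|[? _]]; [left|right].
by move=> [?|?]; [left|case: (pselect (Z z)) => zz; [left|right]].
Qed.

(** A pair counted for the union or for the intersection is counted for [A] or for [B], and a pair
    counted for both of the former is counted for both of the latter. *)
Lemma per_submodular A B U : measurable A -> measurable B -> measurable U ->
  (per (A `|` B) U + per (A `&` B) U <= per A U + per B U)%E.
Proof.
move=> mA mB mU.
have mAB := measurableU _ _ mA mB; have mAiB := measurableI _ _ mA mB.
have m1 := measurable_per mAB mU; have m2 := measurable_per mAiB mU.
have m3 := measurable_per mA mU; have m4 := measurable_per mB mU.
rewrite !perE (J_setUI m1 m2) (J_setUI m3 m4); apply: leeD; apply: le_J.
- exact: measurableU.
- exact: measurableU.
- move=> z [[[a|b] /not_orP[na nb] u]|[[a b] nab u]]; [by left|by right|].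
  by case: (pselect (A z.2)) => a2; [right; split => // b2; exact: nab|left].
- exact: measurableI.
- exact: measurableI.
- by move=> z [[_ /not_orP[na nb] u] [[a b] _ _]].
Qed.

(** Pairs from [F n] to the complement of the whole union increase with [n], so [J] is continuous
    along them, and they are fewer than the pairs counted by the perimeter of [F n]. *)
Lemma per_le_up (F : nat -> set T) U c : (forall n, measurable (F n)) -> measurable U ->
  (forall n, F n `<=` F n.+1) -> (forall n, (per (F n) U <= c)%E) ->
  (per (\bigcup_n F n) U <= c)%E.
Proof.
move=> mF mU Fi Fc; set G := \bigcup_n F n.
have mG : measurable G by exact: bigcupT_measurable.
have nd i j : (i <= j)%N -> F i `<=` F j.
  move=> /subnK <-; elim: (j - i)%N => [//|n IH]; rewrite addSn; exact: subset_trans (Fi _).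
pose Z n := perAB (F n) (~` G) U.
have mZ n : measurable (Z n) by apply: measurable_perAB => //; exact: measurableC.
rewrite !perE (_ : perAB G (~` G) U = \bigcup_n Z n); last first.
  apply/seteqP; split => z; first by move=> [[n _ Fz] h u]; exists n.
  by move=> [n _ [Fz h u]]; split => //; exists n.
have cv : (fun n => J (Z n)) @ \oo --> J (\bigcup_n Z n).
  apply: nondecreasing_cvg_mu => //; first exact: bigcupT_measurable.
  by move=> i j ij; apply/subsetPset => z [Fz h u]; split => //; exact: nd Fz.
rewrite -(cvg_lim _ cv)//; apply: lime_le; first by apply/cvg_ex; exists (J (\bigcup_n Z n)).
apply: nearW => n; apply: le_trans (Fc n); apply: le_J => //.
  exact: measurable_per.
by move=> z [Fz h u]; split => // Fn; apply: h; exists n.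
Qed.

Lemma perC E U : measurable E -> measurable U -> per (~` E) U = per E U.
Proof.
move=> mE mU; rewrite !perE -(J_swap s (measurable_per mE mU)); congr (J _).
rewrite setCK; apply/seteqP; split => z [/= h1 h2 h3]; split => //=; tauto.
Qed.

Lemma per_le_down (F : nat -> set T) U c : (forall n, measurable (F n)) -> measurable U ->
  (forall n, F n.+1 `<=` F n) -> (forall n, (per (F n) U <= c)%E) ->
  (per (\bigcap_n F n) U <= c)%E.
Proof.
move=> mF mU Fi Fc; rewrite -perC//; last exact: bigcapT_measurable.
rewrite setC_bigcap; apply: per_le_up => // n; first exact: measurableC.
  by apply: subsetC.
by rewrite perC.
Qed.

Lemma exists_minimizer L M : measurable L -> measurable M -> L `<=` M ->
  (per L (M `\` L) < +oo)%E ->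
  exists E, [/\ measurable E, L `<=` E, E `<=` M &
    forall F, measurable F -> L `<=` F -> F `<=` M -> (per E (M `\` L) <= per F (M `\` L))%E].
Proof.
move=> mL mM LM fL; set K := M `\` L; have mK : measurable K by exact: measurableD.
pose C : set (set T) := [set F | [/\ measurable F, L `<=` F & F `<=` M]].
have CL : C L by split.
pose i0 := ereal_inf [set per F K | F in C].
have i0le F : C F -> (i0 <= per F K)%E by move=> CF; apply: ereal_inf_lbound; exists F.
have i00 : (0 <= i0)%E by apply: le_ereal_inf_tmp => _ [F _ <-]; exact: J_ge0.
have i0f : i0 \is a fin_num by rewrite ge0_fin_numE//; exact: le_lt_trans (i0le _ CL) fL.
have exE n : exists E, C E /\ (per E K <= i0 + (2^-1 ^+ n)%:E)%E.
  have en : (0 < 2^-1 ^+ n :> R) by rewrite exprn_gt0.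
  have [_ [E CE <-] hE] := lb_ereal_inf_adherent en i0f.
  by exists E; split => //; exact: ltW.
have [E hE] := choice exE.
have CU A B : C A -> C B -> C (A `|` B).
  move=> [mA LA AM] [mB LB BM]; split; first exact: measurableU.
    by move=> x /LA; left.
  by move=> x [/AM|/BM].
have CI A B : C A -> C B -> C (A `&` B).
  move=> [mA LA AM] [mB LB BM]; split; first exact: measurableI.
    by move=> x Lx; split; [exact: LA|exact: LB].
  by move=> x [/AM].
(* The sets [E n] to [E (n + N)], the last one included. *)
pose V n N := \big[setU/set0]_(n <= j < n + N.+1) E j.
have VS n N : V n N.+1 = V n N `|` E (n + N.+1)%N.
  by rewrite /V (addnS n N.+1) big_nat_recr ?leq_addr.
have V0 n : V n 0 = E n by rewrite /V addn1 big_nat1.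
have CV n N : C (V n N).
  elim: N => [|N IH]; first by rewrite V0; exact: (hE n).1.
  by rewrite VS; apply: CU => //; exact: (hE _).1.
(* A further union costs at most the excess of the new set, because the intersection is admissible
   and has perimeter at least [i0]. The excesses [2^-j] for [j] from [n] to [n + N] add up to
   [2^-n (2 - 2^-N)]. *)
have perV n N : (per (V n N) K <= i0 + (2^-1 ^+ n * (2 - 2^-1 ^+ N))%:E)%E.
  elim: N => [|N IH]; first by rewrite V0 expr0 (_ : 2 - 1 = 1) ?mulr1 ?(hE n).2//; ring.
  have [CE pE] := hE (n + N.+1)%N; rewrite VS.
  have [mV _ _] := CV n N; have [mE _ _] := CE.
  have sub := per_submodular mV mE mK.
  have low := i0le _ (CI _ _ (CV n N) CE).
  rewrite -(leeD2rE _ _ i0f); apply: le_trans (leeD (lexx _) low) _.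
  apply: le_trans sub _; apply: le_trans (leeD IH pE) _.
  rewrite -(fineK i0f) -!EFinD lee_fin exprD; apply: eq_ler; rewrite !exprS; by field.
pose G n := \bigcup_N V n N.
have mG n : measurable (G n) by apply: bigcupT_measurable => N; have [] := CV n N.
have perG n : (per (G n) K <= i0 + (2 * 2^-1 ^+ n)%:E)%E.
  apply: per_le_up => // [N|N|N]; first by have [] := CV n N.
    by rewrite VS => x; left.
  apply: le_trans (perV n N) _; rewrite leeD2l// lee_fin mulrC ler_wpM2r ?exprn_ge0//.
  by rewrite gerBl exprn_ge0.
have Gd n : G n.+1 `<=` G n.
  move=> x [N _ Vx]; exists N.+1 => //; rewrite /V addnS -addSn.
  by rewrite big_ltn ?ltn_addr//; right.
pose G0 n := \bigcap_k G (n + k)%N.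
have Gmono n k : G (n + k)%N `<=` G n.
  by elim: k => [|k IH]; rewrite ?addn0// addnS; exact: subset_trans IH.
(* The tails decrease, so omitting the first [n] of them leaves the intersection unchanged; the
   excess can then be bounded with [n] arbitrarily large. *)
have G0E n : G0 n = G0 0%N.
  apply/seteqP; split => x h k _; last exact: (h (n + k)%N).
  by have := h k Logic.I; rewrite addnC; exact: Gmono.
exists (G0 0%N); split.
- by apply: bigcapT_measurable => k; exact: mG.
- by move=> x Lx k _; exists 0%N => //; have [_ LV _] := CV k 0%N; exact: LV.
- by move=> x /(_ 0%N Logic.I) [N _]; have [_ _ VM] := CV 0%N N; exact: VM.
- move=> F mF LF FM; apply: (@le_trans _ _ i0); last exact: i0le.
  apply/lee_addgt0Pr => e e0.
  have [n hn] := bound_exp2 (2 / e).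
  rewrite -(G0E n); apply: (@le_trans _ _ (i0 + (2 * 2^-1 ^+ n)%:E)%E).
    apply: per_le_down => // k; first by rewrite addnS; exact: Gd.
    apply: le_trans (perG _) _; rewrite leeD2l// lee_fin ler_wpM2l//.
    by rewrite exprD ger_pMr ?exprn_gt0// exprn_ile1// invf_le1// ler1n.
  rewrite leeD2l// lee_fin exprVn ler_pdivrMr ?exprn_gt0// mulrC -ler_pdivrMr//.
  exact: ltW.
Qed.

(** Pairs that miss [K] see [E] only outside [K], so sets that agree there share the second term.
    Minimality is transferred between windows in this way. *)
Lemma per_split E U K : measurable E -> measurable U -> measurable K -> K `<=` U ->
  per E U = (per E K + J (perAB (E `\` K) (~` E `\` K) U))%E.
Proof.
move=> mE mU mK KU; rewrite -J_setU.
- congr (J _); apply/seteqP; split => z.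
    move=> [Ez nE u]; case: (pselect (K z.1 \/ K z.2)) => k; first by left.
    by right; split => //; split => // ?; apply: k; [left|right].
  by move=> [[Ez nE [/KU k|/KU k]]|[[Ez _] [nE _] u]]; split => //; [left|right].
- exact: measurable_per.
- by apply: measurable_perAB => //; apply: measurableD => //; exact: measurableC.
- by apply/seteqP; split => // z [[_ _ k] [[_ k1] [_ k2] _]]; tauto.
Qed.

Lemma per_extend E F U K : measurable E -> measurable F -> measurable U -> measurable K ->
  K `<=` U -> E `\` K = F `\` K -> (per E K <= per F K)%E -> (per E U <= per F U)%E.
Proof.
move=> mE mF mU mK KU EF le; rewrite (per_split mE mU mK KU) (per_split mF mU mK KU) EF.
suff -> : ~` E `\` K = ~` F `\` K by exact: leeD.
apply/seteqP; split => x [nE nK]; split => // Fx; apply: nE.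
  by have : (F `\` K) x by []; rewrite -EF => -[].
by have : (E `\` K) x by []; rewrite EF => -[].
Qed.

Lemma per_restrict E F U K : measurable E -> measurable F -> measurable U -> measurable K ->
  K `<=` U -> E `\` K = F `\` K -> (per E U < +oo)%E -> (per E U <= per F U)%E ->
  (per E K <= per F K)%E.
Proof.
move=> mE mF mU mK KU EF fE; rewrite (per_split mE mU mK KU) (per_split mF mU mK KU) EF.
have -> : ~` E `\` K = ~` F `\` K.
  apply/seteqP; split => x [nE nK]; split => // Fx; apply: nE.
    by have : (F `\` K) x by []; rewrite -EF => -[].
  by have : (E `\` K) x by []; rewrite EF => -[].
rewrite leeD2rE// ge0_fin_numE ?J_ge0//; apply: le_lt_trans fE.
rewrite (per_split mE mU mK KU) EF.
suff -> : ~` E `\` K = ~` F `\` K by rewrite leeDr ?J_ge0.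
apply/seteqP; split => x [nE nK]; split => // Fx; apply: nE.
  by have : (F `\` K) x by []; rewrite -EF => -[].
by have : (E `\` K) x by []; rewrite EF => -[].
Qed.

Lemma le_per E U K : measurable E -> measurable U -> measurable K -> K `<=` U ->
  (per E K <= per E U)%E.
Proof. by move=> mE mU mK KU; rewrite (per_split mE mU mK KU) leeDl ?J_ge0. Qed.

(** Adding [D] creates its interaction with the new complement and removes the one with [F]. The
    balance is stated with sums because each term may be infinite. *)
Lemma per_add_balance F D U : measurable F -> measurable D -> measurable U ->
  D `&` F = set0 -> D `<=` U ->
  (per (F `|` D) U + J (D `*` F) = per F U + J (D `*` ~` (F `|` D)))%E.
Proof.
move=> mF mD mU DF DU.
have mFD := measurableU _ _ mF mD; have mN := measurableC mFD.
have nDF x : D x -> ~ F x by move=> Dx Fx; have : (D `&` F) x by []; rewrite DF.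
pose Z := perAB F (~` (F `|` D)) U.
have mZ : measurable Z by exact: measurable_perAB.
have mX1 : measurable (D `*` ~` (F `|` D)) by exact: measurableX.
have mX2 : measurable (D `*` F) by exact: measurableX.
have mX3 : measurable (F `*` D) by exact: measurableX.
have -> : per (F `|` D) U = (J Z + J (D `*` ~` (F `|` D)))%E.
  rewrite -J_setU//; last by apply/seteqP; split => // z [[? _ _] [/= /nDF]].
  congr (J _); apply/seteqP; split => z.
    by move=> [[Fz|Dz] h u]; [left|right].
  move=> [[Fz h u]|[Dz h]]; split => //; [by left|by right|by left; exact: DU].
have -> : per F U = (J Z + J (F `*` D))%E.
  rewrite -J_setU//; last by apply/seteqP; split => // z [[_ h _] [_ Dz]]; apply: h; right.
  congr (J _); apply/seteqP; split => z.
    move=> [Fz h u]; case: (pselect (D z.2)) => d; first by right.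
    by left; split => // -[].
  move=> [[Fz /not_orP[h _] u]|[Fz Dz]]; split => //; first exact: nDF.
  by right; exact: DU.
have -> : J (F `*` D) = J (D `*` F).
  by rewrite -(J_swap s mX3); congr (J _); apply/seteqP; split => z [].
by rewrite addeAC.
Qed.

Lemma per_add F D U (c : R) : measurable F -> measurable D -> measurable U ->
  D `&` F = set0 -> D `<=` U -> 0 <= c ->
  (J (D `*` ~` (F `|` D)) + c%:E * mu D <= J (D `*` F))%E ->
  (per (F `|` D) U + c%:E * mu D <= per F U)%E.
Proof.
move=> mF mD mU DF DU c0 h.
have [fF|] := boolP (per F U < +oo)%E; last by rewrite -leNgt leye_eq => /eqP ->; rewrite leey.
have mX2 : measurable (D `*` F) by exact: measurableX.
have fDF : J (D `*` F) \is a fin_num.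
  rewrite ge0_fin_numE ?J_ge0//; apply: le_lt_trans fF.
  rewrite -(J_swap s mX2); apply: le_J; [exact: measurable_swapset|exact: measurable_per|].
  move=> z [/= Dz Fz]; split => //; last by right; exact: DU.
  by move=> F2; have : (D `&` F) z.2 by []; rewrite DF.
rewrite -(leeD2rE _ _ fDF) addeAC per_add_balance// -addeA.
exact: leeD.
Qed.

Lemma per_ae E N U : measurable E -> measurable N -> measurable U -> mu N = 0%E ->
  per (E `|` N) U = per E U.
Proof.
move=> mE mN mU N0.
have mEN := measurableU _ _ mE mN.
have m1 := measurable_per mE mU; have m2 := measurable_per mEN mU.
have mN1 := measurable_fst_set mN; have mN2 := measurable_snd_set mN.
apply/eqP; rewrite eq_le; apply/andP; split.
  apply: (@le_trans _ _ (J (perAB E (~` E) U `|` [set z | N z.1]))).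
    apply: le_J => //; first exact: measurableU.
    move=> z [[Ez|Nz] /not_orP[h _] u]; [by left|by right].
  apply: le_trans (measureU2 _ _ _) _ => //.
  by rewrite [X in (_ + X)%E]J_null1// adde0.
apply: (@le_trans _ _ (J (perAB (E `|` N) (~` (E `|` N)) U `|` [set z | N z.2]))).
  apply: le_J => //; first exact: measurableU.
  move=> z [Ez h u]; case: (pselect (N z.2)) => n; first by right.
  by left; split => //; [left|case].
apply: le_trans (measureU2 _ _ _) _ => //.
by rewrite [X in (_ + X)%E]J_null2// adde0.
Qed.

End Minimizers.

(** * Half-spaces: zero fractional mean curvature and finite local interaction *)

Section HalfSpace.
Context {R : realType}.
Variables (n : nat) (s : R).
Hypotheses (s0 : 0 < s) (s1 : s < 1).
Local Notation m := n.+1.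
Local Notation T := (rowT R m).
Local Notation mu := (rmu R m).
Local Notation J := (@J R m s).
Local Notation per := (@per R m s).
Local Notation k := (@knl R m s).
Implicit Types (A B D E F U K L M : set T) (Z : set (T * T)).

Lemma measurable_xl : measurable_fun setT (fun X : T => xl X).
Proof. exact: measurable_coord. Qed.

Lemma mass_reflect (X : 'rV[R]_m) A : measurable A ->
  (\int[mu]_(y in A) (k X y)%:E = \int[mu]_(y in [set y : T | A (2 *: X - y)%R]) (k X y)%:E)%E.
Proof.
move=> mA; rewrite [LHS]integral_mkcond [RHS]integral_mkcond.
rewrite -(integral_reflect (2 *: X)).
- apply: eq_integral => y _; rewrite !patchE.
  have -> : k X (2 *: X - y) = k X y.
    by rewrite /knl enormBC scaler_nat mulr2n addrAC addrK -enormN opprB.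
  by congr (if _ then _ else _); apply/idP/idP => /set_mem/= h; exact/mem_set.
- by apply/(measurable_restrictT _ mA); apply: measurable_funTS; exact: measurable_kkx.
- by move=> y; rewrite patchE; case: ifPn => // _; rewrite lee_fin knl_ge0.
Qed.

Lemma measurable_below A (phi : T -> R) x t : measurable A -> measurable_fun setT phi ->
  measurable (below A phi x t).
Proof.
move=> mA mphi; rewrite (_ : below A phi x t = ~` A `&` [set y | phi y < phi x] `&`
    [set y : T | t < enorm (x - y : 'rV[R]_m)]).
  apply: measurableI; first apply: measurableI; first exact: measurableC.
    exact: measurable_ltr_set.
  apply: measurable_ltr_set => //; apply: measurable_enorm.
  by apply: measurable_rowB => //; exact: measurable_cst.
by apply/seteqP; split => y /= => [[]|[[]]].
Qed.

Lemma measurable_above A (phi : T -> R) x t : measurable A -> measurable_fun setT phi ->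
  measurable (above A phi x t).
Proof.
move=> mA mphi; apply: measurableI.
  by apply: measurableU => //; exact: measurable_ltr_set.
apply: measurable_ltr_set => //; apply: measurable_enorm.
by apply: measurable_rowB => //; exact: measurable_cst.
Qed.

(** For affine [phi] and empty [A] the reflection at [x] exchanges [below] and [above], so their
    kernel masses agree and the calibration applies with [c = 0]. *)
Lemma affine_calibration D F (sg b : R) : measurable D -> measurable F -> (mu D < +oo)%E ->
  D `&` F = set0 -> (forall x, D x -> 0 < sg * xl x + b) ->
  (forall y, ~ F y -> ~ D y -> sg * xl y + b <= 0) ->
  (J (D `*` ~` (F `|` D)) <= J (D `*` F))%E.
Proof.
move=> mD mF fD DF h1 h2; pose phi (x : T) := sg * xl x + b.
have mphi : measurable_fun setT phi.
  by apply: measurable_funD => //; apply: measurable_funM => //; exact: measurable_xl.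
have := @calibration R n s s0 D F set0 phi 0 1 mD mF measurable0 mphi fD DF _ h1 h2 (lexx 0) ltr01.
rewrite mul0e adde0; apply => // x t Dx _; rewrite adde0.
rewrite mass_reflect; last exact: measurable_below.
rewrite le_eqVlt; apply/orP; left; apply/eqP; congr (integral _ _ _); apply/seteqP.
have xlr (y : T) : xl (2 *: x - y : 'rV[R]_m) = 2 * xl x - xl y by rewrite /xl !mxE.
have er (y : T) : enorm (x - (2 *: x - y) : 'rV[R]_m) = enorm (x - y : 'rV[R]_m).
  by rewrite scaler_nat mulr2n opprB addrA addrAC opprD addrA subrr add0r addrC enormBC.
split => y; rewrite /below /above /phi /= xlr er.
  by move=> [_ h t1]; split => //; right; lra.
by move=> [[//|h] t1]; split => //; lra.
Qed.

Lemma bounded_scube U : ebounded U -> exists2 M, 0 < M & U `<=` scube 0 M.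
Proof.
move=> [M hM]; exists (`|M| + 1); first by rewrite ltr_wpDl.
move=> x /hM h; apply: enorm_ball_scube; rewrite subr0 (le_trans h)//.
by rewrite (le_trans (ler_norm _))// lerDl.
Qed.

Lemma bounded_mu U : measurable U -> ebounded U -> (mu U < +oo)%E.
Proof.
move=> mU /bounded_scube[M M0 UM]; apply: (@le_lt_trans _ _ (mu (scube 0 M))).
  by apply: le_measure; rewrite ?inE//; exact: measurable_scube.
have -> : mu (scube 0 M) = ((2 * M) ^+ m)%:E by apply: vol_scube; exact: ltW.
exact: ltry.
Qed.

Lemma measurable_hyperplane (a : R) : measurable [set X : T | xl X = a].
Proof.
by apply: (measurable_preimage (A := [set a])) => //; exact: measurable_xl.
Qed.

Lemma hyperplane_null (a : R) : mu [set X | xl X = a] = 0%E.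
Proof.
rewrite rmuS_set1; last exact: measurable_hyperplane.
 apply: integral0_eq => y _.
rewrite (_ : [set t | _] = [set a]) ?lebesgue_measure_set1//.
by apply/seteqP; split => t /=; rewrite xl_ext.
Qed.

(** The layer at height of order [2^-j] has volume of order [2^-j], and each of its points sees the
    opposite half-space with mass of order [2^(j s)]. The resulting series of [2^(- j (1 - s))]
    converges because [s < 1]. *)
Lemma half_finite U (sg : R) : `|sg| = 1 -> measurable U -> ebounded U ->
  (J ((U `&` [set x : T | (0 < sg * xl x)%R]) `*` [set y : T | (sg * xl y <= 0)%R]) < +oo)%E.
Proof.
move=> sg1 mU /bounded_scube[M M0 UM]; have [C C0 hC] := mass_far n s0.
pose a j : R := M / 2 * 2^-1 ^+ j.
have a0 j : 0 < a j by rewrite mulr_gt0 ?divr_gt0 ?exprn_gt0 ?invr_gt0.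
pose A j : set T := scube 0 M `&` [set x | a j < sg * xl x] `&` [set x | sg * xl x <= 2 * a j].
have mxl : measurable_fun setT (fun X : T => sg * xl X) by apply: measurable_funM => //; exact: measurable_xl.
have mA j : measurable (A j).
  by apply: measurableI; [apply: measurableI; [exact: measurable_scube|exact: measurable_ltr_set]|exact: measurable_ler_set].
have mN : measurable [set y : T | sg * xl y <= 0] by exact: measurable_ler_set.
pose Z j := A j `*` [set y : T | sg * xl y <= 0].
have mZ j : measurable (Z j) by exact: measurableX.
have xls (x : T) : `|sg * xl x| <= enorm (x : 'rV[R]_m).
  by rewrite normrM sg1 mul1r; exact: coord_enorm.
apply: (@le_lt_trans _ _ (\sum_(j <oo) J (Z j))%E).
  apply: measure_sigma_subadditive => //.
    by apply: measurableX => //; apply: measurableI => //; exact: measurable_ltr_set.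
  move=> z [[Uz z1] z2].
  have : sg * xl z.1 <= M.
    apply: le_trans (ler_norm _) _; rewrite normrM sg1 mul1r.
    by have := UM _ Uz ord_max; rewrite mxE subr0.
  by move=> /(dyadic_near z1)[j /andP[j1 j2]]; exists j => //; do 2 split => //; split => //; exact: UM.
have z0 : (0 : R) <= 2^-1 `^ (1 - s) < 1.
  rewrite powR_ge0/= (_ : (_ < 1) = (2^-1 `^ (1 - s) < 1 `^ (1 - s) :> R)); last by rewrite powR1.
  by apply: gt0_ltr_powR; rewrite ?subr_gt0 ?nnegrE ?invr_ge0// invf_lt1// ltr1n.
pose c := C * ((2 * M) ^+ n * 4) * (M / 2) `^ (1 - s).
have c0 : 0 <= c by rewrite !mulr_ge0 ?exprn_ge0 ?powR_ge0 ?mulr_ge0 ?(ltW C0) ?(ltW M0).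
apply: (@le_lt_trans _ _ (\sum_(j <oo) (c * (2^-1 `^ (1 - s)) ^+ j)%:E)%E); last first.
  by apply: le_lt_trans (nneseries_geo_le c0 z0) _; exact: ltry.
apply: lee_nneseries => j _; first by move=> _; exact: J_ge0.
rewrite JE1//.
apply: (@le_trans _ _ (\int[mu]_x ((C * a j `^ (- s))%:E * (\1_(A j) x)%:E))%E).
  apply: le_integral_nomeas => x; first by apply: integral_ge0 => y _; rewrite lee_fin knl_ge0.
  rewrite indicE; case: (boolP (x \in A j)) => [/set_mem[[_ /= Ax] _]|/negP nD].
    rewrite mule1; apply: (hC x (a j)) => //; first exact: measurable_sect.
    move=> y [_ /= y0]; apply: lt_le_trans (xls (x - y : 'rV[R]_m)).
    apply: lt_le_trans (ler_norm _); rewrite /xl !mxE mulrBr -/(xl x) -/(xl y); lra.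
  rewrite (_ : [set y | _] = set0) ?integral_set0 ?mule0//.
  by apply/seteqP; split => y // [/= Ax _]; apply: nD; exact/mem_set.
rewrite ge0_integralZl_EFin//; last 2 first.
- exact/measurable_EFinP.
- by rewrite mulr_ge0 ?powR_ge0// ltW.
rewrite -measureE_int//.
pose v : 'rV[R]_m := delta_mx ord0 ord_max.
have vE : v ord0 ord_max = 1 by rewrite mxE !eqxx.
have dv (x : 'rV[R]_m) : dot v x = xl x.
  rewrite /dot (bigD1 ord_max)//= vE mul1r big1 ?addr0// => i ii.
  by rewrite mxE (negbTE ii) andbF mul0r.
have muA : (mu (A j) <= ((2 * M) ^+ n * (2 * (2 * a j)))%:E)%E.
  apply: (@le_trans _ _ (mu (slab v 0 (2 * a j) M))).
    apply: le_measure; rewrite ?inE//; first exact: measurable_slab.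
    move=> x [[xM /= x1] /= x2]; split => //=; rewrite dv addr0.
    have -> : `|xl x| = `|sg * xl x| by rewrite normrM sg1 mul1r.
    by rewrite ger0_norm// ltW// (lt_trans (a0 j)).
  have vn : v ord0 ord_max != 0 by rewrite vE oner_eq0.
  have a2 : 0 <= 2 * a j by rewrite mulr_ge0// ltW.
  by have := vol_slab 0 (ltW M0) a2 vn; rewrite vE normr1 divr1.
apply: (@le_trans _ _ ((C * a j `^ (- s))%:E * ((2 * M) ^+ n * (2 * (2 * a j)))%:E)%E).
  by apply: lee_wpmul2l => //; rewrite lee_fin mulr_ge0 ?powR_ge0// ltW.
rewrite -EFinM lee_fin /c -[in leRHS]mulrA.
have -> : (M / 2) `^ (1 - s) * (2^-1 `^ (1 - s)) ^+ j = a j `^ (1 - s).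
  have h2 : 0 <= 2^-1 :> R by rewrite invr_ge0.
  have hM : 0 <= M / 2 by rewrite mulr_ge0 ?(ltW M0).
  rewrite /a (powRM (1 - s) hM (exprn_ge0 j h2)).
  rewrite -(powR_mulrn j (powR_ge0 _ _)) -(powR_mulrn j h2).
  by rewrite powRAC.
rewrite powRD; last by apply/implyP => _; rewrite gt_eqF.
by rewrite powRr1 ?(ltW (a0 j))//; apply: eq_ler; ring.
Qed.

End HalfSpace.

(** * The obstacle problem in the cylinder *)

Section Obstacle.
Context {R : realType}.
Variables (n : nat) (s : R).
Hypotheses (s0 : 0 < s) (s1 : s < 1).
Local Notation m := n.+1.
Local Notation T := (rowT R m).
Local Notation mu := (rmu R m).
Local Notation J := (@J R m s).
Local Notation per := (@per R m s).
Implicit Types (D E F U N : set T).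

Lemma continuous_measurable_row p (f : 'rV[R]_p -> R) : continuous f ->
  measurable_fun setT (f : rowT R p -> R).
Proof.
move=> cf; apply: (@measurability _ _ (rowT R p) (measurableTypeR R) setT _ _ (RGenOpens.measurableE R)).
move=> _ [_ [a [b ->] <-]]; rewrite setTI; apply: sub_gen_smallest => /=.
apply: open_comp => [x _|]; last exact: interval_open.
exact: cf.
Qed.

Lemma measurable_xh : measurable_fun setT (fun X : T => xh X : rowT R n).
Proof. exact: (measurableT_comp measurable_fst (@measurable_xhl R n)). Qed.

Lemma enorm_xhl (X : 'rV[R]_m) : enorm X ^+ 2 = enorm (xh X) ^+ 2 + xl X ^+ 2.
Proof. by rewrite !enorm_sq dotS expr2. Qed.

Lemma enorm_xh_le (X : 'rV[R]_m) : enorm (xh X) <= enorm X.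
Proof.
rewrite -(@ler_pXn2r _ 2) ?nnegrE ?enorm_ge0// [leRHS]enorm_xhl lerDl.
exact: sqr_ge0.
Qed.

Lemma enorm_le_xhl (X : 'rV[R]_m) : enorm X <= enorm (xh X) + `|xl X|.
Proof.
rewrite -(@ler_pXn2r _ 2) ?nnegrE ?addr_ge0 ?enorm_ge0// [leLHS]enorm_xhl sqrrD.
have := mulr_ge0 (enorm_ge0 (xh X)) (normr_ge0 (xl X)).
by rewrite real_normK ?num_real//; lra.
Qed.

Lemma xhB (X Y : 'rV[R]_m) : xh (X - Y) = xh X - xh Y.
Proof. by apply/rowP => i; rewrite !mxE. Qed.

Variables (omega : set 'rV[R]_n) (psi : 'rV[R]_n -> R) (eps d : R).
Hypotheses (oom : open omega) (bom : ebounded omega) (cpsi : continuous psi).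
Hypotheses (psi_bd : forall x, 0 <= psi x <= eps) (eps0 : 0 < eps) (d0 : 0 < d).
Hypothesis sep : forall x y, psi x != 0 -> omega y -> d <= enorm (x - y).

Let Om : set T := cyl omega.
Let H : set T := [set X | xl X < 0].
Let E0 : set T := [set X | xl X < psi (xh X)].
(** The two obstacles differ only in the bounded window [K], so the minimization takes place at
    finite perimeter although the cylinder is unbounded. *)
Definition lower_set : set T := H `|` (E0 `\` Om).
Definition upper_set : set T := (E0 `\` Om) `|` ([set X | xl X <= eps] `&` Om).
Let K := upper_set `\` lower_set.

Lemma measurable_cyl : measurable Om.
Proof.
apply: (measurable_preimage (h := fun X : T => xh X : rowT R n)); first exact: measurable_xh.
exact: open_borel.
Qed.

Lemma measurable_half : measurable H.
Proof. by apply: measurable_ltr_set => //; exact: measurable_xl. Qed.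

Lemma measurable_sub : measurable E0.
Proof.
apply: measurable_ltr_set; first exact: measurable_xl.
exact: (measurableT_comp (continuous_measurable_row cpsi) measurable_xh).
Qed.

Lemma measurable_lower : measurable lower_set.
Proof.
apply: measurableU; first exact: measurable_half.
apply: measurableD; [exact: measurable_sub|exact: measurable_cyl].
Qed.

Lemma measurable_upper : measurable upper_set.
Proof.
apply: measurableU.
  apply: measurableD; [exact: measurable_sub|exact: measurable_cyl].
apply: measurableI; last exact: measurable_cyl.
by apply: measurable_ler_set => //; exact: measurable_xl.
Qed.

Lemma lower_upper : lower_set `<=` upper_set.
Proof.
move=> X [HX|]; last by left.
case: (pselect (Om X)) => oX; first by right; split => //=; rewrite ltW// (lt_trans HX).
by left; split => //; apply: lt_le_trans HX _; case/andP: (psi_bd (xh X)).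
Qed.

Lemma windowE : K = Om `&` [set X | 0 <= xl X <= eps].
Proof.
apply/seteqP; split => X.
  move=> [uX lX]; have nH : 0 <= xl X by rewrite leNgt; apply/negP => h; apply: lX; left.
  case: uX => [h|[h oX]]; first by exfalso; apply: lX; right.
  by split => //=; rewrite nH.
move=> [oX /andP[h1 h2]]; split; first by right.
by case => [|[]//]; rewrite /H /= ltNge h1.
Qed.

Lemma measurable_window : measurable K.
Proof. exact: measurableD measurable_upper measurable_lower. Qed.

Lemma bounded_window : ebounded K.
Proof.
have [M hM] := bom; exists (M + eps) => X; rewrite windowE => -[oX /andP[h1 h2]].
apply: le_trans (enorm_le_xhl X) _; rewrite lerD ?hM//.
by rewrite ger0_norm.
Qed.

Definition admissible E := [/\ measurable E, lower_set `<=` E & E `<=` upper_set].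
Definition minimizer E := admissible E /\
  forall F, admissible F -> (per E K <= per F K)%E.

Lemma admissible_lower : admissible lower_set.
Proof. by split => //; [exact: measurable_lower|exact: lower_upper]. Qed.

Lemma admissible_off E F : admissible E -> admissible F -> E `\` K = F `\` K.
Proof.
move=> [_ LE EU] [_ LF FU]; apply/seteqP; split => X [h nK]; split => //.
  by apply: LF; apply: contrapT => nL; apply: nK; split => //; exact: EU.
by apply: LE; apply: contrapT => nL; apply: nK; split => //; exact: FU.
Qed.

(** Crossing pairs go from the lower part of [U] to the upper half-space, from the lower half-space
    to [U], or from the bump to [U]. The first two kinds are half-space interactions and the third
    keeps the distance [d]; pairs that end at height [0] are negligible. *)
Lemma per_lower_finite U : measurable U -> ebounded U -> U `<=` Om ->
  (per lower_set U < +oo)%E.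
Proof.
move=> mU bU UO.
have mxl := @measurable_xl R n.
have mP : measurable (E0 `\` Om `\` H).
  apply: measurableD; last exact: measurable_half.
  by apply: measurableD; [exact: measurable_sub|exact: measurable_cyl].
have mh (sg : R) : measurable ((U `&` [set x : T | (0 < sg * xl x)%R]) `*` [set y : T | (sg * xl y <= 0)%R]).
  apply: measurableX.
    by apply: measurableI => //; apply: measurable_ltr_set => //; exact: measurable_funM.
  by apply: measurable_ler_set => //; exact: measurable_funM.
pose Z1 := (U `&` [set x : T | 0 < -1 * xl x]) `*` [set y : T | -1 * xl y <= 0].
pose Z2 := (U `&` [set x : T | 0 < 1 * xl x]) `*` [set y : T | 1 * xl y <= 0].
pose Z3 := U `*` (E0 `\` Om `\` H).
have mZ3 : measurable Z3 by exact: measurableX.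
pose Z2' := [set z | Z2 (z.2, z.1)]; pose Z3' := [set z | Z3 (z.2, z.1)].
have mZ2' : measurable Z2' by apply: measurable_swapset; exact: mh.
have mZ3' : measurable Z3' by exact: measurable_swapset.
pose N := [set z : T * T | [set X : T | xl X = 0] z.2].
have mN0 := @measurable_hyperplane R n 0.
have mN : measurable N by exact: measurable_snd_set.
have f1 : (J Z1 < +oo)%E by apply: half_finite => //; rewrite normrN normr1.
have f2 : (J Z2' < +oo)%E.
  by rewrite J_swap; [apply: half_finite => //; rewrite normr1|exact: mh].
have f3 : (J Z3' < +oo)%E.
  (* Half of [d], since [far] asks for a strict inequality. *)
  rewrite J_swap//; apply: (@J_prod_finite R n s s0 U Z3 (d / 2)) => //.
  - by rewrite divr_gt0.
  - exact: bounded_mu.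
  move=> [x y] [/= Ux [[E0y nO] nH]]; split => //; rewrite /far/=.
  have py : psi (xh y) != 0.
    move: E0y nH; rewrite /E0 /H /=; case: eqP => // -> h []; exact: h.
  have := sep py (UO _ Ux); rewrite enormBC -xhB => h.
  apply: (lt_le_trans _ (le_trans h (enorm_xh_le _))).
  by rewrite ltr_pdivrMr// ltr_pMr// ltr1n.
apply: (@le_lt_trans _ _ (J (Z1 `|` Z2' `|` Z3' `|` N))).
  apply: le_J.
  - exact: (measurable_per measurable_lower mU).
  - by do 3?[apply: measurableU => //]; exact: mh.
  move=> [x y] [/= Lx nLy u].
  have y0 : 0 <= xl y by rewrite leNgt; apply/negP => h; apply: nLy; left.
  case: u => u.
    case: Lx => [hx|[_ nO]]; last by exfalso; apply: nO; exact: UO.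
    by left; left; left; split; [split => //=|]; rewrite /= mulN1r ?oppr_gt0// oppr_le0.
  case: (ltrP 0 (xl y)) => y1; last by right; apply/eqP; rewrite eq_le y1 y0.
  case: (ltrP (xl x) 0) => x1.
    by left; left; right; split; [split => //=|]; rewrite /= mul1r// ltW.
  left; right; split => //=; case: Lx => [|h]; first by rewrite /H /= ltNge x1.
  by split => //; rewrite /H /= ltNge x1.
apply: le_lt_trans (measureU2 _ _ _) _ => //; first by do 2?[apply: measurableU => //]; exact: mh.
have JN : J N = 0%E by apply: J_null2 => //; exact: hyperplane_null.
rewrite [X in (_ + X)%E]JN adde0; apply: le_lt_trans (measureU2 _ _ _) _ => //; first by apply: measurableU => //; exact: mh.
rewrite lte_add_pinfty//; apply: le_lt_trans (measureU2 _ _ _) _ => //; first exact: mh.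
by rewrite lte_add_pinfty.
Qed.

Lemma window_cyl : K `<=` Om. Proof. by rewrite windowE => X []. Qed.

Lemma exists_obstacle_minimizer : exists E, minimizer E.
Proof.
have fL := per_lower_finite measurable_window bounded_window window_cyl.
have [E [mE LE EU hE]] := exists_minimizer measurable_lower measurable_upper lower_upper fL.
by exists E; split => // F [mF LF FU]; exact: hE.
Qed.

Lemma minimizer_finite E U : minimizer E -> measurable U -> ebounded U -> U `<=` Om ->
  K `<=` U -> (per E U < +oo)%E.
Proof.
move=> [adE hE] mU bU UO KU; apply: le_lt_trans (per_lower_finite mU bU UO).
apply: (per_extend (K := K)) => //.
- by case: adE.
- exact: measurable_lower.
- exact: measurable_window.
- exact: admissible_off admissible_lower.
- exact: hE admissible_lower.
Qed.

Lemma minimizer_exterior E : minimizer E -> E `\` Om = E0 `\` Om.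
Proof.
move=> [[_ LE EU] _]; apply/seteqP; split => X [h nO]; split => //.
  by case: (EU _ h) => [[]//|[]//].
by apply: LE; right.
Qed.

Lemma minimizer_s_minimal E : minimizer E -> s_minimal_in s E Om.
Proof.
move=> minE O' oO bO OO; have [adE hE] := minE; have [mE LE EU] := adE.
have mO : measurable (O' : set T) := open_borel oO.
(* Neither [O'] nor the window [K] need contain the other. Perimeters are compared over their
   bounded union, and the outcome is restricted to [O']. *)
pose U : set T := O' `|` K.
have mU : measurable U by apply: measurableU => //; exact: measurable_window.
have bU : ebounded U.
  have [M1 h1] := bO; have [M2 h2] := bounded_window; exists (Num.max M1 M2) => X [/h1|/h2] h.
    by rewrite le_max h.
  by rewrite le_max h orbT.
have UO : U `<=` Om by move=> X [/OO|/window_cyl].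
have KU : K `<=` U by right.
have OU : (O' : set T) `<=` U by left.
have fU := minimizer_finite minE mU bU UO KU.
apply: s_minimal_borel => //; first by apply: le_lt_trans fU; exact: le_per.
move=> F mF FE.
have FE1 X : ~ O' X -> F X -> E X by move=> nO FX; have : (F `\` O') X by []; rewrite FE => -[].
have FE2 X : ~ O' X -> E X -> F X by move=> nO FX; have : (E `\` O') X by []; rewrite -FE => -[].
apply: (per_restrict (U := U)) => //.
have HE X : H X -> E X by move=> HX; apply: LE; left.
have Eeps X : E X -> xl X <= eps.
  move=> /EU[[h _]|[]//]; apply: ltW; apply: lt_le_trans h _; by case/andP: (psi_bd (xh X)).
(* Adding [H] and cutting at height [eps] modify [F] only inside [O']: elsewhere [F] agrees with
   [E], which satisfies both constraints. *)
pose D1 := H `\` F.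
have mD1 : measurable D1 by apply: measurableD => //; exact: measurable_half.
have D1O : D1 `<=` O'.
  by move=> X [HX nF]; apply: contrapT => nO; apply: nF; apply: FE2 => //; exact: HE.
have bD (D : set T) : D `<=` O' -> measurable D -> (mu D < +oo)%E.
  move=> DO mD; apply: bounded_mu => //; have [M1 h1] := bO; exists M1 => X /DO; exact: h1.
have le0 : (0 : R) <= 0 by [].
have step (F' D : set T) : measurable F' -> measurable D -> D `&` F' = set0 -> D `<=` O' ->
   (J (D `*` ~` (F' `|` D)) <= J (D `*` F'))%E -> (per (F' `|` D) U <= per F' U)%E.
  move=> mF' mD DF' DO h; have := @per_add R m s F' D U 0 mF' mD mU DF' (subset_trans DO OU) le0.
  by rewrite mul0e !adde0; apply.
have mF1 := measurableU _ _ mF mD1.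
have p1 : (per (F `|` D1) U <= per F U)%E.
  apply: step => //; first by apply/seteqP; split => // X [[]].
  apply: (affine_calibration (sg := -1) (b := 0) s0) => //.
  - exact: bD.
  - by apply/seteqP; split => // X [[]].
  - by move=> X [HX _]; rewrite addr0 mulN1r oppr_gt0.
  - move=> X nF nD; rewrite addr0 mulN1r oppr_le0 leNgt; apply/negP => h; exact: nD.
set F1 := F `|` D1 in mF1 p1.
pose D2 := F1 `&` [set X | eps < xl X].
have mD2 : measurable D2.
  by apply: measurableI => //; apply: measurable_ltr_set => //; exact: measurable_xl.
have D2O : D2 `<=` O'.
  move=> X [[FX|[HX _]] /= h]; last by move: HX; rewrite /H /= ltNge ltW// (lt_trans eps0).
  apply: contrapT => nO; move: h; rewrite ltNge Eeps//; exact: FE1.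
have mF1c := measurableC mF1.
(* Removing [D2] from [F1] means adding it to the complement, which has the same perimeter. *)
have p2 : (per (~` F1 `|` D2) U <= per (~` F1) U)%E.
  apply: step => //; first by apply/seteqP; split => // X [[]].
  apply: (affine_calibration (sg := 1) (b := - eps) s0) => //.
  - exact: bD.
  - by apply/seteqP; split => // X [[]].
  - by move=> X [_ /= h]; rewrite mul1r subr_gt0.
  - move=> X /contrapT F1X nD; rewrite mul1r subr_le0 leNgt; apply/negP => h; exact: nD.
pose F2 := F1 `\` D2.
have mF2 : measurable F2 by exact: measurableD.
have F2E : ~` F1 `|` D2 = ~` F2.
  apply/seteqP; split => X; first by move=> [nF [FX _]|DX [_ nD]].
  move=> h; case: (pselect (F1 X)) => f; last by left.
  by right; apply: contrapT => nD; apply: h; split.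
rewrite F2E !perC// in p2.
have F2eps X : F2 X -> xl X <= eps.
  by move=> [FX nD]; rewrite leNgt; apply/negP => h; apply: nD; split.
have adF2 : admissible F2.
  split => // X.
    move=> LX; have EX := LE _ LX; split; last first.
      by move=> [_ /=]; rewrite ltNge Eeps.
    case: (pselect (F X)) => [|nF]; first by left.
    case: LX => [HX|[_ nO]]; first by right.
    by left; apply: FE2 => //; apply: contra_not nO; exact: OO.
  move=> F2X; have xe := F2eps _ F2X.
  case: (pselect (Om X)) => oX; first by right.
  have nO : ~ O' X by move=> /OO.
  case: F2X => [[FX|[HX _]] _]; first by apply: EU; exact: FE1.
  by apply: lower_upper; left.
apply: (@le_trans _ _ (per F2 U)); last exact: le_trans p2 p1.
apply: (per_extend (K := K)) => //; first exact: measurable_window.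
  exact: admissible_off adF2.
exact: hE.
Qed.

Lemma minimizer_ae E N : minimizer E -> measurable N -> mu N = 0%E -> N `<=` upper_set ->
  minimizer (E `|` N).
Proof.
move=> [[mE LE EU] hE] mN N0 NU; split.
  split; first exact: measurableU.
    by move=> X /LE; left.
  by move=> X [/EU|/NU].
by move=> F aF; rewrite per_ae//; [exact: hE|exact: measurable_window].
Qed.

(** Finiteness of the perimeter in the window turns [per E K + c * mu D <= per E K] into
    [mu D = 0]. *)
Lemma minimizer_calibrated E D (c : R) : minimizer E -> measurable D -> D `<=` K -> D `&` E = set0 ->
  0 < c -> (J (D `*` ~` (E `|` D)) + c%:E * mu D <= J (D `*` E))%E -> mu D = 0%E.
Proof.
move=> minE mD DK DE c0 h; have [adE hE] := minE; have [mE LE EU] := adE.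
have mK := measurable_window.
have adD : admissible (E `|` D).
  split; first exact: measurableU.
    by move=> X /LE; left.
  by move=> X [/EU|/DK[]].
have h1 := per_add mE mD mK DE DK (ltW c0) h.
have fE : per E K \is a fin_num.
  rewrite ge0_fin_numE ?J_ge0//.
  exact: (minimizer_finite minE mK bounded_window window_cyl).
have h2 := le_trans (leeD (hE _ adD) (lexx (c%:E * mu D)%E)) h1.
have : (c%:E * mu D <= 0)%E by rewrite -(leeD2lE _ _ fE) adde0.
move=> h3; apply/eqP; rewrite eq_le measure_ge0 andbT.
by rewrite -(@pmule_rle0 _ c%:E) ?lte_fin.
Qed.

End Obstacle.

(** * Reflection and balance at a point *)

Section PowerNorm.
Context {R : realType}.
Variables (m : nat) (q : R).
Hypotheses (q1 : 1 < q) (q2 : q < 2).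

(** Young's inequality for [x ^ th] and [1], with the conjugate exponents [1 / th] and
    [1 / (1 - th)]. *)
Lemma powR_bernoulli (x th : R) : 0 <= x -> 0 < th < 1 -> x `^ th <= 1 + th * (x - 1).
Proof.
move=> x0 /andP[t0 t1].
have t1' : 0 < 1 - th by rewrite subr_gt0.
have h := @conjugate_powR R (x `^ th) 1 th^-1 (1 - th)^-1 (powR_ge0 _ _) ler01.
have := h _ _ _; rewrite !invr_gt0 !invrK t0 t1' => /(_ isT isT).
rewrite addrC subrK => /(_ erefl).
rewrite mulr1 -powRrM mulfV ?gt_eqF// powRr1// powR1 mul1r => /le_trans; apply.
by apply: eq_ler; ring.
Qed.

Lemma powR_le_mono (a x y : R) : 0 <= a -> 0 <= x -> x <= y -> x `^ a <= y `^ a.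
Proof. by move=> a0 x0 xy; apply: ge0_ler_powR; rewrite ?nnegrE// (le_trans x0). Qed.

(* The concavity of [u |-> u^(q/2)] bounds [enorm (x + h) ^ q] by its expansion at [x]. *)
Lemma enorm_powR_expansion (x : 'rV[R]_m) : exists lam : R, [/\ 0 <= lam,
  lam * enorm x <= 2 * enorm x `^ (q - 1) &
  forall h, enorm (x + h) `^ q <= enorm x `^ q + lam * dot x h + 6 * enorm h `^ q].
Proof.
have qp : 0 < q by apply: lt_trans q1.
have q0 := ltW qp.
have [->|x0] := eqVneq x 0.
  exists 0; split => //; first by rewrite mul0r mulr_ge0 ?powR_ge0.
  move=> h; rewrite add0r enorm0 powR0 ?gt_eqF// mul0r add0r add0r.
  have := powR_ge0 (enorm h) q; lra.
have a0 : 0 < enorm x by rewrite -(subr0 x) enorm_gt0//; exact/eqP.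
set a := enorm x in a0 *.
have aq : a `^ q = a `^ (q - 2) * (a ^+ 2).
  rewrite -powR_mulrn ?(ltW a0)// -powRD ?subrK//.
  by apply/implyP => _; rewrite gt_eqF.
have aq1 : a `^ (q - 1) = a `^ (q - 2) * a.
  rewrite -[X in _ * X]powRr1 ?(ltW a0)// -powRD; first by congr (_ `^ _); ring.
  by apply/implyP => _; rewrite gt_eqF.
have a2p : 0 < a `^ (q - 2) by exact: powR_gt0.
(* With this value [lam x] is the gradient of [|x|^q]. For [|h| <= |x|], concavity leaves the
   remainder [q / 2 |x|^(q - 2) |h|^2 <= |h|^q]. For larger [h] the left side is at most [4 |h|^q]
   and the linear term at least [- 2 |h|^q], whence the constant [6]. *)
exists (q * a `^ (q - 2)); split.
- by rewrite mulr_ge0 ?powR_ge0.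
- by rewrite -mulrA -aq1 ler_wpM2r ?powR_ge0 ?ltW.
move=> h; set t := dot x h.
have ht : `|t| <= a * enorm h by exact: cauchy_schwarz.
have hq := powR_ge0 (enorm h) q.
have [ha|ha] := leP (enorm h) a.
  have E : enorm (x + h) ^+ 2 = a ^+ 2 + (2 * t + enorm h ^+ 2).
    by rewrite /a !enorm_sq !(dotDl, dotDr) (dotC h x) -/t; ring.
  have u0 : 0 <= enorm (x + h) ^+ 2 / a ^+ 2 by rewrite divr_ge0 ?sqr_ge0.
  have := @powR_bernoulli _ (q / 2) u0; rewrite ltr_pdivrMr// mul1r divr_gt0//= => /(_ q2).
  have -> : (enorm (x + h) ^+ 2 / a ^+ 2) `^ (q / 2) = enorm (x + h) `^ q / a `^ q.
    rewrite powRM ?sqr_ge0 ?invr_ge0 ?sqr_ge0//.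
    have pw (y : R) : 0 <= y -> (y ^+ 2) `^ (q / 2) = y `^ q.
      by move=> y0; rewrite -powR_mulrn// -powRrM; congr (_ `^ _); field.
    by rewrite pw ?enorm_ge0// -(powR_inv1 (sqr_ge0 a)) powRAC pw ?(ltW a0)// powR_inv1 ?powR_ge0.
  rewrite ler_pdivrMr ?powR_gt0// => /le_trans; apply.
  rewrite E aq.
  have -> : (1 + q / 2 * ((a ^+ 2 + (2 * t + enorm h ^+ 2)) / a ^+ 2 - 1)) * (a `^ (q - 2) * a ^+ 2) =
     a `^ (q - 2) * a ^+ 2 + q * a `^ (q - 2) * t + q / 2 * (a `^ (q - 2) * enorm h ^+ 2).
    by field; rewrite gt_eqF.
  rewrite -aq lerD2l.
  have [h0|h0] := eqVneq (enorm h) 0.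
    by rewrite h0 expr0n/= !mulr0 mulr_ge0// powR_ge0.
  have hp : 0 < enorm h by rewrite lt_def h0 enorm_ge0.
  have : a `^ (q - 2) * enorm h ^+ 2 <= enorm h `^ q.
    have -> : enorm h `^ q = enorm h `^ (q - 2) * enorm h ^+ 2.
      rewrite -(powR_mulrn 2) ?enorm_ge0// -powRD ?subrK//.
      by apply/implyP => _; rewrite gt_eqF.
    rewrite ler_wpM2r ?sqr_ge0//.
    have -> : q - 2 = - (2 - q) by ring.
    rewrite !powRN lef_pV2 ?posrE ?powR_gt0//.
    by apply: powR_le_mono => //; rewrite ?subr_ge0 ltW.
  have := powR_ge0 a (q - 2); have := sqr_ge0 (enorm h) => g1 g2.
  have : 0 <= a `^ (q - 2) * enorm h ^+ 2 by rewrite mulr_ge0.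
  set Y := a `^ (q - 2) * _; set B := enorm h `^ q => Y0 YB.
  have : q / 2 * Y <= 1 * Y by rewrite ler_wpM2r// ler_pdivrMr// mul1r ltW.
  lra.
have hp : 0 < enorm h by apply: lt_trans ha.
have b1 : enorm (x + h) `^ q <= 4 * enorm h `^ q.
  apply: (@le_trans _ _ ((2 * enorm h) `^ q)).
    apply: powR_le_mono => //; first exact: enorm_ge0.
    by apply: le_trans (enormD _ _) _; rewrite -/a; lra.
  rewrite powRM ?(ltW hp)// ler_wpM2r//.
  have -> : 4 = 2 `^ 2%:R :> R by rewrite powR_mulrn//; ring.
  by apply: ler_powR; [rewrite ler1n|exact: ltW].
have b2 : - (2 * enorm h `^ q) <= q * a `^ (q - 2) * t.
  have : `|q * a `^ (q - 2) * t| <= 2 * enorm h `^ q.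
    rewrite normrM (ger0_norm (mulr_ge0 q0 (powR_ge0 _ _))).
    apply: (@le_trans _ _ (q * a `^ (q - 2) * (a * enorm h))).
      exact: ler_wpM2l (mulr_ge0 q0 (powR_ge0 _ _)) _ _ ht.
    rewrite mulrA -[q * _ * a]mulrA -aq1 -mulrA; apply: ler_pM => //.
    - by rewrite mulr_ge0 ?powR_ge0 ?enorm_ge0.
    - exact: ltW.
    have -> : enorm h `^ q = enorm h `^ (q - 1) * enorm h.
      rewrite -[X in _ * X]powRr1 ?enorm_ge0// -powRD ?subrK//.
      by apply/implyP => _; rewrite gt_eqF.
    by rewrite ler_wpM2r ?enorm_ge0//; apply: powR_le_mono; rewrite ?subr_ge0 ltW.
  by rewrite ler_norml => /andP[].
have h3 := powR_ge0 a q; apply: le_trans b1 _; clear -b2 hq h3; lra.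
Qed.

End PowerNorm.

Section PowerFunction.
Context {R : realType}.
Implicit Types a x y : R.

Lemma powR1D a x : 0 < a -> 0 <= x -> x `^ (1 + a) = x * x `^ a.
Proof.
move=> a0 x0; rewrite powRD ?powRr1//; apply/implyP => /eqP h; exfalso.
by move: h a0; lra.
Qed.

Lemma small_powR a x : 0 < a -> 0 < x ->
  exists2 r1 : R, 0 < r1 & forall r, 0 < r -> r <= r1 -> r `^ a <= x.
Proof.
move=> a0 x0; exists (x `^ a^-1); first exact: powR_gt0.
move=> r r0 rr; have -> : x = (x `^ a^-1) `^ a.
  by rewrite -powRrM mulVf ?gt_eqF// powRr1// ltW.
by apply: powR_le_mono rr; exact: ltW.
Qed.

(** The factor [4] is [2^2], as [1 + a <= 2]. *)
Lemma powR_double a x y : 0 <= a -> a <= 1 -> 0 <= x -> 0 <= y -> x <= 2 * y ->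
  x `^ (1 + a) <= 4 * y `^ (1 + a).
Proof.
move=> a0 a1 x0 y0 xy; apply: (@le_trans _ _ ((2 * y) `^ (1 + a))).
  by apply: powR_le_mono; rewrite ?addr_ge0.
rewrite powRM// ler_wpM2r ?powR_ge0//.
have -> : 4 = 2 `^ 2%:R :> R by rewrite powR_mulrn//; ring.
apply: ler_powR; first by rewrite ler1n.
by rewrite (_ : 2%:R = 1 + 1) ?lerD2l//; ring.
Qed.

Lemma powR_le1 a x : 0 <= a -> 0 <= x -> x <= 1 -> x `^ a <= 1.
Proof.
move=> a0 x0 x1; have -> : 1 = 1 `^ a :> R by rewrite powR1.
exact: powR_le_mono.
Qed.

Lemma powR_lt_inv a x y : 0 <= a -> 0 <= y -> x `^ a < y `^ a -> x < y.
Proof.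
move=> a0 y0; rewrite !ltNge; apply: contra => h; exact: powR_le_mono.
Qed.

End PowerFunction.

Section Pointwise.
Context {R : realType}.
Variables (n : nat) (s : R).
Hypotheses (s0 : 0 < s).
Local Notation m := n.+1.
Local Notation T := (rowT R m).
Local Notation mu := (rmu R m).
Local Notation k := (@knl R m s).
Implicit Types (A V W : set T).

Definition kmass (X : T) A : \bar R := (\int[mu]_(y in A) (k X y)%:E)%E.

Section kmass_measure.
Variable X : T.
Let km0 : kmass X set0 = 0%E. Proof. exact: integral_set0. Qed.
Let km_ge0 A : (0 <= kmass X A)%E.
Proof. by apply: integral_ge0 => z _; rewrite lee_fin knl_ge0. Qed.
Let km_sa : semi_sigma_additive (kmass X).
Proof.
move=> F mF tF mUF; rewrite /kmass ge0_integral_bigcup//; last 2 first.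
- by apply: measurable_funTS; exact: measurable_kkx.
- by move=> z _; rewrite lee_fin knl_ge0.
by apply: is_cvg_nneseries => i _ _; exact: km_ge0.
Qed.
HB.instance Definition _ := isMeasure.Build _ _ _ (kmass X) km0 km_ge0 km_sa.
End kmass_measure.

Lemma le_kmass X A W : measurable A -> measurable W -> A `<=` W -> (kmass X A <= kmass X W)%E.
Proof. by move=> mA mW AW; apply: le_measure; rewrite ?inE. Qed.

Lemma measurable_refl (X : 'rV[R]_m) A : measurable A -> measurable [set y : T | A (2 *: X - y)].
Proof.
move=> mA; apply: (@measurable_preimage _ _ _ _ (fun y : T => 2 *: X - y : T)) => //.
by apply: measurable_rowB => //; exact: measurable_cst.
Qed.

Lemma reflB (X y : 'rV[R]_m) : X - (2 *: X - y) = - (X - y).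
Proof. by apply/rowP => i; rewrite !mxE; ring. Qed.

(** The pointwise hypothesis of the calibration: curvature at most [- c] at [X], for all small
    truncations. *)
Definition balanced A (phi : T -> R) (X : T) (c t0 : R) :=
  forall t, 0 < t < t0 -> (kmass X (below A phi X t) + c%:E <= kmass X (above A phi X t))%E.

(* After reflection at [X], the points of [below] which are not matched by points of
   [above] lie in [W], whereas [V] is matched by no point of [below]. *)
Lemma pointwise_balance A (phi : T -> R) (X : T) V W (c t0 B : R) :
  measurable A -> measurable V -> measurable W -> measurable_fun setT phi ->
  (forall Y, V Y -> [/\ A Y, A (2 *: (X : 'rV[R]_m) - Y) & t0 <= enorm (X - Y : 'rV[R]_m)]) ->
  (forall Y, ~ A Y -> ~ A (2 *: (X : 'rV[R]_m) - Y) -> phi Y <= phi X ->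
     phi (2 *: (X : 'rV[R]_m) - Y) <= phi X -> W Y) ->
  (kmass X W <= B%:E)%E -> ((B + c)%:E <= kmass X V)%E ->
  balanced A phi X c t0.
Proof.
move=> mA mV mW mphi hV hW hB hc t /andP[t0' tt].
have mb := measurable_below X t mA mphi; have ma := measurable_above X t mA mphi.
rewrite {1}/kmass mass_reflect//.
set M := [set y | _]; have mM : measurable M by exact: measurable_refl.
rewrite -/(kmass X M).
have fW : kmass X W \is a fin_num.
  by rewrite ge0_fin_numE ?measure_ge0//; apply: le_lt_trans hB _; exact: ltry.
have h1 : (kmass X M + kmass X V <= kmass X (above A phi X t) + kmass X W)%E.
  rewrite -measureU//; last first.
    by apply/seteqP; split => // Y [[nA _ _] /hV[_ AY _]].
  apply: le_trans (measureU2 _ ma mW).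
  apply: le_kmass; [exact: measurableU|exact: measurableU|].
  move=> Y [[nA ph ft]|VY].
    have ft' : t < enorm (X - Y : 'rV[R]_m) by move: ft; rewrite reflB enormN.
    case: (pselect (A Y)) => AY; first by left; split => //; left.
    case: (ltrP (phi X) (phi Y)) => pp; first by left; split => //; right.
    by right; apply: hW => //; exact: ltW.
  by have [AY _ h] := hV _ VY; left; split; [left|exact: lt_le_trans tt h].
rewrite -(leeD2rE _ _ fW) -addeA; apply: le_trans h1; apply: leeD => //.
apply: le_trans hc; rewrite EFinD addeC; exact: leeD.
Qed.

Lemma kmass_cube_lower (X Z : 'rV[R]_m) (r a : R) : 0 < r -> 0 < a ->
  (forall Y : 'rV[R]_m, scube Z r Y -> X <> Y /\ enorm (X - Y) <= a) ->
  (((2 * r) ^+ m * a `^ (- (m%:R + s)))%:E <= kmass X (scube Z r))%E.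
Proof.
move=> r0 a0 h; have mS := @measurable_scube R m Z r.
apply: (@le_trans _ _ (\int[mu]_(y in scube Z r) (a `^ (- (m%:R + s)))%:E)%E).
  rewrite integral_cst//.
  set L := (X in (_ * X)%E); have -> : L = ((2 * r) ^+ m)%:E by apply: vol_scube; exact: ltW.
  by rewrite -EFinM lee_fin mulrC.
apply: ge0_le_integral => //.
- by move=> y _; rewrite lee_fin powR_ge0.
- by apply: measurable_funTS; exact: measurable_kkx.
- by move=> y /h[Xy ya]; rewrite lee_fin; exact: knl_ge.
Qed.

End Pointwise.

(** * Barriers *)

Section Barriers.
Context {R : realType}.
Variables (n : nat) (s alpha : R).
Hypotheses (s0 : 0 < s) (sa : s < alpha) (a1 : alpha < 1).
Local Notation m := n.+1.
Local Notation T := (rowT R m).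
Local Notation mu := (rmu R m).
Local Notation k := (@knl R m s).
Local Notation q := (1 + alpha).
Local Notation kmass := (@kmass R n s).
Local Notation balanced := (@balanced R n s).
Implicit Types (A V W : set T).

Let alpha0 : 0 < alpha. Proof. exact: lt_trans sa. Qed.
Let q0 : 0 <= q. Proof. by rewrite addr_ge0// ltW. Qed.

(** What the reflection at [X] leaves unpaired; it is taken as [W] in [pointwise_balance], where its
    kernel mass is the loss. *)
Definition gap A (phi : T -> R) (X : 'rV[R]_m) : set T :=
  ~` A `&` [set Y | ~ A (2 *: X - Y)] `&` [set Y | phi Y <= phi X] `&`
  [set Y | phi (2 *: X - Y : 'rV[R]_m) <= phi X].

Lemma measurable_gap A phi X : measurable A -> measurable_fun setT phi -> measurable (gap A phi X).
Proof.
move=> mA mphi.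
have mrefl : measurable_fun setT (fun Y : T => 2 *: X - Y : T).
  by apply: measurable_rowB => //; exact: measurable_cst.
apply: measurableI; last by apply: measurable_ler_set => //; exact: (measurableT_comp mphi mrefl).
apply: measurableI; last exact: measurable_ler_set.
apply: measurableI; first exact: measurableC.
by apply: (measurable_refl X (A := ~` A)); exact: measurableC.
Qed.

(** Up to distance [r] the set is thin in direction [v], from [r] to [1] it is thin in direction
    [e], and beyond [1] the full tail of the kernel is accepted. The middle zone is split according
    to which of the two terms of its width dominates. *)
Lemma mass_slabs : exists2 C, 0 < C & forall (X v e : 'rV[R]_m) (r B b1 w : R) W,
  1 / 2 <= enorm v -> 1 <= enorm e -> 0 < r -> r <= 1 -> 0 <= B -> 0 <= b1 -> 0 <= w ->
  measurable W ->
  (forall Y : 'rV[R]_m, W Y -> enorm (X - Y) <= r -> `|dot v (X - Y)| <= B * enorm (X - Y) `^ q) ->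
  (forall Y : 'rV[R]_m, W Y -> r < enorm (X - Y) -> enorm (X - Y) <= 1 ->
     `|dot e (X - Y)| <= b1 * enorm (X - Y) `^ q + w) ->
  (kmass X W <= (C * (B * r `^ (alpha - s) + b1 + w * r `^ (- 1 - s) + 1))%:E)%E.
Proof.
have [C1 C10 h1] := mass_near n s0 sa.
have [C2 C20 h2] := mass_far n s0.
have [C3 C30 h3] := mass_far_slab n s0.
exists (2 * C1 + C2 + 2 * C3); first by rewrite !addr_gt0 ?mulr_gt0.
move=> X v e r B b1 w W hv he r0 r1 B0 b10 w0 mW hn hm.
have v0 : 0 < enorm v by apply: lt_le_trans hv; rewrite divr_gt0.
have e0 : 0 < enorm e by apply: lt_le_trans he.
have vn : v <> 0 by move=> h; move: v0; rewrite h enorm0 ltxx.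
have en : e <> 0 by move=> h; move: e0; rewrite h enorm0 ltxx.
have mn : measurable_fun setT (fun Y : T => enorm (X - Y : 'rV[R]_m)).
  by apply: measurable_enorm; apply: measurable_rowB => //; exact: measurable_cst.
have md : measurable_fun setT (fun Y : T => `|dot e (X - Y : 'rV[R]_m)|).
  apply: measurableT_comp => //; apply: (measurableT_comp (measurable_dot e)).
  by apply: measurable_rowB => //; exact: measurable_cst.
have mp : measurable_fun setT (fun Y : T => 2 * b1 * enorm (X - Y : 'rV[R]_m) `^ q).
  by apply: measurable_funM => //; exact: (measurableT_comp (measurable_powR _) mn).
pose W1 := W `&` cball X r.
pose W2 := W `&` cball X 1 `&` [set Y : T | `|dot e (X - Y : 'rV[R]_m)| <= 2 * b1 * enorm (X - Y : 'rV[R]_m) `^ q].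
pose W3 := W `&` [set Y : T | r < enorm (X - Y : 'rV[R]_m)] `&` [set Y : T | `|dot e (X - Y : 'rV[R]_m)| <= 2 * w].
pose W4 := W `&` [set Y : T | 1 < enorm (X - Y : 'rV[R]_m)].
have mW1 : measurable W1 by apply: measurableI => //; exact: measurable_cball.
have mW2 : measurable W2.
  apply: measurableI; first by apply: measurableI => //; exact: measurable_cball.
  exact: measurable_ler_set.
have mW3 : measurable W3.
  apply: measurableI; first by apply: measurableI => //; exact: measurable_ltr_set.
  exact: measurable_ler_set.
have mW4 : measurable W4 by apply: measurableI => //; exact: measurable_ltr_set.
have dv (x N : R) : 0 <= x -> 1 / 2 <= N -> x / N <= 2 * x.
  move=> x0 hN; have N0 : 0 < N by apply: lt_le_trans hN; rewrite divr_gt0.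
  rewrite ler_pdivrMr//; have : x * 1 <= x * (2 * N) by apply: ler_wpM2l => //; lra.
  lra.
have p1 : (kmass X W1 <= (2 * C1 * (B * r `^ (alpha - s)))%:E)%E.
  apply: le_trans (h1 X v B r W1 vn B0 r0 mW1 _ _) _.
  - by move=> Y [].
  - by move=> Y [WY hY]; exact: hn.
  rewrite lee_fin (_ : 2 * C1 * (B * _) = C1 * (2 * B) * r `^ (alpha - s)); last by ring.
  by apply: ler_wpM2r; [exact: powR_ge0|apply: ler_wpM2l; [exact: ltW|exact: dv]].
have p2 : (kmass X W2 <= (2 * C1 * b1)%:E)%E.
  apply: le_trans (h1 X e (2 * b1) 1 W2 en _ ltr01 mW2 _ _) _.
  - by rewrite mulr_ge0.
  - by move=> Y [[]].
  - by move=> Y [_ hY].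
  rewrite lee_fin powR1 mulr1 (_ : 2 * C1 * b1 = C1 * (2 * b1)); last by ring.
  apply: ler_wpM2l; first exact: ltW.
  by rewrite ler_pdivrMr// ler_peMr// mulr_ge0.
have p3 : (kmass X W3 <= (2 * C3 * (w * r `^ (- 1 - s)))%:E)%E.
  apply: le_trans (h3 X e (2 * w) r W3 en _ r0 mW3 _) _.
  - by rewrite mulr_ge0.
  - by move=> Y [[_ hr] hY].
  rewrite lee_fin (_ : 2 * C3 * (w * _) = C3 * (2 * w) * r `^ (- 1 - s)); last by ring.
  apply: ler_wpM2r; first exact: powR_ge0.
  apply: ler_wpM2l; first exact: ltW.
  by rewrite ler_pdivrMr// ler_peMr// mulr_ge0.
have p4 : (kmass X W4 <= C2%:E)%E.
  apply: le_trans (h2 X 1 W4 ltr01 mW4 _) _; first by move=> Y [].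
  by rewrite powR1 mulr1.
apply: (@le_trans _ _ (kmass X (W1 `|` W2 `|` W3 `|` W4))).
  apply: le_kmass => //; first by do 3?[apply: measurableU => //].
  move=> Y WY; case: (lerP (enorm (X - Y : 'rV[R]_m)) r) => yr; first by left; left; left.
  case: (lerP (enorm (X - Y : 'rV[R]_m)) 1) => y1; last by right.
  have hh := hm Y WY yr y1.
  case: (lerP (b1 * enorm (X - Y : 'rV[R]_m) `^ q) w) => c.
    by left; right; split => //=; apply: le_trans hh _; clear -c; lra.
  by left; left; right; split => //=; apply: le_trans hh _; clear -c; lra.
have U3 : measurable (W1 `|` W2 `|` W3) by do 2?[apply: measurableU => //].
have U2 : measurable (W1 `|` W2) by apply: measurableU.
apply: le_trans (measureU2 _ U3 mW4) _.
apply: le_trans (leeD (measureU2 _ U2 mW3) (lexx _)) _.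
apply: le_trans (leeD (leeD (measureU2 _ mW1 mW2) (lexx _)) (lexx _)) _.
apply: le_trans (leeD (leeD (leeD p1 p2) p3) p4) _.
rewrite -!EFinD lee_fin.
set x := B * _; set y := w * _.
have x0 : 0 <= x by rewrite mulr_ge0 ?powR_ge0.
have y0 : 0 <= y by rewrite mulr_ge0 ?powR_ge0.
rewrite -subr_ge0.
have -> : (2 * C1 + C2 + 2 * C3) * (x + b1 + y + 1) - (2 * C1 * x + 2 * C1 * b1 + 2 * C3 * y + C2) =
  2 * C1 * (y + 1) + C2 * (x + b1 + y) + 2 * C3 * (x + b1 + 1) by ring.
by rewrite !addr_ge0 ?mulr_ge0 ?addr_ge0 ?(ltW C10) ?(ltW C20) ?(ltW C30).
Qed.

(** [P] anchors the affine part and [Q] is the vertex of the penalty. They coincide until the last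
    step, where only [Q] is lifted. *)
Definition bar (e : 'rV[R]_m) (b : R) (P Q : 'rV[R]_m) (X : 'rV[R]_m) : R :=
  dot e (X - P) - b * enorm (X - Q) `^ q.

Lemma barE e b P Q X : bar e b P Q X = dot e (X - P) - b * enorm (X - Q) `^ q.
Proof. by []. Qed.

Lemma measurable_bar e b P Q : measurable_fun setT (fun X : T => bar e b P Q X).
Proof.
apply: measurable_funB.
  apply: (measurableT_comp (measurable_dot e)).
  by apply: measurable_rowB => //; exact: measurable_cst.
apply: measurable_funM => //; apply: (measurableT_comp (measurable_powR _)).
by apply: measurable_enorm; apply: measurable_rowB => //; exact: measurable_cst.
Qed.

Lemma slab_arith (p z x0 x1 x2 d y : R) : x1 <= x0 - d + y -> x2 <= x0 + d + y ->
  p - z - x1 <= p - x0 -> p + z - x2 <= p - x0 -> `|z - d| <= y.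
Proof. by move=> *; rewrite ler_norml; apply/andP; split; lra. Qed.

(** [e - b lam (X - Q)] is the gradient of the barrier at [X]. If neither [Y] nor its reflection
    exceeds the level of [X], the first-order term, which has opposite signs at the two points, is
    bounded by the remainder. *)
Lemma bar_slab e b P Q X : 0 <= b -> exists lam : R, [/\ 0 <= lam,
  lam * enorm (X - Q) <= 2 * enorm (X - Q) `^ alpha &
  forall Y, bar e b P Q Y <= bar e b P Q X -> bar e b P Q (2 *: X - Y) <= bar e b P Q X ->
    `|dot (e - (b * lam) *: (X - Q)) (X - Y)| <= 6 * b * enorm (X - Y) `^ q].
Proof.
move=> b0.
have q1 : 1 < q by rewrite ltrDl. have q2 : q < 2 by rewrite (_ : 2 = 1 + 1) ?ltrD2l//; ring.
have [lam [l0 l1 hl]] := enorm_powR_expansion q1 q2 (X - Q).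
have E : q - 1 = alpha by ring.
rewrite E in l1; exists lam; split; [exact: l0|exact: l1|].
move=> Y; rewrite /bar => h1 h2.
have E1 : Y - P = (X - P) + - (X - Y) by apply/rowP => i; rewrite !mxE; ring.
have E2 : Y - Q = (X - Q) + - (X - Y) by apply/rowP => i; rewrite !mxE; ring.
have E3 : 2 *: X - Y - P = (X - P) + (X - Y) by apply/rowP => i; rewrite !mxE; ring.
have E4 : 2 *: X - Y - Q = (X - Q) + (X - Y) by apply/rowP => i; rewrite !mxE; ring.
have k1 := ler_wpM2l b0 (hl (- (X - Y))); have k2 := ler_wpM2l b0 (hl (X - Y)).
rewrite E1 E2 (dotDr e (X - P)) (dotNr e) in h1; rewrite E3 E4 (dotDr e (X - P)) in h2.
rewrite (dotNr (X - Q)) enormN in k1.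
rewrite dotBl dotZl.
move: k1 k2 h1 h2.
set d := dot (X - Q) (X - Y); set z := dot e (X - Y).
set x0 := enorm (X - Q) `^ q; set y := enorm (X - Y) `^ q.
set x1 := enorm (X - Q + - (X - Y)) `^ q; set x2 := enorm (X - Q + (X - Y)) `^ q.
rewrite (_ : b * (x0 + lam * - d + 6 * y) = b * x0 - b * lam * d + 6 * b * y); last by ring.
rewrite (_ : b * (x0 + lam * d + 6 * y) = b * x0 + b * lam * d + 6 * b * y); last by ring.
by move=> k1 k2 h1 h2; exact: (slab_arith k1 k2 h1 h2).
Qed.

(** With last entry [- g] the barrier loses [g] per unit of height; [g = 0] is a vertical wall. *)
Definition slope (nu : 'rV[R]_n) (g : R) : 'rV[R]_m := ext_row nu (- g).
Definition base (p : 'rV[R]_n) (y : R) : 'rV[R]_m := ext_row p y.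

Lemma dot_slope nu g X : dot (slope nu g) X = dot nu (xh X) - g * xl X.
Proof. by rewrite dotS xh_ext xl_ext mulNr. Qed.

Lemma enorm_slope_ge nu g : enorm nu = 1 -> 1 <= enorm (slope nu g).
Proof. by move=> h; have := enorm_xh_le (slope nu g); rewrite xh_ext h. Qed.

Lemma enorm_slope_le nu g : enorm nu = 1 -> 0 <= g -> enorm (slope nu g) <= 1 + g.
Proof.
move=> h g0; have := enorm_le_xhl (slope nu g).
by rewrite xh_ext xl_ext h normrN ger0_norm.
Qed.

Definition wedge nu g b p : set T := [set X | xl X < 0] `|`
  [set X | 0 < bar (slope nu g) b (base p 0) (base p 0) X].

Lemma measurable_wedge nu g b p : measurable (wedge nu g b p).
Proof.
apply: measurableU; first exact: measurable_half.
by apply: measurable_ltr_set => //; exact: measurable_bar.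
Qed.

(* The gain near [X] comes from a cube of size [r0] behind the vertex of the wedge;
   it beats every loss since it scales like [r0 ^ (- s)]. *)
Lemma wedge_balance (g0 : R) : 0 <= g0 -> exists C cV, [/\ 0 < C, 0 < cV &
  forall nu p g b0 r0 tau B (X v : 'rV[R]_m) (phi : T -> R),
  enorm nu = 1 -> 0 <= g -> g <= g0 -> 0 <= b0 -> 0 < r0 -> r0 <= 1 ->
  b0 * (3 * g0 + 10) `^ q * r0 `^ alpha <= 1 -> 0 <= tau -> tau <= 1 ->
  measurable_fun setT phi -> ~ wedge nu g b0 p X ->
  enorm (X - base p 0) <= r0 -> - (tau * r0) <= dot (slope nu g) (X - base p 0) ->
  1 / 2 <= enorm v -> 0 <= B ->
  (forall Y : 'rV[R]_m, phi Y <= phi X -> phi (2 *: X - Y) <= phi X ->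
     `|dot v (X - Y)| <= B * enorm (X - Y) `^ q) ->
  C * (B * r0 `^ (alpha - s) + 4 * b0 + tau * r0 `^ (- s) + 1) <= cV / 2 * r0 `^ (- s) ->
  balanced (wedge nu g b0 p) phi X (cV / 2 * r0 `^ (- s)) r0].
Proof.
move=> g00; have [C C0 hC] := mass_slabs.
pose sm : R := Num.sqrt m%:R.
have sm0 : 0 < sm by rewrite sqrtr_gt0.
pose cV : R := (2 / sm) ^+ m * (3 * g0 + 9) `^ (- (m%:R + s)).
have cV0 : 0 < cV by rewrite mulr_gt0 ?exprn_gt0 ?divr_gt0// powR_gt0; lra.
exists C, cV; split => // nu p g b0 r0 tau B X v phi nu1 g_ge g_le b00 r00 r01 hr0 tau0 tau1 mphi nA Xr Xe hv B0 hslab hle.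
set A := wedge nu g b0 p in nA *; set P := base p 0 in Xr Xe *.
set e := slope nu g in Xe *.
have nH : 0 <= xl X by rewrite leNgt; apply/negP => h; apply: nA; left.
have xlP : xl P = 0 by rewrite /P /base xl_ext.
(* The cube has depth between [r0] and [3 r0]. Its shift against [nu] is [3 g0 + 5] (in units of
   [r0]): [2 g] compensates for the depth, [1 + g] for the size of the cube, and at least [4] is
   left, so that [dot e (Y - P) <= - 4 r0] on the cube. Reflected at [X], the cube then falls into
   the wedge. *)
pose Z : 'rV[R]_m := P - r0 *: ext_row ((3 * g0 + 5) *: nu) 2.
pose V : set T := scube Z (r0 / sm).
have VZ (Y : 'rV[R]_m) : V Y -> enorm (Y - Z) <= r0.
  move=> VY; have smr : Num.sqrt m%:R * (r0 / sm) = r0 by rewrite mulrC divfK// gt_eqF.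
  rewrite -smr; apply: enorm_coord_le => i.
  by have := VY i; rewrite !mxE.
have xlV (Y : 'rV[R]_m) : V Y -> xl Y <= - r0.
  move=> /VZ h; have := le_trans (coord_enorm (Y - Z) ord_max) h; rewrite -/(xl (Y - Z)) xlB.
  have -> : xl Z = - (2 * r0).
    rewrite xlB xlP /xl mxE -/(xl _) xl_ext; ring.
  by rewrite ler_norml => /andP[_]; lra.
have eL : enorm e <= 1 + g by exact: enorm_slope_le.
have ZP : Z - P = - (r0 *: ext_row ((3 * g0 + 5) *: nu) 2) by rewrite /Z addrC addKr.
have nZP : enorm (Z - P) <= r0 * (3 * g0 + 7).
  rewrite ZP enormN enormZ gtr0_norm// ler_wpM2l ?(ltW r00)//.
  apply: le_trans (enorm_le_xhl _) _; rewrite xh_ext xl_ext enormZ nu1 mulr1 !ger0_norm//; lra.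
have YP (Y : 'rV[R]_m) : V Y -> enorm (Y - P) <= r0 * (3 * g0 + 8).
  move=> /VZ h; apply: le_trans (enormB_tri Z _ _) _; lra.
have dnu : dot nu nu = 1 by rewrite -enorm_sq nu1 expr1n.
have eY (Y : 'rV[R]_m) : V Y -> dot e (Y - P) <= - (4 * r0).
  move=> VY; have -> : Y - P = (Z - P) + (Y - Z) by apply/rowP => i; rewrite !mxE; ring.
  rewrite dotDr ZP dotNr dotZr dot_slope xh_ext xl_ext dotZr dnu mulr1.
  have := le_trans (ler_norm _) (cauchy_schwarz e (Y - Z)).
  have : enorm e * enorm (Y - Z) <= (1 + g) * r0.
    by apply: ler_pM; rewrite ?enorm_ge0//; exact: VZ.
  have : g * r0 <= g0 * r0 by rewrite ler_wpM2r// ltW.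
  move: (dot e (Y - Z)) (enorm e * enorm (Y - Z)); clear => *; lra.
have hV (Y : 'rV[R]_m) : V Y -> [/\ A Y, A (2 *: X - Y) & r0 <= enorm (X - Y)].
  move=> VY; split.
  - by left => /=; apply: le_lt_trans (xlV _ VY) _; rewrite oppr_lt0.
  - right; rewrite /= /bar -/e -/P.
    have E : 2 *: X - Y - P = 2 *: (X - P) - (Y - P) by apply/rowP => i; rewrite !mxE; ring.
    have d2 : 2 * r0 <= dot e (2 *: X - Y - P).
      rewrite E dotBr dotZr; have := eY _ VY; have : tau * r0 <= 1 * r0 by rewrite ler_wpM2r// ltW.
      by move: Xe; clear -alpha0 q0 s0 sa a1; lra.
    have n2 : enorm (2 *: X - Y - P) <= (3 * g0 + 10) * r0.
      rewrite E; apply: le_trans (enormB _ _) _; rewrite enormZ ger0_norm//.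
      by have := YP _ VY; move: Xr; clear -alpha0 q0 s0 sa a1; lra.
    have : b0 * enorm (2 *: X - Y - P) `^ q <= 1 * r0.
      apply: (@le_trans _ _ (b0 * ((3 * g0 + 10) * r0) `^ q)).
        by rewrite ler_wpM2l// powR_le_mono ?enorm_ge0.
      have g10 : 0 <= 3 * g0 + 10 by lra.
      rewrite (powRM _ g10 (ltW r00)) (powR1D alpha0 (ltW r00)).
      rewrite [in leLHS](mulrC r0) !mulrA ler_wpM2r ?(ltW r00)//.
    have r02 : r0 < 2 * r0 by rewrite ltr_pMl// ltr1n.
    by rewrite mul1r => h; rewrite subr_gt0; exact: le_lt_trans h (lt_le_trans r02 d2).
  - apply: le_trans (coord_enorm (X - Y) ord_max); rewrite -/(xl (X - Y)) xlB.
    by apply: le_trans (ler_norm _); have := lerB nH (xlV _ VY); rewrite sub0r opprK.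
pose W := gap A phi X; have mA : measurable A by exact: measurable_wedge.
have mW : measurable W by exact: measurable_gap.
have e1 : 1 <= enorm e by exact: enorm_slope_ge.
(* Beyond [r0] the wedge confines the unmatched points: it contains neither [Y] nor the reflection
   of [Y], and this bounds [dot e (X - Y)] on both sides. *)
have hmid (Y : 'rV[R]_m) : W Y -> r0 < enorm (X - Y) -> enorm (X - Y) <= 1 ->
    `|dot e (X - Y)| <= 4 * b0 * enorm (X - Y) `^ q + tau * r0.
  move=> [[[nY nY'] _] _] hr h1.
  have XP2 : enorm (X - P) + enorm (X - Y) <= 2 * enorm (X - Y) by move: Xr hr; clear -alpha0 q0 s0 sa a1; lra.
  have pw x : 0 <= x -> x <= enorm (X - P) + enorm (X - Y) -> b0 * x `^ q <= 4 * b0 * enorm (X - Y) `^ q.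
    move=> x0 hx; rewrite (mulrC 4) -mulrA ler_wpM2l//.
    exact: powR_double (ltW alpha0) (ltW a1) x0 (enorm_ge0 _) (le_trans hx XP2).
  have c1 : dot e (Y - P) <= b0 * enorm (Y - P) `^ q.
    by rewrite leNgt; apply/negP => h; apply: nY; right; rewrite /= /bar subr_gt0.
  have c2 : dot e (2 *: X - Y - P) <= b0 * enorm (2 *: X - Y - P) `^ q.
    by rewrite leNgt; apply/negP => h; apply: nY'; right; rewrite /= /bar subr_gt0.
  have E1 : Y - P = (X - P) + - (X - Y) by apply/rowP => i; rewrite !mxE; ring.
  have E2 : 2 *: X - Y - P = (X - P) + (X - Y) by apply/rowP => i; rewrite !mxE; ring.
  have k1 := le_trans c1 (pw _ (enorm_ge0 _) _).
  have k2 := le_trans c2 (pw _ (enorm_ge0 _) _).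
  rewrite E1 enormB dotDr dotNr in k1; rewrite E2 enormD dotDr in k2.
  have {}k1 := k1 isT; have {}k2 := k2 isT.
  by rewrite ler_norml; apply/andP; move: k1 k2 Xe; clear -alpha0 q0 s0 sa a1; split; lra.
have t0 : 0 <= tau * r0 by rewrite mulr_ge0// ltW.
have b40 : 0 <= 4 * b0 by rewrite mulr_ge0.
have hn (Y : 'rV[R]_m) : W Y -> enorm (X - Y) <= r0 -> `|dot v (X - Y)| <= B * enorm (X - Y) `^ q.
  by move=> [[_ h1] h2] _; exact: hslab.
have massW := hC X v e r0 B (4 * b0) (tau * r0) W hv e1 r00 r01 B0 b40 t0 mW hn hmid.
have massV : ((cV * r0 `^ (- s))%:E <= kmass X V)%E.
  have rsm : 0 < r0 / sm by rewrite divr_gt0.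
  have ga : 0 < (3 * g0 + 9) * r0 by rewrite mulr_gt0//; lra.
  apply: le_trans (kmass_cube_lower s0 (Z := Z) (X := X) rsm ga _).
    rewrite lee_fin; apply: eq_ler.
    have g9 : 0 <= 3 * g0 + 9 by lra.
    rewrite (powRM _ g9 (ltW r00)) /cV.
    have -> : (2 * (r0 / sm)) ^+ m = (2 / sm) ^+ m * r0 ^+ m.
      by rewrite -exprMn; congr (_ ^+ _); ring.
    have -> : r0 `^ (- s) = r0 ^+ m * r0 `^ (- (m%:R + s)).
      rewrite -(powR_mulrn m (ltW r00)) -powRD; first by congr (_ `^ _); ring.
      by apply/implyP => _; rewrite gt_eqF.
    by ring.
  move=> Y VY; have [_ _ far] := hV _ VY; split.
    by move=> XY; move: far; rewrite XY subrr enorm0 leNgt r00.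
  apply: le_trans (enormB_tri P _ _) _; rewrite (enormBC P).
  by have := YP _ VY; move: Xr; clear -alpha0 q0 s0 sa a1; lra.
have hW (Y : 'rV[R]_m) : ~ A Y -> ~ A (2 *: X - Y) -> phi Y <= phi X -> phi (2 *: X - Y) <= phi X -> W Y.
  by move=> h1 h2 h3 h4; exact: (conj (conj (conj h1 h2) h3) h4).
have bW : (kmass X W <= (cV / 2 * r0 `^ (- s))%:E)%E.
  apply: le_trans massW _; rewrite lee_fin; apply: le_trans hle.
  rewrite ler_wpM2l ?(ltW C0)// lerD2r lerD2l -mulrA ler_wpM2l//.
  rewrite -[X in X * _ <= _]powRr1 ?(ltW r00)// -powRD; last by apply/implyP => _; rewrite gt_eqF.
  by apply: eq_ler; congr (_ `^ _); ring.
(* One half of the gain pays for the losses, the other half remains as the constant of the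
   balance. *)
have bV : ((cV / 2 * r0 `^ (- s) + cV / 2 * r0 `^ (- s))%:E <= kmass X V)%E.
  by apply: le_trans massV; rewrite lee_fin; apply: eq_ler; field.
exact: (pointwise_balance mA (measurable_scube _ _) mW mphi hV hW bW bV).
Qed.

End Barriers.

(** * The three improvement steps for barriers *)

Section Steps.
Context {R : realType}.
Variables (n : nat) (s alpha : R).
Hypotheses (s0 : 0 < s) (sa : s < alpha) (a1 : alpha < 1).
Local Notation m := n.+1.
Local Notation T := (rowT R m).
Local Notation mu := (rmu R m).
Local Notation k := (@knl R m s).
Local Notation q := (1 + alpha).
Local Notation kmass := (@kmass R n s).
Local Notation balanced := (@balanced R n s).
Local Notation bar := (@bar R n alpha).
Local Notation wedge := (@wedge R n alpha).
Implicit Types (A V W : set T).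

Let alpha0 : 0 < alpha. Proof. exact: lt_trans sa. Qed.
Let q0 : 0 <= q. Proof. by rewrite addr_ge0// ltW. Qed.

Lemma xl_base (p : 'rV[R]_n) (y : R) : xl (base p y) = y.
Proof. exact: xl_ext. Qed.

Lemma xh_base (p : 'rV[R]_n) (y : R) : xh (base p y) = p.
Proof. exact: xh_ext. Qed.

Lemma xl_sub_base (X : 'rV[R]_m) p y : xl (X - base p y) = xl X - y.
Proof. by rewrite xlB xl_base. Qed.

Lemma xlZ (a : R) (X : 'rV[R]_m) : xl (a *: X) = a * xl X.
Proof. by rewrite /xl mxE. Qed.

Lemma xl_enorm_base (X : 'rV[R]_m) p : xl X <= enorm (X - base p 0).
Proof.
apply: le_trans (coord_enorm _ ord_max); rewrite -/(xl _) xl_sub_base subr0.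
exact: ler_norm.
Qed.

Lemma dot_slope_base nu g (X : 'rV[R]_m) p y :
  dot (slope nu g) (X - base p y) = dot nu (xh X - p) - g * (xl X - y).
Proof. by rewrite dot_slope xl_sub_base xhB xh_base. Qed.

Lemma dot_nu_le nu (X : 'rV[R]_m) p y : enorm nu = 1 ->
  dot nu (xh X - p) <= enorm (X - base p y).
Proof.
move=> nu1; apply: le_trans (ler_norm _) _; apply: le_trans (cauchy_schwarz _ _) _.
rewrite nu1 mul1r; apply: le_trans (enorm_xh_le _); by rewrite xhB xh_base.
Qed.

(** At nonnegative height a steep barrier is positive only below height [1 / g0], and there the
    unmatched points have mass of order [1 / g0]. Reflected at so low a point, the cube inside the
    bump falls below height [0]; this gain does not depend on [g0]. *)
Lemma first_step (b h0 rb a0 eps : R) : 1 <= b -> 0 < h0 -> 0 < rb -> 0 < a0 -> 0 < eps ->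
  exists g0 c, [/\ 1 <= g0, 0 < c & forall A nu p (Z X : 'rV[R]_m), measurable A ->
    (forall Y : 'rV[R]_m, xl Y < 0 -> A Y) -> scube Z rb `<=` A ->
    (forall Y : 'rV[R]_m, scube Z rb Y -> h0 <= xl Y) ->
    (forall X Y : 'rV[R]_m, enorm (X - base p 0) <= 1 -> scube Z rb Y -> enorm (X - Y) <= a0) ->
    enorm nu = 1 -> 0 <= xl X -> 0 < bar (slope nu g0) b (base p 0) (base p 0) X ->
    xl X <= eps /\ balanced A (bar (slope nu g0) b (base p 0) (base p 0)) X c (h0 / 2)].
Proof.
move=> b1 h00 rb0 a00 eps0.
have [C1 C10 hC1] := mass_near n s0 sa.
have [C3 C30 hC3] := mass_far_slab n s0.
pose c : R := (2 * rb) ^+ m * a0 `^ (- (m%:R + s)) / 2.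
have c0 : 0 < c by rewrite divr_gt0// mulr_gt0 ?powR_gt0// exprn_gt0// mulr_gt0.
have b0 : 0 <= b by apply: le_trans b1.
pose M := 6 * b * C1 + C3.
have M0 : 0 <= M by rewrite addr_ge0 ?mulr_ge0// ltW.
(* One summand per requirement: slope at least [1], height at most [eps], height at most [h0 / 4],
   losses at most [c]. *)
pose g0 : R := 1 + eps^-1 + 4 / h0 + M / c.
have x1 : 0 <= eps^-1 by rewrite invr_ge0 ltW.
have x2 : 0 <= 4 / h0 by rewrite divr_ge0// ltW.
have x3 : 0 <= M / c by rewrite divr_ge0// ltW.
have g1 : 1 <= g0 by rewrite /g0; lra.
have ge : eps^-1 <= g0 by rewrite /g0; lra.
have gh : 4 / h0 <= g0 by rewrite /g0; lra.
have gc : M / c <= g0 by rewrite /g0; lra.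
have gp : 0 < g0 by apply: lt_le_trans g1.
exists g0, c; split => // A nu p Z X mA HA ZA Zh Za nu1 X0 hphi.
set P := base p 0 in hphi Za *; set e := slope nu g0 in hphi *.
set phi := bar e b P P in hphi *.
have mphi : measurable_fun setT (phi : T -> R) by exact: measurable_bar.
have hp : g0 * xl X + b * enorm (X - P) `^ q < enorm (X - P).
  have := dot_nu_le X p 0 nu1; move: hphi; rewrite /phi /bar dot_slope_base subr0 -/P.
  move: (dot nu _) (enorm _) (b * _) (g0 * _); clear -alpha0 => *; lra.
have bq0 : 0 <= b * enorm (X - P) `^ q by rewrite mulr_ge0 ?powR_ge0.
have gx0 : 0 <= g0 * xl X by rewrite mulr_ge0// ltW.
have Xp : 0 < enorm (X - P) by move: hp bq0 gx0; clear -alpha0 => *; lra.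
have hal : enorm (X - P) `^ alpha <= 1.
  have h : enorm (X - P) * (b * enorm (X - P) `^ alpha) < enorm (X - P) * 1.
    by rewrite mulr1 mulrCA -(powR1D alpha0) ?(ltW Xp)//; move: hp gx0; clear -alpha0 => *; lra.
  rewrite ltr_pM2l// in h; apply: ltW; apply: le_lt_trans h.
  by rewrite ler_peMl// powR_ge0.
have X1 : enorm (X - P) <= 1.
  rewrite leNgt; apply/negP => h; move: hal; rewrite leNgt => /negP; apply.
  have -> : 1 = 1 `^ alpha :> R by rewrite powR1.
  by rewrite gt0_ltr_powR// nnegrE ltW.
have gX : g0 * xl X <= 1 by move: hp bq0 X1; clear -alpha0 => *; lra.
have Xg : xl X <= g0^-1 by rewrite -[g0^-1]mul1r ler_pdivlMr// mulrC.
split.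
  by apply: le_trans Xg _; rewrite -[leRHS]invrK lef_pV2// posrE ?invr_gt0.
have Xh : xl X <= h0 / 4.
  apply: le_trans Xg _; rewrite -[leRHS]invrK lef_pV2// ?posrE ?invr_gt0 ?divr_gt0//.
  by rewrite invf_div.
have [lam [l0 l1 hs]] := @bar_slab R n s alpha s0 sa a1 e b P P X b0.
set v := e - _ in hs.
have xlv : g0 <= `|xl v|.
  have -> : xl v = - (g0 + b * lam * xl X).
    by rewrite /v xlB xlZ /P xl_sub_base /e /slope xl_ext; ring.
  by rewrite normrN ger0_norm ?lerDl ?addr_ge0// ?mulr_ge0// ltW.
have vg : g0 <= enorm v by apply: le_trans xlv (coord_enorm _ _).
have v0 : v <> 0 by move=> h; move: vg; rewrite h enorm0 leNgt gp.
(* The gap relative to the half-space contains the one relative to [A], and its estimate is the same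
   for all [A]. *)
pose H : set T := [set Y | xl Y < 0]; pose W := gap H phi X.
have mW : measurable W by apply: measurable_gap => //; exact: measurable_half.
have mn : measurable_fun setT (fun Y : T => enorm (X - Y : 'rV[R]_m)).
  by apply: measurable_enorm; apply: measurable_rowB => //; exact: measurable_cst.
pose W1 := W `&` cball X 1.
pose W2 := W `&` [set Y : T | 1 < enorm (X - Y : 'rV[R]_m)].
have mW1 : measurable W1 by apply: measurableI => //; exact: measurable_cball.
have mW2 : measurable W2 by apply: measurableI => //; exact: measurable_ltr_set.
have b60 : 0 <= 6 * b by rewrite mulr_ge0.
have k1 : (kmass X W1 <= (C1 * (6 * b) / g0)%:E)%E.
  have sW1 : W1 `<=` cball X 1 by move=> Y [].
  have dW1 (Y : 'rV[R]_m) : W1 Y -> `|dot v (X - Y)| <= 6 * b * enorm (X - Y) `^ q.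
    by move=> [[[_ h1] h2] _]; exact: (hs Y h1 h2).
  apply: le_trans (hC1 X v (6 * b) 1 W1 v0 b60 ltr01 mW1 sW1 dW1) _.
  rewrite lee_fin powR1 mulr1 mulrA; apply: (ler_wpM2l (mulr_ge0 (ltW C10) b60)).
  by rewrite lef_pV2// posrE// (lt_le_trans gp).
pose el : 'rV[R]_m := ext_row 0 1.
have del (Y : 'rV[R]_m) : dot el Y = xl Y.
  rewrite /el dotS xh_ext xl_ext mul1r /dot big1 ?add0r// => i _; by rewrite mxE mul0r.
have el1 : enorm el = 1.
  rewrite -[LHS]ger0_norm ?enorm_ge0// -sqrtr_sqr enorm_sq del /el xl_ext; exact: sqrtr1.
have el0 : el <> 0 by move=> h; move: el1; rewrite h enorm0 => /esym/eqP; rewrite oner_eq0.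
have k2 : (kmass X W2 <= (C3 / g0)%:E)%E.
  have dW2 (Y : 'rV[R]_m) : W2 Y -> 1 < enorm (X - Y) /\ `|dot el (X - Y)| <= xl X.
    move=> [[[[/negP y1 /negP y2] _] _] ft]; split => //; rewrite del.
    rewrite -leNgt in y1; rewrite -leNgt in y2.
    have E : 2 *: X - Y = X + (X - Y) by apply/rowP => i; rewrite !mxE; ring.
    have E' : xl (2 *: X - Y) = 2 * xl X - xl Y by rewrite xlB /xl mxE.
    move: y1 y2; rewrite /= E' xlB ler_norml; clear -alpha0; move: (xl X) (xl Y) => *.
    by apply/andP; split; lra.
  apply: le_trans (hC3 X el (xl X) 1 W2 el0 X0 ltr01 mW2 dW2) _.
  by rewrite lee_fin powR1 mulr1 el1 divr1 ler_wpM2l// ltW.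
have kW : (kmass X W <= c%:E)%E.
  have WW : W = W1 `|` W2.
    apply/seteqP; split => [Y WY|Y [[]|[]]//].
    by case: (lerP (enorm (X - Y : 'rV[R]_m)) 1) => h; [left|right].
  rewrite WW; apply: le_trans (measureU2 _ mW1 mW2) _.
  apply: le_trans (leeD k1 k2) _; rewrite -EFinD lee_fin -mulrDl ler_pdivrMr//.
  have -> : C1 * (6 * b) + C3 = M by rewrite /M; ring.
  by rewrite -ler_pdivrMl// mulrC.
have YX (Y : 'rV[R]_m) : scube Z rb Y -> h0 / 2 <= enorm (X - Y).
  move=> /Zh h; rewrite enormBC; apply: le_trans (coord_enorm (Y - X) ord_max).
  rewrite -/(xl _) xlB; apply: le_trans (ler_norm _).
  move: h Xh h00; clear -alpha0; move: (xl X) (xl Y) => *; lra.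
have kV : ((c + c)%:E <= kmass X (scube Z rb))%E.
  apply: le_trans (kmass_cube_lower s0 (Z := Z) (X := X) rb0 a00 _).
    by rewrite lee_fin; apply: eq_ler; rewrite /c; field.
  move=> Y ZY; split; last exact: Za.
  move=> XY; have := YX _ ZY; rewrite XY subrr enorm0 leNgt => /negP; apply.
  by rewrite divr_gt0.
have hV (Y : 'rV[R]_m) : scube Z rb Y -> [/\ A Y, A (2 *: X - Y) & h0 / 2 <= enorm (X - Y)].
  move=> ZY; split; [exact: ZA| |exact: YX].
  apply: HA; have -> : xl (2 *: X - Y) = 2 * xl X - xl Y by rewrite xlB /xl mxE.
  have := Zh _ ZY; move: Xh h00; clear -alpha0; move: (xl X) (xl Y) => *; lra.
have hW (Y : 'rV[R]_m) : ~ A Y -> ~ A (2 *: X - Y) -> phi Y <= phi X -> phi (2 *: X - Y) <= phi X -> W Y.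
  by move=> n1 n2 h3 h4; exact: (conj (conj (conj (fun h => n1 (HA _ h)) (fun h => n2 (HA _ h))) h3) h4).
exact: (pointwise_balance mA (measurable_scube _ _) mW mphi hV hW kW kV).
Qed.

Lemma notin_wedge nu g b p (X : 'rV[R]_m) : ~ wedge nu g b p X ->
  0 <= xl X /\ dot nu (xh X - p) - g * xl X <= b * enorm (X - base p 0) `^ q.
Proof.
move=> h; split; first by rewrite leNgt; apply/negP => c; apply: h; left.
rewrite leNgt; apply/negP => c; apply: h; right.
by rewrite /= barE dot_slope_base !subr0 subr_gt0.
Qed.

Lemma double_eighth (x : R) : x <= 1 / 8 -> 2 * x <= 1 / 2.
Proof. by move=> *; lra. Qed.

Lemma slab_normal (e u : 'rV[R]_m) (x : R) : 1 <= enorm e -> enorm u <= 1 / 2 -> 1 / 2 <= enorm (e - u).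
Proof.
move=> h1 h2; have := enormD (e - u) u; rewrite subrK; lra.
Qed.

(** The three bounds respectively keep the normal of the barrier away from [0], keep the reflected
    cube inside the wedge, and make the curvature losses small compared with [r ^ (- s)]. *)
Lemma small_radius (C cV b0 y2 eps : R) : 0 < C -> 0 < cV -> 0 <= b0 -> 0 < eps ->
  exists r1, [/\ 0 < r1, r1 <= 1, r1 <= eps &
   forall r, 0 < r -> r <= r1 -> [/\ b0 * r `^ alpha <= 1 / 8, b0 * y2 * r `^ alpha <= 1 &
     C * (10 * b0 + 1) * r `^ s <= cV / 4]].
Proof.
move=> C0 cV0 b00 eps0.
have B1 : 0 < b0 + 1 by lra.
have [r1 r10 h1] := small_powR alpha0 (x := 1 / 8 / (b0 + 1)) ltac:(by rewrite !divr_gt0).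
have y20 : 0 < `|b0 * y2| + 1 by rewrite ltr_wpDl.
have [r2 r20 h2] := small_powR alpha0 (x := (`|b0 * y2| + 1)^-1) ltac:(by rewrite invr_gt0).
have k0 : 0 < C * (10 * b0 + 1) by rewrite mulr_gt0//; lra.
have [r3 r30 h3] := small_powR s0 (x := cV / 4 / (C * (10 * b0 + 1))) ltac:(by rewrite !divr_gt0).
exists (Num.min (Num.min r1 r2) (Num.min (Num.min r3 eps) 1)); split.
- by rewrite !lt_min r10 r20 r30 eps0 ltr01.
- by rewrite !ge_min lexx !orbT.
- by rewrite !ge_min lexx !orbT.
move=> r r0; rewrite !le_min => /andP[/andP[c1 c2] /andP[/andP[c3 _] _]]; split.
- have := h1 _ r0 c1; rewrite ler_pdivlMr// => h; apply: le_trans h.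
  by rewrite mulrC ler_wpM2l ?powR_ge0// lerDl.
- have := h2 _ r0 c2; rewrite -[leRHS]mul1r ler_pdivlMr// => h; apply: le_trans h.
  rewrite mulrC ler_wpM2l ?powR_ge0//; apply: le_trans (ler_norm _) _; by rewrite lerDl.
- by rewrite mulrC -ler_pdivlMr//; exact: h3.
Qed.

(** [tau] is chosen before [b0]: the curvature already present is absorbed by a smaller radius,
    whereas the tilt costs [7 C tau r0^(- s)], which scales like the gain and has to be small from
    the start. *)
Lemma tilt_step (g0 : R) : 0 <= g0 -> exists tau, [/\ 0 < tau, tau <= 1 & forall b0 eps : R, 0 <= b0 -> 0 < eps ->
  exists b c t0, [/\ b0 <= b, 0 < c, 0 < t0 & forall nu p g g' (X : 'rV[R]_m), enorm nu = 1 ->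
    0 <= g' -> g' <= g -> g <= g0 -> g - g' <= tau ->
    ~ wedge nu g b0 p X -> 0 < bar (slope nu g') b (base p 0) (base p 0) X ->
    xl X <= eps /\ balanced (wedge nu g b0 p) (bar (slope nu g') b (base p 0) (base p 0)) X c t0]].
Proof.
move=> g00; have [C [cV [C0 cV0 hw]]] := wedge_balance n s0 sa a1 g00.
(* In [7 * C], six parts come from the added curvature and one from the width of the slab; [1 / 8]
   serves the bound on the normal. *)
pose tau := Num.min (1 / 8) (cV / 4 / (7 * C)).
have C7 : 0 < 7 * C by rewrite mulr_gt0.
have tau0 : 0 < tau by rewrite lt_min !divr_gt0.
have t8 : tau <= 1 / 8 by rewrite ge_min lexx.
have tC : 7 * C * tau <= cV / 4.
  by rewrite mulrC -ler_pdivlMr// /tau ge_min lexx orbT.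
have t1 : tau <= 1 by lra.
exists tau; split => // b0 eps b00 eps0.
have [r0 [r00 r01 re hr]] := small_radius ((3 * g0 + 10) `^ q) C0 cV0 b00 eps0.
have [c1 c2 c3] := hr _ r00 (lexx _).
(* The extra curvature confines the new region to the ball of radius [r0]: outside the old wedge,
   positivity of the new barrier gives [tau r0^(- alpha) |X - P|^q < tau xl X <= tau |X - P|]. *)
pose b := b0 + tau * r0 `^ (- alpha).
have bb : b0 <= b by rewrite lerDl mulr_ge0 ?powR_ge0 ?(ltW tau0).
have bge : 0 <= b by exact: le_trans bb.
exists b, (cV / 2 * r0 `^ (- s)), r0; split => //; first by rewrite mulr_gt0 ?divr_gt0 ?powR_gt0.
move=> nu p g g' X nu1 g'0 gg gg0 hgt nA hphi.
have [X0 hX] := notin_wedge nA.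
set P := base p 0 in hphi hX *; set e := slope nu g' in hphi *.
have hp : b * enorm (X - P) `^ q < dot nu (xh X - p) - g' * xl X.
  by move: hphi; rewrite barE dot_slope_base subr0 subr_gt0.
have xP : xl X <= enorm (X - P) by exact: xl_enorm_base.
have bq0 : 0 <= b0 * enorm (X - P) `^ q by rewrite mulr_ge0 ?powR_ge0.
have tq0 : 0 <= tau * r0 `^ (- alpha) * enorm (X - P) `^ q.
  by rewrite mulr_ge0 ?powR_ge0// mulr_ge0 ?powR_ge0// ltW.
have hgx : (g - g') * xl X <= tau * xl X by rewrite ler_wpM2r.
have hlt : tau * r0 `^ (- alpha) * enorm (X - P) `^ q < tau * xl X.
  move: hp hX hgx; rewrite /b !mulrDl mulNr.
  move: (dot _ _) (b0 * _) (tau * xl X) (tau * _ * _) (g * _) (g' * _); clear -alpha0 => *; lra.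
have ra (z : R) : 0 < z -> z `^ (- alpha) * z `^ alpha = 1.
  by move=> z0; rewrite -powRD ?addNr ?powRr0//; apply/implyP => _; rewrite gt_eqF.
have Xr : enorm (X - P) <= r0.
  have x0 : 0 < enorm (X - P).
    rewrite lt_neqAle enorm_ge0 andbT; apply/eqP => h; move: hlt.
    rewrite -h in xP *; have -> : xl X = 0 by apply/eqP; rewrite eq_le X0 xP.
    by rewrite mulr0 ltNge mulr_ge0 ?powR_ge0// mulr_ge0 ?powR_ge0// ltW.
  apply: ltW; apply: (@powR_lt_inv R alpha); rewrite ?(ltW alpha0) ?(ltW r00)//.
  have h : r0 `^ (- alpha) * enorm (X - P) `^ alpha < 1.
    rewrite -(ltr_pM2l tau0) -(ltr_pM2r x0) mulr1.
    apply: lt_le_trans (_ : tau * xl X <= _); last by rewrite ler_wpM2l// ltW.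
    by apply: le_lt_trans hlt; rewrite (powR1D alpha0) ?(ltW x0)//; apply: eq_ler; ring.
  have := ltr_pM2l (powR_gt0 alpha r00); move=> /(_ (r0 `^ (- alpha) * enorm (X - P) `^ alpha) 1).
  by rewrite h mulr1 mulrCA mulrA ra// mul1r.
split; first by apply: le_trans xP _; apply: le_trans re.
have [lam [l0 l1 hs]] := @bar_slab R n s alpha s0 sa a1 e b P P X bge.
have ba : b * r0 `^ alpha <= 1 / 4.
  by rewrite /b mulrDl -mulrA ra// mulr1; lra.
have vv : 1 / 2 <= enorm (e - (b * lam) *: (X - P)).
  apply: slab_normal => //; first exact: enorm_slope_ge.
  rewrite enormZ ger0_norm ?mulr_ge0// -mulrA.
  apply: (@le_trans _ _ (b * (2 * enorm (X - P) `^ alpha))); first by rewrite ler_wpM2l.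
  apply: (@le_trans _ _ (2 * (b * r0 `^ alpha))).
    by rewrite mulrCA ler_wpM2l// ler_wpM2l// powR_le_mono ?enorm_ge0// ltW.
  by lra.
have b6 : 0 <= 6 * b by rewrite mulr_ge0.
have g_ge : 0 <= g by exact: le_trans gg.
have Xe : - (tau * r0) <= dot (slope nu g) (X - P).
  rewrite dot_slope_base subr0.
  have tx : tau * xl X <= tau * r0 by rewrite ler_wpM2l ?(ltW tau0)// (le_trans xP).
  have bp : 0 <= b * enorm (X - P) `^ q by rewrite mulr_ge0 ?powR_ge0.
  move: hp hgx tx bp; rewrite mulrBl.
  move: (dot _ _) (b * _) (tau * r0) (tau * xl X) (g * _) (g' * _); clear -alpha0 => *; lra.
apply: (hw nu p g b0 r0 tau (6 * b) X _ (bar e b P P) nu1 g_ge gg0 b00 r00 r01 c2 (ltW tau0) t1 _ nA Xr Xe vv b6 hs).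
  exact: measurable_bar.
set z := r0 `^ (- s); have z0 : 0 < z by exact: powR_gt0.
have e1 : b * r0 `^ (alpha - s) = b0 * r0 `^ alpha * z + tau * z.
  rewrite powRD; last by apply/implyP => _; rewrite gt_eqF.
  rewrite -/z /b mulrDl mulrA; congr (_ + _).
  by rewrite -!mulrA (mulrA _ _ z) ra// mul1r.
have zs : z * r0 `^ s = 1 by rewrite /z -powRD ?addNr ?powRr0//; apply/implyP => _; rewrite gt_eqF.
have k1 : C * (10 * b0 + 1) <= cV / 4 * z.
  have := ler_wpM2r (ltW z0) c3; by rewrite -(mulrA _ (r0 `^ s)) (mulrC (r0 `^ s)) zs mulr1.
have rz : b0 * (r0 `^ alpha * z) <= b0.
  rewrite -[leRHS]mulr1 ler_wpM2l// /z -powRD; last by apply/implyP => _; rewrite gt_eqF.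
  by apply: powR_le1; rewrite ?(ltW r00)// subr_ge0 ltW.
have k2 : 7 * C * tau * z <= cV / 4 * z by rewrite ler_wpM2r// ltW.
rewrite -[6 * b * _]mulrA e1 -[b0 * _ * z]mulrA.
have k3 : C * (b0 * (r0 `^ alpha * z)) <= C * b0 by rewrite ler_wpM2l// ltW.
move: k1 k2 k3; rewrite -/z.
have -> : C * (6 * (b0 * (r0 `^ alpha * z) + tau * z) + 4 * b0 + tau * z + 1) =
  6 * (C * (b0 * (r0 `^ alpha * z))) + 7 * C * tau * z + 4 * (C * b0) + C by ring.
have -> : C * (10 * b0 + 1) = 10 * (C * b0) + C by ring.
have -> : cV / 2 * z = cV / 4 * z + cV / 4 * z by field.
move: (7 * C * _ * _) (C * b0) (cV / 4 * z) (C * (b0 * _)); clear -alpha0 => *; lra.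
Qed.

(** [b] and [yb] are fixed before [y0], so one curvature serves all heights up to [yb]; only the
    gain and the truncation radius depend on [y0]. *)
Lemma final_step (b0 bmin eps : R) : 0 <= b0 -> 0 <= bmin -> 0 < eps ->
  exists b yb, [/\ bmin <= b, 0 < yb & forall y0, 0 < y0 -> y0 <= yb ->
  exists c t0, [/\ 0 < c, 0 < t0 & forall nu p (X : 'rV[R]_m), enorm nu = 1 ->
    ~ wedge nu 0 b0 p X -> 0 < bar (slope nu 0) b (base p 0) (base p y0) X ->
    xl X <= eps /\ balanced (wedge nu 0 b0 p) (bar (slope nu 0) b (base p 0) (base p y0)) X c t0]].
Proof.
move=> b00 bm0 eps0; have [C [cV [C0 cV0 hw]]] := wedge_balance n s0 sa a1 (lexx 0).
(* Points farther than [y0] from the lifted vertex are at most twice as far from the old one, and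
   [4] is the doubling constant of [powR_double]: there the new region lies inside the old wedge. *)
pose b := 4 * b0 + bmin.
have bge : 0 <= b by rewrite addr_ge0// mulr_ge0.
have [r1 [r10 r11 re hr]] := small_radius ((3 * 0 + 10) `^ q) C0 cV0 bge eps0.
exists b, (r1 / 2); split; [by rewrite lerDr mulr_ge0|by rewrite divr_gt0|].
move=> y0 y00 yb; pose r0 := 2 * y0.
have r00 : 0 < r0 by rewrite mulr_gt0.
have rr1 : r0 <= r1 by rewrite /r0; lra.
have [c1 c2 c3] := hr _ r00 rr1.
have b0b : b0 <= b by rewrite /b; lra.
exists (cV / 2 * r0 `^ (- s)), r0; split => //; first by rewrite mulr_gt0 ?divr_gt0 ?powR_gt0.
move=> nu p X nu1 nA hphi.
have [X0 hX] := notin_wedge nA; rewrite mul0r subr0 in hX.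
set P := base p 0 in hphi hX *; set Q := base p y0 in hphi *; set e := slope nu 0 in hphi *.
have hp : b * enorm (X - Q) `^ q < dot nu (xh X - p).
  by move: hphi; rewrite barE dot_slope_base mul0r subr0 subr_gt0.
have PQ : enorm (Q - P) <= y0.
  apply: le_trans (enorm_le_xhl _) _.
  rewrite xhB xlB !xh_base !xl_base subrr enorm0 add0r subr0 gtr0_norm//.
have XPQ : enorm (X - P) <= enorm (X - Q) + y0.
  by apply: le_trans (enormB_tri Q _ _) _; rewrite lerD2l.
have XQ : enorm (X - Q) <= y0.
  rewrite leNgt; apply/negP => h.
  have h2 : enorm (X - P) <= 2 * enorm (X - Q) by move: XPQ h; move: (enorm (X - P)) (enorm (X - Q)); clear -alpha0 => *; lra.
  have : b0 * enorm (X - P) `^ q <= b * enorm (X - Q) `^ q.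
    apply: (@le_trans _ _ (b0 * (4 * enorm (X - Q) `^ q))); last first.
      by rewrite mulrA ler_wpM2r ?powR_ge0// mulrC lerDl.
    by apply: (ler_wpM2l b00); exact: (powR_double (ltW alpha0) (ltW a1)) (enorm_ge0 _) (enorm_ge0 _) h2.
  by move=> c; have := lt_le_trans hp hX; rewrite ltNge c.
have Xr : enorm (X - P) <= r0.
  by apply: le_trans XPQ _; rewrite /r0 mulrDl mul1r lerD2r.
split; first by apply: le_trans (xl_enorm_base X p) _; apply: le_trans Xr _; apply: le_trans rr1 re.
have [lam [l0 l1 hs]] := @bar_slab R n s alpha s0 sa a1 e b P Q X bge.
have vv : 1 / 2 <= enorm (e - (b * lam) *: (X - Q)).
  apply: slab_normal => //; first exact: enorm_slope_ge.
  rewrite enormZ ger0_norm ?mulr_ge0// -mulrA.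
  apply: (@le_trans _ _ (b * (2 * enorm (X - Q) `^ alpha))); first by rewrite ler_wpM2l.
  apply: (@le_trans _ _ (2 * (b * r0 `^ alpha))).
    rewrite mulrCA ler_wpM2l// ler_wpM2l// powR_le_mono ?enorm_ge0// ?(ltW alpha0)//.
    by apply: le_trans XQ _; rewrite /r0 ler_peMl ?ler1n// ltW.
  exact: double_eighth.
have b6 : 0 <= 6 * b by rewrite mulr_ge0.
have Xe : - (0 * r0) <= dot (slope nu 0) (X - P).
  rewrite dot_slope_base mul0r oppr0 mul0r subr0; apply: ltW; apply: le_lt_trans hp.
  by rewrite mulr_ge0 ?powR_ge0.
have c2' : b0 * (3 * 0 + 10) `^ q * r0 `^ alpha <= 1.
  by apply: le_trans c2; rewrite ler_wpM2r ?powR_ge0// ler_wpM2r ?powR_ge0.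
have r01 : r0 <= 1 by exact: le_trans r11.
apply: (hw nu p 0 b0 r0 0 (6 * b) X _ (bar e b P Q) nu1 (lexx _) (lexx _) b00 r00 r01 c2' (lexx _) ler01 _ nA Xr Xe vv b6 hs).
  exact: measurable_bar.
set z := r0 `^ (- s); have z0 : 0 < z by exact: powR_gt0.
have zs : z * r0 `^ s = 1 by rewrite /z -powRD ?addNr ?powRr0//; apply/implyP => _; rewrite gt_eqF.
have k1 : C * (10 * b + 1) <= cV / 4 * z.
  have := ler_wpM2r (ltW z0) c3; by rewrite -(mulrA _ (r0 `^ s)) (mulrC (r0 `^ s)) zs mulr1.
have rz : b * r0 `^ (alpha - s) <= b.
  rewrite -[leRHS]mulr1 ler_wpM2l//.
  by apply: powR_le1; rewrite ?(ltW r00)// subr_ge0 ltW.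
have k3 : C * (6 * b * r0 `^ (alpha - s) + 4 * b0 + 0 * z + 1) <= C * (10 * b + 1).
  apply: (ler_wpM2l (ltW C0)); rewrite mul0r addr0 lerD2r -mulrA.
  rewrite (_ : 10 * b = 6 * b + 4 * b); last by ring.
  by apply: lerD; apply: ler_wpM2l.
apply: le_trans k3 _; apply: le_trans k1 _; apply: (ler_wpM2r (ltW z0)).
by apply: (ler_wpM2l (ltW cV0)); rewrite lef_pV2 ?posrE// ler_nat.
Qed.

End Steps.

(** * Barrier regions contained in the minimizer *)

Section Sticking.
Context {R : realType}.
Variables (n : nat) (s alpha : R).
Hypotheses (s0 : 0 < s) (s1 : s < 1) (sa : s < alpha) (a1 : alpha < 1).
Local Notation m := n.+1.
Local Notation T := (rowT R m).
Local Notation mu := (rmu R m).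
Local Notation q := (1 + alpha).
Local Notation balanced := (@balanced R n s).
Local Notation bar := (@bar R n alpha).
Local Notation wedge := (@wedge R n alpha).
Implicit Types (A B D : set T) (nu p : 'rV[R]_n) (X Y Z : 'rV[R]_m).
Variables (omega : set 'rV[R]_n) (psi : 'rV[R]_n -> R) (eps d : R).
Hypotheses (oom : open omega) (bom : ebounded omega) (cpsi : continuous psi).
Hypotheses (psi_bd : forall x, 0 <= psi x <= eps) (eps0 : 0 < eps) (d0 : 0 < d).
Hypothesis sep : forall x y, psi x != 0 -> omega y -> d <= enorm (x - y).
Local Notation lower := (lower_set omega psi).
Local Notation upper := (upper_set omega psi eps).
Variable E : set T.
Hypothesis minE : minimizer s omega psi eps E.

(** Inclusion in [E] holds up to a null set, which is all that calibration yields; the bound by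
    [upper] permits adding the missing part to [E]. *)
Definition filled A := [/\ measurable A, A `<=` upper & mu (A `\` E) = 0%E].

Let mE : measurable E. Proof. by case: minE => [[]]. Qed.
Let lE : lower `<=` E. Proof. by case: minE => [[]]. Qed.
Let alpha0 : 0 < alpha. Proof. exact: lt_trans sa. Qed.
Let q0 : 0 <= q. Proof. by rewrite addr_ge0// ltW. Qed.

Lemma filled_sub A B : measurable A -> A `<=` B -> filled B -> filled A.
Proof.
move=> mA AB [mB BU B0]; split => //; first exact: subset_trans BU.
apply/eqP; rewrite -measure_le0 -B0; apply: le_measure.
- by rewrite inE; exact: measurableD.
- by rewrite inE; exact: measurableD.
- by move=> X [/AB ? ?].
Qed.

Lemma filled_lower : filled lower.
Proof.
split; [exact: measurable_lower|exact: (lower_upper psi_bd eps0)|].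
rewrite (_ : _ `\` _ = set0) ?measure0//.
by apply/seteqP; split => // X [/lE].
Qed.

Lemma filled_calibrated A (phi : T -> R) (c t0 : R) : filled A -> measurable_fun setT phi ->
  0 < c -> 0 < t0 ->
  (forall X, ~ A X -> 0 < phi X -> (upper `\` lower) X /\ balanced A phi X c t0) ->
  filled (A `|` [set X | 0 < phi X]).
Proof.
move=> [mA AU A0] mphi c0 t00 h.
have mP : measurable [set X : T | 0 < phi X] by exact: measurable_ltr_set.
have mN : measurable (A `\` E) by exact: measurableD.
have NU : A `\` E `<=` upper by move=> X [/AU].
(* Calibration asks for [A] to lie inside the minimizer, so [E] is first enlarged by the null set
   [A \ E]. *)
have minE' := minimizer_ae oom cpsi minE mN A0 NU.
set E' := E `|` (A `\` E) in minE'.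
have mE' : measurable E' by exact: measurableU.
have AE' : A `<=` E' by move=> X AX; case: (pselect (E X)) => EX; [left|right].
pose D := [set X : T | 0 < phi X] `\` E'.
have mD : measurable D by exact: measurableD.
have hD X : D X -> (upper `\` lower) X /\ balanced A phi X c t0.
  by move=> [pX nE]; apply: h => // /AE'.
have DK : D `<=` upper `\` lower by move=> X /hD[].
have D0 : D `&` E' = set0 by apply/seteqP; split => // X [[]].
have fD : (mu D < +oo)%E.
  apply: bounded_mu => //; have [M hM] := bounded_window psi eps bom.
  by exists M => X /DK; exact: hM.
have cal : (J s (D `*` ~` (E' `|` D)) + c%:E * mu D <= J s (D `*` E'))%E.
  apply: (calibration s0 mD mE' mA mphi fD D0 AE' _ _ (ltW c0) t00).
  - by move=> X [].
  - by move=> Y nE nD; rewrite leNgt; apply/negP => pY; apply: nD.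
  - by move=> X t /hD[_]; exact.
have muD := minimizer_calibrated s0 s1 oom bom cpsi psi_bd eps0 d0 sep minE' mD DK D0 c0 cal.
have sub : (A `|` [set X | 0 < phi X]) `\` E `<=` (A `\` E) `|` D.
  move=> X [AX nE]; case: (pselect (A X)) => AX'; first by left.
  by case: AX => // pX; right; split => // -[//|[]].
split.
- exact: measurableU.
- move=> X [/AU//|pX]; case: (pselect (A X)) => [/AU//|nA].
  by have [[]] := h _ nA pX.
- apply/eqP; rewrite -measure_le0.
  apply: (@le_trans _ _ (mu ((A `\` E) `|` D))).
    apply: le_measure => //.
    + by rewrite inE; apply: measurableD => //; exact: measurableU.
    + by rewrite inE; exact: measurableU.
  apply: le_trans (measureU2 _ mN mD) _.
  set u := (X in (X + _)%E); have -> : u = 0%E by exact: A0.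
  set v := (X in (_ + X)%E); have -> : v = 0%E by exact: muD.
  by rewrite adde0.
Qed.

(** A unit inner normal at [p] with an interior paraboloid. The inequality is imposed for all [z],
    so that no chart radius enters the barrier estimates. *)
Definition good (C : R) p nu := enorm nu = 1 /\
  forall z, C * enorm (z - p) `^ q < dot nu (z - p) -> omega z.

(** For [g >= 0] and [b >= C], a point of nonnegative height with positive barrier value projects
    into the interior paraboloid at [p], hence into [omega]. *)
Lemma bar_window (C b g y : R) p nu X : 0 <= C -> C <= b -> 0 <= g -> good C p nu ->
  0 <= xl X -> xl X <= eps -> 0 < bar (slope nu g) b (base p 0) (base p y) X ->
  (upper `\` lower) X.
Proof.
move=> C0 Cb g0 [nu1 hz] X0 Xe; rewrite windowE barE dot_slope_base subr0 subr_gt0 => h.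
split; last by rewrite /= X0 Xe.
apply: hz; apply: (@le_lt_trans _ _ (b * enorm (X - base p y) `^ q)).
  apply: ler_pM => //; first exact: powR_ge0.
  apply: powR_le_mono; rewrite ?enorm_ge0//.
  by apply: le_trans (enorm_xh_le _); rewrite xhB xh_base.
by apply: lt_le_trans h _; rewrite lerBlDr lerDl mulr_ge0.
Qed.

Lemma filled_first (C h0 rb : R) Z : 0 <= C -> 0 < h0 -> 0 < rb -> scube Z rb `<=` lower ->
  (forall Y, scube Z rb Y -> h0 <= xl Y) ->
  exists g0 b, [/\ 0 <= g0, C <= b & forall p nu, good C p nu -> enorm p <= 1 ->
    filled (wedge nu g0 b p)].
Proof.
move=> C0 h00 rb0 Zl Zh.
(* Bounds the distance to the cube from any point within [1] of [base p 0], uniformly for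
   [enorm p <= 1]. *)
pose a0 := 2 + enorm Z + Num.sqrt m%:R * rb.
have a00 : 0 < a0.
  by rewrite /a0 -addrA ltr_pwDl// addr_ge0 ?enorm_ge0// mulr_ge0 ?sqrtr_ge0// ltW.
pose b := 1 + C; have b1 : 1 <= b by rewrite lerDl.
have [g0 [c [g1 c0 hf]]] := first_step n s0 sa a1 b1 h00 rb0 a00 eps0.
have g00 : 0 <= g0 by exact: le_trans g1.
exists g0, b; split => //; first by rewrite lerDr.
move=> p nu gd p1; have [nu1 _] := gd.
pose phi : T -> R := bar (slope nu g0) b (base p 0) (base p 0).
have mphi : measurable_fun setT phi by exact: measurable_bar.
have Za X Y : enorm (X - base p 0) <= 1 -> scube Z rb Y -> enorm (X - Y) <= a0.
  move=> h1 h2; apply: le_trans (enormB_tri (base p 0) _ _) _.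
  have h3 : enorm (base p 0 - Y) <= enorm (base p 0) + enorm Y by exact: enormB.
  have h4 : enorm (base p 0) <= 1.
    by apply: le_trans (enorm_le_xhl _) _; rewrite xh_base xl_base normr0 addr0.
  have h5 : enorm Y <= enorm (Y - Z) + enorm Z by rewrite -{1}(subrK Z Y); exact: enormD.
  have h6 : enorm (Y - Z) <= Num.sqrt m%:R * rb.
    by apply: enorm_coord_le => i; have := h2 i; rewrite !mxE.
  rewrite (_ : a0 = 1 + (1 + (Num.sqrt m%:R * rb + enorm Z))); last by rewrite /a0; ring.
  exact: lerD h1 (le_trans h3 (lerD h4 (le_trans h5 (lerD h6 (lexx _))))).
have HA Y : xl Y < 0 -> lower Y by left.
apply: filled_sub (filled_calibrated filled_lower mphi c0 (_ : 0 < h0 / 2) _).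
- exact: measurable_wedge.
- by move=> X [HX|pX]; [left; left|right].
- by rewrite divr_gt0.
move=> X nA pX.
have X0 : 0 <= xl X by rewrite leNgt; apply/negP => /HA.
have [Xe bal] := hf _ nu p Z X (measurable_lower oom cpsi) HA Zl Zh Za nu1 X0 pX.
by split => //; apply: (bar_window C0 _ g00 gd X0 Xe pX); rewrite lerDr.
Qed.

(** Every tilt lowers the slope by the same [tau] while the curvature grows; [b] depends on [j] but
    not on [p], [nu] or [g]. Clipping at [0] lets the iteration overshoot. *)
Lemma filled_tilt (C g0 : R) : 0 <= C -> 0 <= g0 -> exists2 tau, 0 < tau &
  forall b0 (j : nat), C <= b0 -> exists2 b, b0 <= b & forall p nu g, good C p nu ->
    0 <= g -> g <= g0 -> filled (wedge nu g b0 p) ->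
    filled (wedge nu (Num.max (g - j%:R * tau) 0) b p).
Proof.
move=> C0 g00; have [tau [tau0 tau1 ht]] := tilt_step n s0 sa a1 g00.
exists tau => // b0 j Cb; elim: j => [|j [b bb IH]].
  exists b0; first exact: lexx.
  move=> p nu g _ g_ge _; rewrite mul0r subr0.
  by have -> : Num.max g 0 = g by apply/max_idPl.
have bge : 0 <= b by apply: le_trans bb; exact: le_trans Cb.
have [b' [c [t0 [bb' c0 t00 hs]]]] := ht b eps bge eps0.
exists b'; first exact: le_trans bb'.
move=> p nu g gd g_ge gg0 hfill; have [nu1 _] := gd.
have {}IH := IH p nu g gd g_ge gg0 hfill.
set g1 := Num.max _ _ in IH; set g2 := Num.max _ _.
have g20 : 0 <= g2 by rewrite le_max lexx orbT.
have jt : j.+1%:R * tau = j%:R * tau + tau by rewrite -natr1 mulrDl mul1r.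
have g21 : g2 <= g1.
  rewrite ge_max !le_max lexx orbT andbT; apply/orP; left.
  by rewrite jt opprD addrA lerBlDr lerDl ltW.
have g1g : g1 <= g0.
  rewrite ge_max g00 andbT; apply: le_trans gg0; rewrite lerBlDr lerDl mulr_ge0//.
  exact: ltW.
have gt : g1 - g2 <= tau.
  rewrite lerBlDr ge_max; apply/andP; split; last by rewrite addr_ge0// ltW.
  rewrite -lerBlDl le_max; apply/orP; left; rewrite jt opprD addrA; exact: lexx.
pose phi : T -> R := bar (slope nu g2) b' (base p 0) (base p 0).
have mphi : measurable_fun setT phi by exact: measurable_bar.
apply: filled_sub (filled_calibrated IH mphi c0 t00 _).
- exact: measurable_wedge.
- by move=> X [HX|pX]; [left; left|right].
move=> X nA pX.
have [X0 _] := notin_wedge nA.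
have [Xe bal] := hs nu p g1 g2 X nu1 g20 g21 g1g gt nA pX.
split => //; apply: (bar_window C0 _ g20 gd X0 Xe pX).
exact: le_trans (le_trans bb bb').
Qed.

Lemma filled_vertical (C h0 rb : R) Z : 0 <= C -> 0 < h0 -> 0 < rb -> scube Z rb `<=` lower ->
  (forall Y, scube Z rb Y -> h0 <= xl Y) ->
  exists b yb, [/\ 0 <= b, 0 < yb & forall y0 p nu, 0 < y0 -> y0 <= yb ->
    good C p nu -> enorm p <= 1 ->
    filled [set X | 0 < bar (slope nu 0) b (base p 0) (base p y0) X]].
Proof.
move=> C0 h00 rb0 Zl Zh.
have [g0 [b0 [g00 Cb0 hfirst]]] := filled_first C0 h00 rb0 Zl Zh.
have [tau tau0 htilt] := filled_tilt C0 g00.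
(* Enough tilts to bring the slope [g0] down to [0]. *)
pose j := (Num.truncn (g0 / tau)).+1.
have hj : g0 - j%:R * tau <= 0.
  by rewrite subr_le0 -ler_pdivrMr//; apply: ltW; exact: truncnS_gt.
have [b1 b01 ht] := htilt b0 j Cb0.
have Cb1 : C <= b1 by exact: le_trans b01.
have b1ge : 0 <= b1 by exact: le_trans Cb1.
have [b [yb [Cb yb0 hfin]]] := final_step n s0 sa a1 b1ge C0 eps0.
exists b, yb; split => //; first exact: le_trans Cb.
move=> y0 p nu y00 y0b gd p1; have [nu1 _] := gd.
have [c [t0 [c0 t00 hs]]] := hfin y0 y00 y0b.
have f1 := ht p nu g0 gd g00 (lexx _) (hfirst p nu gd p1).
have E0 : Num.max (g0 - j%:R * tau) 0 = 0 by apply/max_idPr.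
rewrite E0 in f1.
pose phi : T -> R := bar (slope nu 0) b (base p 0) (base p y0).
have mphi : measurable_fun setT phi by exact: measurable_bar.
apply: filled_sub (filled_calibrated f1 mphi c0 t00 _).
- exact: measurable_ltr_set.
- by move=> X pX; right.
move=> X nA pX.
have [X0 _] := notin_wedge nA.
have [Xe bal] := hs nu p X nu1 nA pX.
by split => //; exact: (bar_window C0 Cb (lexx 0) gd X0 Xe pX).
Qed.

End Sticking.

(** * Boundary paraboloids *)

Section Graph.
Context {R : realType}.
Variable n : nat.
Local Notation V := 'rV[R]_n.
Local Notation e_ := (fun j : 'I_n => delta_mx ord0 j : V).

Lemma derive_line (f : V -> R) (y h : V) (t : R) : differentiable f (y + t *: h) ->
  is_derive t 1 (fun u : R => f (y + u *: h)) ('D_h f (y + t *: h)).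
Proof.
move=> df.
have E : (fun u : R => u^-1 *: (((fun u : R => f (y + u *: h)) \o shift t) (u *: (1 : R)) - f (y + t *: h))) =
  (fun u : R => u^-1 *: ((f \o shift (y + t *: h)) (u *: h) - f (y + t *: h))).
  apply/funext => u /=; do 2 f_equal; congr f.
  by apply/rowP => i; rewrite !mxE /GRing.scale /= mulr1; ring.
have dd : derivable f (y + t *: h) h by exact: diff_derivable.
split; first by rewrite /derivable E.
by rewrite /derive E.
Qed.

Lemma derive_sum_coord (f : V -> R) (x h : V) : differentiable f x ->
  'D_h f x = \sum_j h ord0 j * 'D_(e_ j) f x.
Proof.
move=> df; rewrite (deriveE _ df) {1}(row_sum_delta h) linear_sum.
by apply: eq_bigr => j _; rewrite linearZ /= deriveE.
Qed.

(** Mean value theorem on the segment from [y] to [z], then the Hoelder bound for each partial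
    derivative. *)
Lemma holder_taylor (f : V -> R) (alpha : R) : 0 < alpha -> C1alpha_fun alpha f ->
  exists2 C, 0 <= C & forall y z, f y + \sum_j (z - y) ord0 j * 'D_(e_ j) f y -
    C * enorm (z - y) `^ (1 + alpha) <= f z.
Proof.
move=> a0 [df hf]; have [C hC] := choice (fun j : 'I_n => hf (e_ j)).
exists (\sum_j `|C j|); first by apply: sumr_ge0.
move=> y z; set h := z - y.
have zE : z = y + (1 : R) *: h by rewrite scale1r /h addrC subrK.
have d1 (t : R) : t \in `]0, 1[%R -> is_derive t 1 (fun u : R => f (y + u *: h)) ('D_h f (y + t *: h)).
  by move=> _; exact: derive_line.
have c1 : {within `[(0:R), 1], continuous (fun u : R => f (y + u *: h))}.
  apply: continuous_subspaceT => t; apply: differentiable_continuous.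
  by apply/derivable1_diffP; have [] := derive_line (df (y + t *: h)).
have [t t01] := MVT ltr01 d1 c1.
rewrite subr0 mulr1 scale0r addr0 -zE => hmvt.
rewrite (_ : f z = f y + 'D_h f (y + t *: h)); last by rewrite -hmvt addrC subrK.
rewrite -addrA lerD2l derive_sum_coord// lerBlDr -lerBlDl -sumrB mulr_suml.
apply: ler_sum => j _; rewrite -mulrBr.
apply: le_trans (ler_norm _) _; rewrite normrM.
have t1 : 0 <= t <= 1 by move: t01; rewrite in_itv /= => /andP[/ltW -> /ltW ->].
have := hC j y (y + t *: h); rewrite (_ : y - (y + t *: h) = - t *: h); last first.
  by rewrite opprD addrA subrr add0r scaleNr.
have tt0 : 0 <= t by case/andP: t1.
rewrite enormZ normrN (ger0_norm tt0).
move=> hj.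
have th : t * enorm h <= enorm h by rewrite ler_piMl ?enorm_ge0//; case/andP: t1.
have hj' : `|'D_(e_ j) f y - 'D_(e_ j) f (y + t *: h)| <= `|C j| * enorm h `^ alpha.
  apply: le_trans hj _; apply: (@le_trans _ _ (`|C j| * (t * enorm h) `^ alpha)).
    by rewrite ler_wpM2r ?powR_ge0// ler_norm.
  by rewrite ler_wpM2l// powR_le_mono ?mulr_ge0 ?enorm_ge0 ?(ltW a0).
rewrite powR1D ?enorm_ge0// mulrCA; apply: ler_pM => //.
exact: coord_enorm.
Qed.

Lemma dot_mx (x y : V) : dot x y = (x *m y^T) ord0 ord0.
Proof. by rewrite mxE; apply: eq_bigr => i _; rewrite mxE. Qed.

Lemma dot_mulmx (x y : V) (Q : 'M[R]_n) : dot (x *m Q) y = dot x (y *m Q^T).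
Proof. by rewrite !dot_mx trmx_mul trmxK mulmxA. Qed.

Lemma enorm_mulmx (x : V) (Q : 'M[R]_n) : Q *m Q^T = 1%:M -> enorm (x *m Q) = enorm x.
Proof.
move=> hQ; apply/eqP; rewrite -(eqrXn2 (ltn0Sn 1)) ?enorm_ge0// !enorm_sq.
by rewrite dot_mulmx -mulmxA hQ mulmx1.
Qed.

Lemma dot_delta (x : V) i : dot x (e_ i) = x ord0 i.
Proof.
rewrite /dot (bigD1 i)//= big1 ?addr0 => [|j ji]; rewrite mxE eqxx.
  by rewrite eqxx mulr1.
by rewrite (negbTE ji) mulr0.
Qed.

Lemma addZ_delta (x : V) (t : R) i : (x + t *: e_ i) ord0 i = x ord0 i + t.
Proof. by rewrite !mxE !eqxx mulr1. Qed.

Lemma enorm_delta i : enorm (e_ i) = 1.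
Proof.
apply/eqP; rewrite -(eqrXn2 (ltn0Sn 1)) ?enorm_ge0// enorm_sq dot_delta mxE !eqxx.
by rewrite expr1n.
Qed.

Lemma vertical_derive (g : V -> R) i y :
  (forall z t, g z = g (z + (t - z ord0 i) *: e_ i)) -> 'D_(e_ i) g y = 0.
Proof.
move=> hg; rewrite /derive (_ : (fun _ => _) = cst 0) ?lim_cst//.
apply/funext => u /=; rewrite (_ : g (u *: e_ i + y) = g y) ?subrr ?scaler0//.
by rewrite (hg y (y ord0 i + u)); congr g; apply/rowP => j; rewrite !mxE; ring.
Qed.

Lemma continuous_enorm_ball (g : V -> R) (x : V) e : {for x, continuous g} -> 0 < e ->
  exists2 r, 0 < r & forall y, enorm (x - y) < r -> `|g x - g y| < e.
Proof.
move=> /cvgrPdist_lt hg e0; have /nbhs_ballP[r /= r0 hr] := hg e e0.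
exists r => // y hy; apply: hr; split => // i j; rewrite ord1.
by apply: le_lt_trans hy; have := coord_enorm (x - y) j; rewrite !mxE.
Qed.

(* Around a boundary point, the points of [S] lie vertically below points [p] of the
   graph of [g], and the region above a [C^{1,alpha}] paraboloid with vertex [p] lies in [S]. *)
Lemma graph_interior_paraboloid (S : set V) (alpha : R) : 0 < alpha -> open S ->
  C1alpha_boundary alpha S -> bdry S 0 ->
  exists C c, [/\ 0 <= C, 0 < c & forall eta, 0 < eta -> exists2 delta, 0 < delta &
    forall x, S x -> enorm x < delta -> exists p nu,
    [/\ enorm nu = 1, forall z, C * enorm (z - p) `^ (1 + alpha) < dot nu (z - p) -> S z,
        enorm p <= 1, 0 < enorm (x - p) <= eta & c * enorm (x - p) <= dot nu (x - p)]].
Proof.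
move=> a0 oS bS S0; have [r [Q [i [g [r0 [hQ [hg [ig hS]]]]]]]] := bS _ S0.
have hQ' : Q^T *m Q = 1%:M by apply: mulmx1C.
have [dg holg] := hg.
(* Otherwise [0] would be an interior point of [S]. *)
have g0 : g 0 <= 0.
  rewrite leNgt; apply/negP => h; case: S0 => _; apply.
  apply: open_nbhs_nbhs; split => //; apply/(hS 0); first by rewrite subr0 enorm0.
  by rewrite subr0 mul0mx mxE.
have [C1 C10 hT] := holder_taylor a0 hg.
have [K hK] := choice (fun j : 'I_n => holg (e_ j)).
(* Gradient at [y] of [z |-> g z - z_i], which is positive exactly on [S] in the chart. Its [i]-th
   entry is [-1], as [g] does not depend on [z_i]. *)
pose a (y : V) : V := \row_j 'D_(e_ j) g y - e_ i.
pose M := 1 + \sum_j (`|'D_(e_ j) g 0| + `|K j|).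
pose A := 1 + Num.sqrt n%:R * M.
have sM : 0 <= \sum_j (`|'D_(e_ j) g 0| + `|K j|) by apply: sumr_ge0 => j _; rewrite addr_ge0.
have M0 : 0 <= M by rewrite addr_ge0.
have A0 : 0 < A by rewrite ltr_pwDl// mulr_ge0// sqrtr_ge0.
have aA y : enorm y <= 1 -> enorm (a y) <= A.
  move=> y1; apply: (@le_trans _ _ (Num.sqrt n%:R * M)); last by rewrite lerDr.
  apply: enorm_coord_le => j; rewrite !mxE.
  apply: le_trans (ler_normB _ _) _; rewrite /M addrC; apply: lerD.
    by rewrite normr_nat; case: (_ && _); rewrite ?lexx ?ler01.
  rewrite (bigD1 j)//=; apply: (@le_trans _ _ (`|'D_(e_ j) g 0| + `|K j|)); last first.
    by rewrite lerDl; apply: sumr_ge0 => k _; rewrite addr_ge0.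
  rewrite -[X in `|X|](subrK ('D_(e_ j) g 0)) addrC; apply: le_trans (ler_normD _ _) _.
  rewrite lerD2l; apply: le_trans (hK j _ _) _; rewrite subr0.
  apply: (@le_trans _ _ (`|K j| * enorm y `^ alpha)).
    by rewrite ler_wpM2r ?powR_ge0// ler_norm.
  rewrite ler_piMr//; have -> : 1 = 1 `^ alpha :> R by rewrite powR1.
  by apply: powR_le_mono; rewrite ?enorm_ge0// ltW.
have ai y : a y ord0 i = -1.
  by rewrite !mxE !eqxx (vertical_derive _ ig) sub0r.
have a1 y : 1 <= enorm (a y).
  by have := coord_enorm (a y) i; rewrite ai normrN normr1.
have hG y z : (g y - y ord0 i) + dot (a y) (z - y) - C1 * enorm (z - y) `^ (1 + alpha) <= g z - z ord0 i.
  have E : dot (a y) (z - y) = \sum_j (z - y) ord0 j * 'D_(e_ j) g y - (z - y) ord0 i.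
    rewrite /a dotBl [dot (e_ i) _]dotC dot_delta; congr (_ - _).
    by apply: eq_bigr => j _; rewrite mxE mulrC.
  have := hT y z; rewrite E [(z - y) ord0 i]mxE [(- y) ord0 i]mxE.
  move: (\sum_j _) (C1 * _); clear -a0 => *; lra.
(* [C1] is the Taylor constant. Where the paraboloid inequality holds at distance [rho] one has
   [C rho^(1 + alpha) < rho], so the second summand forces [rho < r / 2]: the paraboloid region
   cannot leave the chart. *)
pose C := C1 + (2 / r) `^ alpha.
have C0 : 0 <= C by rewrite addr_ge0 ?powR_ge0.
exists C, A^-1; split => //; first by rewrite invr_gt0.
move=> eta eta0.
pose eta' := Num.min eta (Num.min (r / 8) (1 / 4)).
have e0 : 0 < eta' by rewrite !lt_min eta0 !divr_gt0.
have e1 : eta' <= eta by rewrite ge_min lexx.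
have e2 : eta' <= r / 8 by rewrite !ge_min lexx !orbT.
have e3 : eta' <= 1 / 4 by rewrite !ge_min lexx !orbT.
have [e ep he] := continuous_enorm_ball (differentiable_continuous (dg 0)) (divr_gt0 e0 (ltr0n R 2)).
exists (Num.min e (eta' / 2)); first by rewrite lt_min ep divr_gt0.
move=> x Sx; rewrite lt_min => /andP[xe xeta].
pose z := x *m Q; have zx : enorm z = enorm x by exact: enorm_mulmx.
have xr : enorm (x - 0) < r by rewrite subr0; move: xeta e2 r0; clear -a0 => *; lra.
have zi : z ord0 i < g z by have /(hS x xr) := Sx; rewrite subr0.
(* Vertical distance from [z] to the graph; it is small since [g 0 <= 0] and [g] is continuous at
   [0]. *)
pose t := g z - z ord0 i; have t0 : 0 < t by rewrite subr_gt0.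
have te : t <= eta'.
  have h1 : `|g 0 - g z| < eta' / 2 by apply: he; rewrite sub0r enormN zx.
  have h2 := coord_enorm z i; rewrite zx in h2.
  move: h1 h2; rewrite ltr_norml ler_norml => /andP[h1 _] /andP[h2 _].
  by rewrite /t; move: h1 h2 g0 xeta; move: (g 0) (g z) (enorm x) (z ord0 i); clear -a0 => *; lra.
pose y := z + t *: e_ i.
have gy : g y = g z by rewrite (ig z (z ord0 i + t)) addrAC subrr add0r.
have yi : y ord0 i = g z by rewrite /y addZ_delta /t addrC subrK.
have zy : z - y = - t *: e_ i by rewrite /y opprD addrA subrr add0r scaleNr.
have y2 : enorm y <= 2 * eta'.
  apply: le_trans (enormD _ _) _; rewrite enormZ enorm_delta mulr1 gtr0_norm// zx.
  move: te xeta e0; move: (enorm x); clear -a0 => *; lra.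
have y1 : enorm y <= 1 by move: y2 e3; move: (enorm y); clear -a0 => *; lra.
pose p := y *m Q^T.
have hQT : Q^T *m (Q^T)^T = 1%:M by rewrite trmxK.
have py : enorm p = enorm y by exact: enorm_mulmx.
have ay0 : 0 < enorm (a y) by apply: lt_le_trans (a1 y).
pose nu := (enorm (a y))^-1 *: (a y *m Q^T).
have dnu w : dot nu (w - p) = (enorm (a y))^-1 * dot (a y) (w *m Q - y).
  by rewrite dotZl dot_mulmx trmxK mulmxBl -mulmxA hQ' mulmx1.
have nrm w : enorm (w - p) = enorm (w *m Q - y).
  by rewrite -(enorm_mulmx _ hQ) mulmxBl -mulmxA hQ' mulmx1.
exists p, nu; split.
- by rewrite enormZ gtr0_norm ?invr_gt0// (enorm_mulmx _ hQT) mulVf// gt_eqF.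
- move=> w; rewrite dnu nrm; set W := w *m Q; set rho := enorm (W - y) => hw.
  have rho0 : 0 <= rho by exact: enorm_ge0.
  set D := dot (a y) (W - y) in hw.
  have Cq : 0 <= C * rho `^ (1 + alpha) by rewrite mulr_ge0 ?powR_ge0.
  have D0 : 0 < D by have := le_lt_trans Cq hw; rewrite pmulr_rgt0 ?invr_gt0.
  have DD : (enorm (a y))^-1 * D <= D by rewrite ler_piMl ?(ltW D0)// invf_le1.
  have Drho : (enorm (a y))^-1 * D <= rho.
    rewrite mulrC ler_pdivrMr// mulrC; apply: le_trans (ler_norm _) _; exact: cauchy_schwarz.
  have rhop : 0 < rho.
    rewrite lt_neqAle rho0 andbT eq_sym; apply/eqP => h; have := lt_le_trans hw Drho.
    by rewrite h ltNge => /negP; apply; rewrite mulr_ge0 ?powR_ge0.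
  have rhor : rho < r / 2.
    rewrite ltNge; apply/negP => h.
    have h1 : C * rho `^ alpha < 1.
      rewrite -(ltr_pM2l rhop) mulr1; apply: le_lt_trans (lt_le_trans hw Drho).
      by rewrite powR1D// mulrCA.
    have h2 : 1 <= (2 / r) `^ alpha * rho `^ alpha.
      rewrite -powRM ?divr_ge0 ?(ltW r0)//; apply: (@le_trans _ _ (1 `^ alpha)); first by rewrite powR1.
      apply: powR_le_mono; rewrite ?(ltW a0)//.
      by rewrite mulrAC ler_pdivlMr// mul1r mulrC -ler_pdivrMr.
    move: h1; rewrite ltNge => /negP; apply; apply: le_trans h2 _.
    by rewrite ler_wpM2r ?powR_ge0// lerDr.
  have wr : enorm (w - 0) < r.
    rewrite subr0 -(enorm_mulmx _ hQ) -/W -(subrK y W).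
    apply: le_lt_trans (enormD _ _) _.
    by move: rhor y2 e2 r0; rewrite -/rho; move: (enorm y); clear -a0 => *; lra.
  apply/(hS w wr); rewrite subr0 -/W -subr_gt0; apply: lt_le_trans (hG y W).
  rewrite gy yi subrr add0r -/rho subr_gt0.
  apply: le_lt_trans (lt_le_trans hw DD).
  by rewrite ler_wpM2r ?powR_ge0// lerDl powR_ge0.
- by rewrite py.
- rewrite nrm -/z zy enormZ enorm_delta mulr1 normrN gtr0_norm// t0.
  exact: le_trans te e1.
- rewrite dnu nrm -/z zy enormZ enorm_delta mulr1 normrN gtr0_norm// dotZr dot_delta ai mulrNN mulr1.
  by rewrite ler_wpM2r ?(ltW t0)// lef_pV2 ?posrE// aA.
Qed.

End Graph.

(** * Bump functions *)

Section Flat.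
Context {R : realType}.

(** The functions [t^(-k) exp(- 1 / t)], extended by [0]: differentiation stays in their linear
    span, which gives smoothness without formulas for higher derivatives. *)
Definition flat (k : nat) (t : R) : R := if 0 < t then t^-1 ^+ k * expR (- t^-1) else 0.

Lemma flat_ge0 k t : 0 <= flat k t.
Proof.
rewrite /flat; case: ltrP => // t0; rewrite mulr_ge0 ?expR_ge0// exprn_ge0// invr_ge0.
exact: ltW.
Qed.

Lemma flat_le k t : flat k t <= k.+1`!%:R * `|t|.
Proof.
rewrite /flat; case: ltrP => [t0|_]; last by rewrite mulr_ge0.
rewrite expRN ler_pdivrMr ?expR_gt0// gtr0_norm//.
have u0 : 0 <= t^-1 by rewrite invr_ge0 ltW.
have f0 : 0 < k.+1`!%:R :> R by rewrite ltr0n fact_gt0.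
have h : t^-1 ^+ k.+1 / k.+1`!%:R <= expR t^-1.
  by apply: le_trans (expR_ge1Dxn k u0); rewrite lerDr.
rewrite ler_pdivrMr// in h.
have -> : t^-1 ^+ k = t * t^-1 ^+ k.+1 by rewrite exprS mulrA mulfV ?gt_eqF// mul1r.
rewrite (_ : _ * _ * _ = t * (expR t^-1 * k.+1`!%:R)); last by ring.
by rewrite ler_wpM2l// ltW.
Qed.

Lemma flatS k t : flat k t = t * flat k.+1 t.
Proof.
rewrite /flat; case: ltrP => t0; last by rewrite mulr0.
by rewrite exprS !mulrA mulfV ?gt_eqF// mul1r.
Qed.

Lemma is_derive_flat k (t : R) : is_derive t 1 (flat k) (flat k.+2 t - k%:R * flat k.+1 t).
Proof.
have [t0|t0|->] := ltrgtP t 0.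
- have -> : flat k.+2 t - k%:R * flat k.+1 t = 0 by rewrite /flat !ltNge (ltW t0) mulr0 subrr.
  have dc : is_derive t (1 : R) (cst (0 : R)) (0 : R) by exact: is_derive_cst.
  apply: (near_eq_is_derive _ dc).
    near=> z; rewrite /flat ltNge; suff -> : z <= 0 by [].
    by apply: ltW; near: z; exact: lt_nbhsl.
- apply: (@near_eq_is_derive _ _ _ (fun z : R => z^-1 ^+ k * expR (- z^-1))).
    near=> z; rewrite /flat; suff -> : 0 < z by [].
    by near: z; exact: lt_nbhsr.
  have dV : is_derive t 1 (fun z : R => z^-1) (- t ^- 2 *: 1).
    by apply: is_deriveV; rewrite gt_eqF.
  have dX := is_deriveX k dV.
  have dE : is_derive t 1 (expR \o (fun z : R => - z^-1)) (expR (- t^-1) * - (- t ^- 2 *: 1)).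
    exact: (is_derive1_comp (is_derive_expR _) (is_deriveN dV)).
  have -> : (fun z : R => z^-1 ^+ k * expR (- z^-1)) =
      ((fun z : R => z^-1) ^+ k) * (expR \o (fun z : R => - z^-1)).
    by apply/funext => z; rewrite !fctE.
  apply: is_derive_eq (is_deriveM dX dE) _.
  rewrite /flat t0 /GRing.scale /= mulr1 fctE.
  case: (k) => [|j]; first by rewrite !expr0 !mul0r; field; rewrite gt_eqF.
  by rewrite /= -!exprVn !exprS; ring.
(* At [0] the difference quotient of [flat k] is [flat k.+1], which is bounded by a multiple of
   [|t|] and so tends to [0]. *)
- apply/is_derive1_caratheodory; exists (flat k.+1); split.
  + by move=> z; rewrite subr0 {2}/flat ltxx subr0 flatS mulrC.
  + apply/cvgrPdist_lt => e e0; apply/nbhs_ballP; exists (k.+2`!%:R^-1 * e) => /=.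
      by rewrite mulr_gt0// invr_gt0 ltr0n fact_gt0.
    move=> z; rewrite /ball_ /= sub0r normrN => hz.
    rewrite {1}/flat ltxx sub0r normrN ger0_norm ?flat_ge0//.
    by apply: le_lt_trans (flat_le _ _) _; rewrite -ltr_pdivlMl ?ltr0n ?fact_gt0.
  + by rewrite /flat ltxx mulr0 subrr.
Unshelve. all: by end_near. Qed.

Lemma flat_le1 t : flat 0 t <= 1.
Proof.
rewrite /flat; case: ltrP => // t0; rewrite expr0 mul1r -expR0 ler_expR oppr_le0 invr_ge0.
exact: ltW.
Qed.

Lemma flat_neq0 k t : (flat k t != 0) = (0 < t).
Proof.
rewrite /flat; case: ltrP => [t0|_]; last by rewrite eqxx.
by rewrite gt_eqF// mulr_gt0 ?expR_gt0// exprn_gt0// invr_gt0.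
Qed.

End Flat.

Section Generated.
Context {R : realType}.
Variable n : nat.
Local Notation V := 'rV[R]_n.

(** The algebra generated by [B], the constants and the coordinates. If it contains the derivatives
    of [B], it is closed under differentiation, and smoothness follows by induction on the order.
    With empty [B] it consists of the polynomials. *)
Inductive gen (B : (V -> R) -> Prop) : (V -> R) -> Prop :=
| gen_base f of B f : gen B f
| gen_cst c : gen B (fun=> c)
| gen_coord i : gen B (fun x => x ord0 i)
| gen_add f g of gen B f & gen B g : gen B (fun x => f x + g x)
| gen_mul f g of gen B f & gen B g : gen B (fun x => f x * g x).

Definition derivation_closed (B P : (V -> R) -> Prop) :=
  forall f, B f -> (forall x, differentiable f x) /\ forall v, P ('D_v f).

Lemma derive_coord (v x : V) i : 'D_v (fun y : V => y ord0 i) x = v ord0 i.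
Proof.
apply: cvg_lim => //; apply: cvg_near_cst; near=> h.
have h0 : h != 0 by near: h; exact: nbhs_dnbhs_neq.
by rewrite /= !mxE addrK /GRing.scale /= mulrA mulVf// mul1r.
Unshelve. all: by end_near. Qed.

Lemma gen_closed B : derivation_closed B (gen B) -> derivation_closed (gen B) (gen B).
Proof.
move=> hB f; elim=> {f} [f /hB//|c|i|f g _ [df hf] _ [dg hg]|f g Gf [df hf] Gg [dg hg]].
- split=> [x|v]; first exact: differentiable_cst.
  rewrite (_ : 'D_v _ = fun=> 0); first exact: gen_cst.
  by apply/funext => x; exact: derive_cst.
- split=> [x|v]; first exact: differentiable_coord.
  rewrite (_ : 'D_v _ = fun=> v ord0 i); first exact: gen_cst.
  by apply/funext => x; exact: derive_coord.
- split=> [x|v]; first exact: differentiableD.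
  rewrite (_ : 'D_v _ = fun x => 'D_v f x + 'D_v g x); first exact: gen_add.
  by apply/funext => x; apply: deriveD; exact: diff_derivable.
- split=> [x|v]; first exact: differentiableM.
  rewrite (_ : 'D_v _ = fun x => f x * 'D_v g x + g x * 'D_v f x).
    by apply: gen_add; exact: gen_mul.
  by apply/funext => x; apply: deriveM; exact: diff_derivable.
Qed.

Lemma gen_sum B I (r : seq I) (F : I -> V -> R) : (forall i, gen B (F i)) ->
  gen B (fun x => \sum_(i <- r) F i x).
Proof.
move=> hF; elim: r => [|i r IH].
  rewrite (_ : (fun _ => _) = fun=> 0); first exact: gen_cst.
  by apply/funext => x; rewrite big_nil.
rewrite (_ : (fun _ => _) = fun x => F i x + \sum_(i <- r) F i x); first exact: gen_add.
by apply/funext => x; rewrite big_cons.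
Qed.

Lemma gen_smooth B : derivation_closed B (gen B) -> forall f, gen B f -> smooth f.
Proof.
move=> /gen_closed hB f Gf k; elim: k f Gf => [|k IH] f Gf; have [df hf] := hB f Gf.
  by move=> x; exact: differentiable_continuous.
by split => // v; exact: IH.
Qed.

Lemma gen_sub B f : gen (fun=> False) f -> gen B f.
Proof.
by elim=> {f} [//|c|i|f g _ Gf _ Gg|f g _ Gf _ Gg]; [exact: gen_cst|exact: gen_coord|exact: gen_add|exact: gen_mul].
Qed.

(** The generators are all [flat k] composed with [rho]: the chain rule raises [k] and multiplies by
    a derivative of [rho], which is again a polynomial. *)
Lemma smooth_flat_comp (rho : V -> R) (c : R) : gen (fun=> False) rho -> smooth (fun x => c * flat 0 (rho x)).
Proof.
move=> Grho; have h0 : derivation_closed (fun=> False) (gen (fun=> False)) by [].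
have [drho hrho] := gen_closed h0 Grho.
pose B := [set f : V -> R | exists k, f = fun x => flat k (rho x)].
have hB : derivation_closed B (gen B).
  move=> _ [k ->].
  have dk x : differentiable (flat k) (rho x).
    by apply/derivable1_diffP; have [] := is_derive_flat k (rho x).
  have dc x : differentiable (flat k \o rho) x by exact: differentiable_comp.
  split => // v.
  rewrite (_ : 'D_v _ = fun x => (flat k.+2 (rho x) + - k%:R * flat k.+1 (rho x)) * 'D_v rho x).
    apply: gen_mul; last by apply: gen_sub.
    apply: gen_add; first by apply: gen_base; exists k.+2.
    by apply: gen_mul; [exact: gen_cst|apply: gen_base; exists k.+1].
  apply/funext => x; change ('D_v (flat k \o rho) x = (flat k.+2 (rho x) + - k%:R * flat k.+1 (rho x)) * 'D_v rho x).
  rewrite (deriveE _ (dc x)).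
  rewrite diff_comp//= deriv1E; last by apply/derivable1_diffP.
  rewrite derive1E (@derive_val _ _ _ _ _ _ _ (is_derive_flat k (rho x))) deriveE//.
  by rewrite /GRing.scale /= mulNr mulrC.
apply: (gen_smooth hB); apply: gen_mul; first exact: gen_cst.
by apply: gen_base; exists 0%N.
Qed.

End Generated.

Section Bump.
Context {R : realType}.
Variable n' : nat.
Local Notation n := n'.+1.
Local Notation V := 'rV[R]_n.

Lemma gen_dot (p : V) : gen (fun=> False) (fun x : V => dot (x - p) (x - p)).
Proof.
have -> : (fun x : V => dot (x - p) (x - p)) =
    (fun x => \sum_(i < n) (x ord0 i + - p ord0 i) * (x ord0 i + - p ord0 i)).
  by apply/funext => x; apply: eq_bigr => i _; rewrite !mxE.
by apply: gen_sum => i; apply: gen_mul; (apply: gen_add; [exact: gen_coord|exact: gen_cst]).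
Qed.

Lemma gen_paraboloid (p : V) : gen (fun=> False) (fun x : V => 1 - dot (x - p) (x - p)).
Proof.
have -> : (fun x : V => 1 - dot (x - p) (x - p)) = (fun x => 1 + -1 * dot (x - p) (x - p)).
  by apply/funext => x; rewrite mulN1r.
apply: gen_add; first exact: gen_cst.
apply: gen_mul; [exact: gen_cst|exact: gen_dot].
Qed.

Lemma closed_enorm_le (p : V) (M : R) : closed [set x : V | enorm (x - p) <= M].
Proof.
have h0 : derivation_closed (fun=> False) (@gen R n (fun=> False)) by [].
have c : continuous (fun x : V => dot (x - p) (x - p)) by exact: (gen_smooth h0 (gen_dot p) 0).
have [M0|M0] := lerP 0 M; last first.
  rewrite (_ : [set _ | _] = set0); first exact: closed0.
  by apply/seteqP; split => // x /= h; have := le_lt_trans (le_trans (enorm_ge0 _) h) M0; rewrite ltxx.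
have -> : [set x : V | enorm (x - p) <= M] =
    (fun x : V => dot (x - p) (x - p)) @^-1` [set t | t <= M ^+ 2].
  apply/seteqP; split => x /=; rewrite -enorm_sq => h.
    by rewrite ler_pXn2r// ?nnegrE ?enorm_ge0.
  by rewrite -(ler_pXn2r (ltn0Sn 1)) ?nnegrE ?enorm_ge0.
by apply: closed_comp => [x _|]; [exact: c|exact: closed_le].
Qed.

Lemma compact_enorm_le (M : R) : compact [set x : V | enorm (x - 0) <= M].
Proof.
have cB : compact [set x : V | forall i, `[- M, M]%classic (x ord0 i)].
  by apply: (@rV_compact R n (fun=> `[- M, M]%classic)) => _; exact: segment_compact.
apply: (subclosed_compact (@closed_enorm_le 0 M) cB) => x /= h i.
rewrite in_itv /= -ler_norml; apply: le_trans h; rewrite subr0; exact: coord_enorm.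
Qed.

Lemma exists_bump (omega : set V) (eps : R) : ebounded omega -> 0 < eps ->
  exists psi : V -> R, [/\ Cinf0 (~` closure omega) eps psi,
    forall x y, psi x != 0 -> omega y -> 1 <= enorm (x - y) &
    exists h0 rb (Z : 'rV[R]_n.+1), [/\ 0 < h0, 0 < rb, scube Z rb `<=` lower_set omega psi &
      forall Y : 'rV[R]_n.+1, scube Z rb Y -> h0 <= xl Y]].
Proof.
move=> [M0 hM0] eps0; pose M : R := `|M0|.
have M_ge : 0 <= M by exact: normr_ge0.
have hM x : omega x -> enorm x <= M by move=> /hM0 h; apply: le_trans h (ler_norm _).
(* The unit ball around this centre keeps distance at least [1] from the ball of radius [M], which
   contains [omega]. *)
pose p : V := (M + 2) *: delta_mx ord0 ord0.
have M2 : 0 <= M + 2 by rewrite addr_ge0.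
have pM : enorm p = M + 2 by rewrite /p enormZ enorm_delta mulr1 ger0_norm.
pose rho (x : V) : R := 1 - dot (x - p) (x - p).
pose psi (x : V) : R := eps * flat 0 (rho x).
have supp x : psi x != 0 -> enorm (x - p) <= 1.
  rewrite mulf_eq0 negb_or flat_neq0 subr_gt0 -enorm_sq => /andP[_ h].
  by rewrite -(ler_pXn2r (ltn0Sn 1)) ?nnegrE ?enorm_ge0 ?ler01// expr1n ltW.
have farp x : enorm (x - p) <= 1 -> M + 1 <= enorm x.
  move=> h; have := enormD (p - x) x; rewrite subrK pM enormBC; move: h.
  move: (enorm (x - p)) (enorm x); clear => *; lra.
have clo : closure [set x | psi x != 0] `<=` [set x | M + 1 <= enorm x /\ enorm x <= M + 3].
  have cp : closed [set x : V | enorm (x - p) <= 1] by exact: closed_enorm_le.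
  have sub : [set x | psi x != 0] `<=` [set x : V | enorm (x - p) <= 1] by move=> x; exact: supp.
  move=> x /(closureS sub); rewrite -(proj1 (closure_id _) cp) => h.
  split; first exact: farp.
  have := enormD (x - p) p; rewrite subrK pM; move: h => /=.
  move: (enorm (x - p)) (enorm x); clear => *; lra.
have cM : closure omega `<=` [set x | enorm (x - 0) <= M].
  have cc : closed [set x : V | enorm (x - 0) <= M] by exact: closed_enorm_le.
  by rewrite (proj1 (closure_id _) cc); apply: closureS => x /hM; rewrite /= subr0.
exists psi; split.
- split; first exact: smooth_flat_comp (gen_paraboloid p).
  split.
    have cl : closed (closure [set x : V | psi x != 0]) by exact: closed_closure.
    have sb : closure [set x : V | psi x != 0] `<=` [set x : V | enorm (x - 0) <= M + 3].
      by move=> x /clo[]; rewrite /= subr0.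
    exact: (subclosed_compact cl (@compact_enorm_le (M + 3)) sb).
  split.
    by move=> x /clo[h _] /cM /=; rewrite subr0 => h'; have := le_trans h h'; rewrite gerDl ler10.
  by move=> x; rewrite mulr_ge0 ?flat_ge0 ?(ltW eps0)//= -[leRHS]mulr1 ler_wpM2l ?flat_le1// ltW.
- move=> x y /supp /farp hx /hM hy.
  have := enormD (x - y) y; rewrite subrK; move: hx hy.
  move: (enorm (x - y)) (enorm x) (enorm y); clear => *; lra.
(* Within distance [1 / 2] of [p] one has [rho >= 1 / 2], hence [psi >= kap]. A cube centred at
   height [kap / 2] with half-side at most [kap / 4] fits under the graph and stays above height
   [kap / 4]. *)
pose kap : R := eps * expR (- 2).
have kap0 : 0 < kap by rewrite mulr_gt0 ?expR_gt0.
pose sm : R := Num.sqrt n%:R.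
have sm0 : 0 < sm by rewrite sqrtr_gt0.
pose rb : R := Num.min (kap / 4) (1 / (2 * sm)).
have rb0 : 0 < rb by rewrite lt_min !divr_gt0// mulr_gt0.
have rbk : rb <= kap / 4 by rewrite ge_min lexx.
have rbs : sm * rb <= 1 / 2.
  have h : rb <= 1 / (2 * sm) by rewrite ge_min lexx orbT.
  apply: le_trans (ler_wpM2l (ltW sm0) h) _; apply: eq_ler; field; exact: lt0r_neq0.
exists (kap / 4), rb, (ext_row p (kap / 2)); split => //; first by rewrite divr_gt0.
  move=> Y hY; right.
  have xlY : xl Y <= 3 / 4 * kap.
    have := hY ord_max; rewrite -/(xl _) xl_ext -/(xl Y) ler_norml => /andP[_].
    move: rbk; clear => *; lra.
  have xp : enorm (xh Y - p) <= 1 / 2.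
    apply: le_trans rbs; apply: enorm_coord_le => i.
    have xhi (X : 'rV[R]_n.+1) : xh X ord0 i = X ord0 (widen_ord (leqnSn n) i) by rewrite mxE.
    have -> : (xh Y - p) ord0 i = xh Y ord0 i - xh (ext_row p (kap / 2)) ord0 i.
      by rewrite xh_ext mxE [(- p) _ _]mxE.
    rewrite !xhi; exact: hY.
  have rho2 : 1 / 2 <= rho (xh Y).
    rewrite /rho -enorm_sq; have := enorm_ge0 (xh Y - p); move: xp.
    move: (enorm (xh Y - p)); clear => x *.
    have : x * x <= 1 / 2 * (1 / 2) by apply: ler_pM.
    rewrite expr2; lra.
  split; last first.
    move=> /hM; have : enorm (xh Y - p) <= 1 by move: xp; move: (enorm (xh Y - p)); clear => *; lra.
    by move=> /farp h1 h2; have := le_trans h1 h2; rewrite gerDl ler10.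
  apply: le_lt_trans xlY _; apply: (@lt_le_trans _ _ kap); first by move: kap0; clear => *; lra.
  rewrite /kap /psi ler_wpM2l ?(ltW eps0)// /flat.
  have r0 : 0 < rho (xh Y) by apply: lt_le_trans rho2.
  rewrite r0 expr0 mul1r ler_expR lerN2 -[leRHS]invrK lef_pV2 ?posrE// ?invr_gt0//.
  by rewrite -div1r.
move=> Y hY; have := hY ord_max; rewrite -/(xl _) xl_ext -/(xl Y) ler_norml => /andP[h _].
move: h rbk; clear => *; lra.
Qed.

End Bump.

(** * Countable cover by rational cubes, and the conclusion *)

Section Cover.
Context {R : realType}.

Lemma measurable_ratbox m (r : 'rV[rat]_m * nat) : measurable (ratbox r : set (rowT R m)).
Proof.
rewrite (_ : ratbox r = \big[setI/setT]_(i < m)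
   [set x : rowT R m | `|ratr (r.1 ord0 i) - x ord0 i| < r.2.+1%:R^-1]); last first.
  rewrite -bigcap_seq; apply/seteqP; split => x /= h => [i _|i]; first exact: h.
  by apply: h; rewrite /= mem_index_enum.
apply: bigsetI_measurable => i _; apply: measurable_ltr_set => //.
apply: measurableT_comp => //; apply: measurable_funB => //; exact: measurable_coord.
Qed.

Lemma ratbox_near m (X : 'rV[R]_m) (e : R) : 0 < e -> exists2 r : 'rV[rat]_m * nat,
  ratbox r X & forall Y, ratbox r Y -> enorm (X - Y) <= e.
Proof.
move=> e0; pose sm : R := Num.sqrt m%:R + 1.
have sm0 : 0 < sm by rewrite ltr_wpDl// sqrtr_ge0.
have es : 0 < e / sm by rewrite divr_gt0.
have oB : open (ball X (e / sm)) by exact: ball_open.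
have [r [rX rU]] := open_ratbox oB (ballxx X es).
exists r => // Y /rU [_ hY].
apply: (@le_trans _ _ (Num.sqrt m%:R * (e / sm))).
  by apply: enorm_coord_le => i; rewrite !mxE; apply: ltW; exact: hY.
rewrite mulrCA ler_piMr ?(ltW e0)// ler_pdivrMr// mul1r /sm lerDl.
exact: ler01.
Qed.

Variables (n : nat) (omega : set 'rV[R]_n) (psi : 'rV[R]_n -> R) (eps : R).
Variable E : set (rowT R n.+1).
Hypothesis mE : measurable E.
Local Notation filled := (filled omega psi eps E).

(** There are only countably many rational cubes, so the null sets missed by [E] in the filled ones
    add up to a null set. *)
Lemma filled_cover (A : set (rowT R n.+1)) :
  (forall X, A X -> exists r : 'rV[rat]_n.+1 * nat, ratbox r X /\ filled (ratbox r)) ->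
  exists2 B, filled B & A `<=` B.
Proof.
move=> hA.
pose F j : set (rowT R n.+1) := if unpickle j is Some r then
  (if `[< filled (ratbox r) >] then ratbox r else set0) else set0.
have fF j : filled (F j).
  have f0 : filled set0 by split => //; rewrite set0D measure0.
  rewrite /F; case: (unpickle j) => [r|//]; by case: asboolP.
exists (\bigcup_j F j); last first.
  move=> X /hA[r [rX fr]]; exists (pickle r) => //.
  by rewrite /F pickleK asboolT.
have mF : measurable (\bigcup_j F j) by apply: bigcupT_measurable => j; case: (fF j).
split => //.
  by move=> X [j _ FX]; have [_ h _] := fF j; exact: h.
apply: measure_negligible; first exact: measurableD.
rewrite setD_bigcupl; apply: negligible_bigcup => j; have [mj _ h] := fF j.
by apply/negligibleP => //; exact: measurableD.
Qed.

End Cover.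

(** Put [r = |xh X - p|]. The linear part is at least [c r] at [X] and drops by at most [c r / 4] on
    the way to [Y]; the penalty, taken at distance at most [2 r] from the vertex, is at most
    [c r / 4]. *)
Lemma bar_ball (R : realType) n (s alpha b c : R) (X Y : 'rV[R]_n.+1) p nu :
  0 < s -> s < alpha -> alpha < 1 -> 0 <= b -> 0 < c -> enorm nu = 1 ->
  0 < enorm (xh X - p) -> 4 * b * enorm (xh X - p) `^ alpha <= c / 4 ->
  c * enorm (xh X - p) <= dot nu (xh X - p) ->
  enorm (X - Y) <= enorm (xh X - p) -> enorm (X - Y) <= c / 4 * enorm (xh X - p) ->
  0 < bar alpha (slope nu 0) b (base p 0) (base p (xl X)) Y.
Proof.
move=> s0 sa a1 b0 c0 nu1 r0 hb hd h1 h2; set r := enorm (xh X - p) in r0 hb hd h1 h2.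
have XQ : enorm (X - base p (xl X)) <= r.
  apply: le_trans (enorm_le_xhl _) _; rewrite xhB xlB xh_base xl_base subrr normr0 addr0.
  exact: lexx.
have YQ : enorm (Y - base p (xl X)) <= 2 * r.
  apply: le_trans (enormB_tri X _ _) _; rewrite (enormBC Y) mulrDl mul1r.
  exact: lerD h1 XQ.
have pw := powR_double (ltW (lt_trans s0 sa)) (ltW a1) (enorm_ge0 _) (ltW r0) YQ.
rewrite /bar subr_gt0 dot_slope_base mul0r subr0.
have k1 : b * enorm (Y - base p (xl X)) `^ (1 + alpha) <= c / 4 * r.
  apply: le_trans (ler_wpM2l b0 pw) _.
  rewrite (powR1D (lt_trans s0 sa) (ltW r0)).
  rewrite (_ : b * _ = r * (4 * b * r `^ alpha)); last by ring.
  by rewrite mulrC ler_wpM2r// ltW.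
have k2 : dot nu (xh X - p) - enorm (X - Y) <= dot nu (xh Y - p).
  have -> : xh Y - p = (xh X - p) - (xh (X - Y)) by rewrite xhB; apply/rowP => i; rewrite !mxE; ring.
  rewrite [leRHS]dotBr lerD2l lerN2; apply: le_trans (ler_norm _) _.
  apply: le_trans (cauchy_schwarz _ _) _; rewrite nu1 mul1r; exact: enorm_xh_le.
have k3 : 0 < c * r by rewrite mulr_gt0.
have E1 : c / 4 * r = c * r / 4 by ring.
rewrite E1 in k1 h2; move: k1 k2 k3 h2 hd.
move: (b * _) (enorm (X - Y)) (dot nu _) (dot nu _) (c * r); clear => *; lra.
Qed.

Theorem theorem1p5 (R : realType) (n : nat) (s alpha : R)
    (omega S : set 'rV[R]_n) :
  (2 <= n)%N -> 0 < s < 1 ->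
  open omega -> ebounded omega -> lipschitz_boundary (cyl omega) ->
  bdry omega 0 ->
  open S -> ebounded S -> s < alpha < 1 -> C1alpha_boundary alpha S ->
  S `<=` omega -> bdry S 0 ->
  forall eps : R, 0 < eps ->
  exists (delta : R) (psi : 'rV[R]_n -> R) (E : set 'rV[R]_n.+1),
    0 < delta /\
    Cinf0 (~` closure omega) eps psi /\
    lmeasurable E /\
    s_minimal_in s E (cyl omega) /\
    E `\` cyl omega = [set X | xl X < psi (xh X)] `\` cyl omega /\
    [set X | S (xh X) /\ enorm (xh X) < delta /\ 0 <= xl X <= delta]
      `<=` E `&` cyl S.
Proof.
case: n omega S => [//|n] omega S _ /andP[s0 s1] oom bom _ _ oS _ /andP[sa a1] bS Som S0 eps eps0.
have alpha0 : 0 < alpha by exact: lt_trans sa.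
have [psi [cpsi0 sep [h0 [rb [Z [h00 rb0 Zl Zh]]]]]] := exists_bump bom eps0.
have [smp [_ [_ psi_bd]]] := cpsi0.
have cpsi : continuous psi by exact: (smp 0).
have [C [c [C0 c0 hgeo]]] := graph_interior_paraboloid alpha0 oS bS S0.
have [E minE] := exists_obstacle_minimizer s0 s1 oom bom cpsi psi_bd eps0 ltr01 sep.
have mE : measurable E by case: minE => [[]].
have [b [yb [b0 yb0 hfill]]] :=
  filled_vertical s0 s1 sa a1 oom bom cpsi psi_bd eps0 ltr01 sep minE C0 h00 rb0 Zl Zh.
have b40 : 0 < 4 * b + 1 by rewrite ltr_wpDl// mulr_ge0.
(* Close enough to the boundary point the penalty is small against [c]; the summand [1] keeps the
   divisor positive when [b = 0]. *)
have [eta eta0 heta] := small_powR alpha0 (divr_gt0 (divr_gt0 c0 (ltr0n R 4)) b40).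
have [delta d0 hdelta] := hgeo eta eta0.
pose dl := Num.min delta yb.
(* Strictly positive heights, because the vertex of the barrier for [X] is lifted to the height of
   [X]. The slice at height [0] is null and is added separately as [N1]. *)
pose A : set (rowT R n.+2) := [set X | S (xh X) /\ enorm (xh X) < dl /\ 0 < xl X <= dl].
have hA X : A X -> exists r : 'rV[rat]_n.+2 * nat, ratbox r X /\ filled omega psi eps E (ratbox r).
  move=> [SX [Xd /andP[X0 Xl]]].
  have Xd' : enorm (xh X) < delta by apply: lt_le_trans Xd _; rewrite ge_min lexx.
  have Xy : xl X <= yb by apply: le_trans Xl _; rewrite ge_min lexx orbT.
  have [p [nu [nu1 hz p1 /andP[r0 re] hd]]] := hdelta _ SX Xd'.
  have gd : good alpha omega C p nu by split => // z /hz /Som.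
  have fU := hfill _ p nu X0 Xy gd p1.
  set r := enorm (xh X - p) in r0 re hd.
  have e0 : 0 < Num.min r (c / 4 * r) by rewrite lt_min r0 mulr_gt0// divr_gt0.
  have [k kX kY] := ratbox_near X e0.
  exists k; split => //; apply: (filled_sub minE (measurable_ratbox k) _ fU).
  move=> Y /kY; rewrite le_min => /andP[Y1 Y2].
  apply: (bar_ball s0 sa a1 b0 c0 nu1 r0 _ hd Y1 Y2).
  have := heta _ r0 re; rewrite ler_pdivlMr// mulrC; apply: le_trans.
  by rewrite ler_wpM2r ?powR_ge0// lerDl.
have [B [mB BU B0] AB] := filled_cover mE hA.
pose N1 : set (rowT R n.+2) := cyl omega `&` [set X | xl X = 0].
have mN1 : measurable N1.
  by apply: measurableI; [exact: measurable_cyl|exact: measurable_hyperplane].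
pose N : set (rowT R n.+2) := (B `\` E) `|` N1.
have mN : measurable N by apply: measurableU => //; exact: measurableD.
have N0 : rmu R n.+2 N = 0%E.
  apply: measure_negligible => //; apply: negligibleU.
    by apply/negligibleP => //; exact: measurableD.
  apply: (negligibleS (@subIsetr _ _ _)); apply/negligibleP; first exact: measurable_hyperplane.
  exact: hyperplane_null.
have NU : N `<=` upper_set omega psi eps.
  move=> X [[/BU//]|[oX /= X0]]; right; split => //=.
  by rewrite X0 ltW.
(* Adding the null set [N] preserves minimality and turns inclusion almost everywhere into
   inclusion. *)
have minE' := minimizer_ae oom cpsi minE mN N0 NU.
exists dl, psi, (E `|` N); split; first by rewrite lt_min d0.
split; first exact: cpsi0.
split.
  exists (E `|` N), set0; split.
    have : measurable (E `|` N : set (rowT R n.+2)) by exact: measurableU.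
    exact.
  split; first by have : measurable (set0 : set (rowT R n.+2)) by exact: measurable0.
  split; last by rewrite !setDv setU0.
  by rewrite volE// measure0.
split; first exact: (minimizer_s_minimal s0 s1 oom bom cpsi psi_bd eps0 ltr01 sep minE').
split; first exact: minimizer_exterior minE'.
move=> X [SX [Xd /andP[X0 Xl]]]; split => //.
case: (pselect (E X)) => EX; first by left.
right; move: X0; rewrite le_eqVlt => /orP[/eqP X0|X0].
  by right; split; [exact: Som|rewrite /= -X0].
by left; split => //; apply: AB; split => //; split => //; rewrite X0.
Qed.
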